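(* Let $(M,g)$ be a connected $6$-dimensional Riemannian manifold (not necessarily compact) with an $\mathrm{SU}(3)$-structure $(\omega,\Psi^\pm)$ such that $\Psi^-$ is a Killing $3$-form. Then one of the following holds: (a) $(g,\omega)$ is Kähler and the forms $\Psi^+$ and $\Psi^-$ are parallel; or (b) $(g,\omega)$ is strict nearly Kähler and $\Psi^-$ is a constant multiple of $*d\omega$; more precisely $\Psi^-=\frac{1}{3\lambda}*d\omega$ for some constant $\lambda\in\mathbb{R}\setminus\{0\}$ such that the scalar curvature of $g$ equals $30\lambda^2$.
   Context: Let $\nabla$ be the Levi-Civita connection of $g$. An $\mathrm{SU}(3)$-structure on a $6$-dimensional Riemannian manifold $(M,g)$ is a reduction of the structure group from $\mathrm{O}(6)$ to $\mathrm{SU}(3)$. It defines an almost complex structure $J$ compatible with $g$, with fundamental $2$-form $\omega(X,Y)=g(JX,Y)$ (and the orientation induced by $J$), and a $3$-form $\Psi^+$ of type $(3,0)+(0,3)$ such that $\frac14\Psi^+\wedge*\Psi^+$ is the Riemannian volume form; one sets $\Psi^-:=*\Psi^+$, where $*$ is the Hodge operator. A Killing $p$-form is a $p$-form $\eta$ such that $\nabla\eta$ is totally skew-symmetric, equivalently $\nabla_X\eta=\frac{1}{p+1}\,\iota_X\,d\eta$ for every tangent vector $X$, where $\iota_X$ is the interior product. A form $\eta$ is parallel if $\nabla\eta=0$. $(g,\omega)$ is Kähler if $\nabla J=0$. It is nearly Kähler if $(\nabla_XJ)(X)=0$ for every tangent vector $X$, and strict nearly Kähler if moreover $\nabla_XJ\neq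 0$ for every tangent vector $X\neq 0$. *)

(* Defs.v *)
(* Smooth manifolds, covariant tensor fields and the Levi-Civita calculus are
   set up through an atlas: a tensor field is a family of component functions,
   one for each chart of the atlas, subject to the usual transformation law on
   overlaps. *)
From mathcomp Require Import all_boot all_order all_algebra all_fingroup.
From mathcomp Require Import boolp classical_sets functions cardinality.
From mathcomp Require Import reals topology normedtype derive.
From mathcomp Require Import complex.

Set Implicit Arguments.
Unset Strict Implicit.
Unset Printing Implicit Defensive.

Import Order.TTheory GRing.Theory Num.Theory.
Import numFieldNormedType.Exports.
Local Open Scope classical_set_scope.
Local Open Scope ring_scope.

Section Calculus.
Context {R : realType} {n : nat}.

Definition partial (i : 'I_n) (f : 'rV[R]_n -> R) : 'rV[R]_n -> R :=
  fun y => 'D_(delta_mx 0 i) f y.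

(* C^k on U, meaningful for open U *)
Fixpoint Ck_on (k : nat) (U : set 'rV[R]_n) (f : 'rV[R]_n -> R) : Prop :=
  if k is k'.+1 then
    (forall y, U y -> differentiable f y) /\
    (forall i, Ck_on k' U (partial i f))
  else forall y, U y -> {for y, continuous f}.

Definition smooth_on (U : set 'rV[R]_n) (f : 'rV[R]_n -> R) : Prop :=
  forall k, Ck_on k U f.

(* entry (a, i) is the i-th partial derivative of the a-th component *)
Definition jac (f : 'rV[R]_n -> 'rV[R]_n) (y : 'rV[R]_n) : 'M[R]_n :=
  \matrix_(a, i) partial i (fun z => f z 0 a) y.

End Calculus.

(* The atlas need not be maximal. [chart_inv c] inverts [chart_map c] on [chart_dom c]; its
   values outside [chart_map c @` chart_dom c] are irrelevant. *)
Record manifold (R : realType) (n : nat) := Manifold {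
  points :> topologicalType;
  chart : Type;
  chart_dom : chart -> set points;
  chart_map : chart -> points -> 'rV[R]_n;
  chart_inv : chart -> 'rV[R]_n -> points;
  manifold_hausdorff : hausdorff_space points;
  manifold_second_countable : @second_countable points;
  chart_cover : forall x, exists c, chart_dom c x;
  chart_dom_open : forall c, open (chart_dom c);
  chart_image_open : forall c, open (chart_map c @` chart_dom c);
  chart_mapK : forall c x, chart_dom c x -> chart_inv c (chart_map c x) = x;
  chart_map_continuous : forall c x, chart_dom c x -> {for x, continuous (chart_map c)};
  chart_inv_continuous : forall c x, chart_dom c x ->
    {for chart_map c x, continuous (chart_inv c)};
  transition_smooth : forall c d (a : 'I_n),
    smooth_on (chart_map c @` (chart_dom c `&` chart_dom d))
              (fun y => chart_map d (chart_inv c y) 0 a)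
}.

Section Tensors.
Context {R : realType} {n : nat}.

(* components T(e_{I_0}, ..., e_{I_(k-1)}) of a covariant k-tensor *)
Definition ktensor (k : nat) := k.-tuple 'I_n -> R.

Definition tupd k (I : k.-tuple 'I_n) (a : 'I_k) (l : 'I_n) : k.-tuple 'I_n :=
  [tuple if b == a then l else tnth I b | b < k].

Definition tdel k (I : k.+1.-tuple 'I_n) (a : 'I_k.+1) : k.-tuple 'I_n :=
  [tuple tnth I (lift a b) | b < k].

Definition tperm_idx k (I : k.-tuple 'I_n) (s : 'S_k) : k.-tuple 'I_n :=
  [tuple tnth I (s b) | b < k].

Definition alternating (V : zmodType) k (T : k.-tuple 'I_n -> V) : Prop :=
  forall (I : k.-tuple 'I_n) (s : 'S_k),
    T (tperm_idx I s) = if odd_perm s then - T I else T I.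

(* normalised so that (e^1 /\ ... /\ e^p)(e_1, ..., e_p) = 1 *)
Definition wedge k l (S : ktensor k) (T : ktensor l) : ktensor (k + l) :=
  fun I => (k`!%:R * l`!%:R)^-1 *
    \sum_(s : 'S_(k + l)) (-1) ^+ odd_perm s *
      S [tuple tnth I (s (lshift l a)) | a < k] *
      T [tuple tnth I (s (rshift k b)) | b < l].

Definition positive_definite (g : 'M[R]_n) : Prop :=
  g^T = g /\ forall X : 'cV[R]_n, X != 0 -> 0 < (X^T *m g *m X) 0 0.

Definition raise (g : 'M[R]_n) k (T : ktensor k) : ktensor k :=
  fun I => \sum_(K : k.-tuple 'I_n)
    (\prod_(a < k) invmx g (tnth I a) (tnth K a)) * T K.

Definition levi_civita (I : n.-tuple 'I_n) : R :=
  \det (\matrix_(a, b) (tnth I a == b)%:R).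

(* Riemannian volume form; [o] is 1 or -1 according to whether the coordinate
   frame is positively oriented or not *)
Definition volume_form (o : R) (g : 'M[R]_n) : ktensor n :=
  fun I => o * Num.sqrt (\det g) * levi_civita I.

End Tensors.

(* S /\ hodge o g T = <S, T> volume_form o g for k-forms S, T *)
Definition hodge (R : realType) (k l : nat) (o : R) (g : 'M[R]_(k + l))
    (T : @ktensor R (k + l) k) : @ktensor R (k + l) l :=
  fun L => k`!%:R^-1 *
    \sum_(I : k.-tuple 'I_(k + l))
      raise g T I * volume_form o g [tuple of I ++ L].

Section TensorFields.
Context {R : realType} {n : nat} {M : manifold R n}.

Definition ktensor_field (k : nat) := chart M -> 'rV[R]_n -> @ktensor R n k.

(* (1,1)-tensor or bilinear form *)
Definition matrix_field := chart M -> 'rV[R]_n -> 'M[R]_n.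

(* Jacobian at x of the change of coordinates from c to d *)
Definition jac_at (c d : chart M) (x : M) : 'M[R]_n :=
  jac (fun y => chart_map d (chart_inv c y)) (chart_map c x).

Definition smooth_ktensor_field k (T : ktensor_field k) : Prop :=
  (forall c I, smooth_on (chart_map c @` chart_dom c) (fun y => T c y I)) /\
  (forall c d x, chart_dom c x -> chart_dom d x -> forall I,
     T c (chart_map c x) I =
     \sum_(K : k.-tuple 'I_n)
       (\prod_(a < k) jac_at c d x (tnth K a) (tnth I a)) *
       T d (chart_map d x) K).

Definition smooth_bilinear_field (g : matrix_field) : Prop :=
  (forall c i j, smooth_on (chart_map c @` chart_dom c) (fun y => g c y i j)) /\
  (forall c d x, chart_dom c x -> chart_dom d x ->
     g c (chart_map c x) =
     (jac_at c d x)^T *m g d (chart_map d x) *m jac_at c d x).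

Definition smooth_endo_field (J : matrix_field) : Prop :=
  (forall c i j, smooth_on (chart_map c @` chart_dom c) (fun y => J c y i j)) /\
  (forall c d x, chart_dom c x -> chart_dom d x ->
     jac_at c d x *m J c (chart_map c x) = J d (chart_map d x) *m jac_at c d x).

Definition differential_form k (T : ktensor_field k) : Prop :=
  smooth_ktensor_field T /\
  forall c x, chart_dom c x -> alternating (T c (chart_map c x)).

Definition ext_d k (T : ktensor_field k) : ktensor_field k.+1 :=
  fun c y I => \sum_(j < k.+1) (-1) ^+ j *
    partial (tnth I j) (fun z => T c z (tdel I j)) y.

Definition riemannian_metric (g : matrix_field) : Prop :=
  smooth_bilinear_field g /\
  forall c x, chart_dom c x -> positive_definite (g c (chart_map c x)).

Section LeviCivita.
Variable g : matrix_field.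

(* [christoffel c l i j y] is \Gamma^l_{ij}, i.e.
   \nabla_{e_i} e_j = \sum_l \Gamma^l_{ij} e_l *)
Definition christoffel (c : chart M) (l i j : 'I_n) : 'rV[R]_n -> R :=
  fun y => 2^-1 * \sum_m invmx (g c y) l m *
    (partial i (fun z => g c z j m) y + partial j (fun z => g c z i m) y
     - partial m (fun z => g c z i j) y).

(* the index of differentiation comes first: component m :: I of [nabla T] is
   (\nabla_{e_m} T)_I *)
Definition nabla k (T : ktensor_field k) : ktensor_field k.+1 :=
  fun c y K =>
    let m := thead K in let I := tdel K ord0 in
    partial m (fun z => T c z I) y
    - \sum_(a < k) \sum_l christoffel c l m (tnth I a) y * T c y (tupd I a l).

(* matrix of the endomorphism \nabla_{e_m} J *)
Definition nabla_endo_basis (J : matrix_field) (c : chart M) (y : 'rV[R]_n)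
    (m : 'I_n) : 'M[R]_n :=
  \matrix_(i, j)
    (partial m (fun z => J c z i j) y
     + \sum_l christoffel c i m l y * J c y l j
     - \sum_l christoffel c l m j y * J c y i l).

(* \nabla_X J for a tangent vector X, given by its components in the chart *)
Definition nabla_endo (J : matrix_field) (c : chart M) (y : 'rV[R]_n)
    (X : 'cV[R]_n) : 'M[R]_n :=
  \sum_m X m 0 *: nabla_endo_basis J c y m.

(* l-component of R(e_i, e_j) e_k, with R(X,Y) = [\nabla_X, \nabla_Y] -
   \nabla_[X,Y] *)
Definition riemann (c : chart M) (l k i j : 'I_n) (y : 'rV[R]_n) : R :=
  partial i (christoffel c l j k) y - partial j (christoffel c l i k) y
  + \sum_m (christoffel c l i m y * christoffel c m j k y
            - christoffel c l j m y * christoffel c m i k y).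

Definition ricci (c : chart M) (j k : 'I_n) (y : 'rV[R]_n) : R :=
  \sum_i riemann c i k i j y.

Definition scalar_curvature (c : chart M) (y : 'rV[R]_n) : R :=
  \sum_j \sum_k invmx (g c y) j k * ricci c j k y.

Definition parallel k (T : ktensor_field k) : Prop :=
  forall c x, chart_dom c x -> forall K, nabla T c (chart_map c x) K = 0.

Definition killing k (T : ktensor_field k) : Prop :=
  forall c x, chart_dom c x -> alternating (nabla T c (chart_map c x)).

(* g and J determine the fundamental 2-form, so being (nearly) Kaehler is a
   property of (g, J) *)
Definition kaehler (J : matrix_field) : Prop :=
  forall c x, chart_dom c x -> forall X, nabla_endo J c (chart_map c x) X = 0.

Definition nearly_kaehler (J : matrix_field) : Prop :=
  forall c x, chart_dom c x -> forall X, nabla_endo J c (chart_map c x) X *m X = 0.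

Definition strict_nearly_kaehler (J : matrix_field) : Prop :=
  nearly_kaehler J /\
  forall c x, chart_dom c x -> forall X, X != 0 ->
    nabla_endo J c (chart_map c x) X != 0.

End LeviCivita.

Definition almost_complex (J : matrix_field) : Prop :=
  smooth_endo_field J /\
  forall c x, chart_dom c x -> J c (chart_map c x) *m J c (chart_map c x) = - 1%:M.

Definition compatible (g J : matrix_field) : Prop :=
  forall c x, chart_dom c x ->
    (J c (chart_map c x))^T *m g c (chart_map c x) *m J c (chart_map c x)
    = g c (chart_map c x).

(* \omega(X,Y) = g(JX,Y) *)
Definition fundamental_form (g J : matrix_field) : ktensor_field 2 :=
  fun c y I => ((J c y)^T *m g c y) (tnth I ord0) (tnth I ord_max).

End TensorFields.

Section ComplexType.
Context {R : realType} {n : nat}.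

(* A complex-valued alternating k-tensor is of type (k,0), resp. (0,k), iff
   T(.., JX, ..) = 'i T(.., X, ..), resp. - 'i T(.., X, ..), in every slot. *)
Definition J_eigen (z : R[i]) (J : 'M[R]_n) k (T : k.-tuple 'I_n -> R[i]) :=
  forall (I : k.-tuple 'I_n) (a : 'I_k),
    \sum_l (J l (tnth I a))%:C%C * T (tupd I a l) = z * T I.

Definition type_k0 (J : 'M[R]_n) k (T : k.-tuple 'I_n -> R[i]) : Prop :=
  alternating T /\ J_eigen 'i%C J T.

Definition type_0k (J : 'M[R]_n) k (T : k.-tuple 'I_n -> R[i]) : Prop :=
  alternating T /\ J_eigen (- 'i%C) J T.

Definition type_k0_0k (J : 'M[R]_n) k (T : @ktensor R n k) : Prop :=
  exists S S' : k.-tuple 'I_n -> R[i],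
    [/\ type_k0 J S, type_0k J S' & forall I, (T I)%:C%C = S I + S' I].

End ComplexType.

Section SU3.
Context {R : realType}.

(* columns v_0, J v_0, v_1, J v_1, v_2, J v_2, where v_a is column a of V *)
Definition complex_frame (J : 'M[R]_6) (V : 'M[R]_(6, 3)) : 'M[R]_6 :=
  \matrix_(i, a) (if odd a then J *m V else V) i (inord a./2).

(* Orientation induced by J: frames (v_0, J v_0, v_1, J v_1, v_2, J v_2) are
   positive, so the coordinate frame is positive iff some such frame has
   positive determinant relative to it. *)
Definition orientation_sign (J : 'M[R]_6) : R :=
  if `[< exists V, 0 < \det (complex_frame J V) >] then 1 else -1.

Context {M : manifold R 6}.

Definition hodge3 (g J : @matrix_field R 6 M) (T : @ktensor_field R 6 M 3) :
    @ktensor_field R 6 M 3 :=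
  fun c y => @hodge R 3 3 (orientation_sign (J c y)) (g c y) (T c y).

(* An SU(3)-reduction of the bundle of g-orthonormal frames, given by the
   tensors (J, \Psi^+) that it defines. *)
Record su3_structure (g : @matrix_field R 6 M) := SU3Structure {
  su3_J : @matrix_field R 6 M;
  Psi_plus : @ktensor_field R 6 M 3;
  su3_almost_complex : almost_complex su3_J;
  su3_compatible : compatible g su3_J;
  Psi_plus_form : differential_form Psi_plus;
  Psi_plus_type : forall c x, chart_dom c x ->
    type_k0_0k (su3_J c (chart_map c x)) (Psi_plus c (chart_map c x));
  Psi_plus_volume : forall c x, chart_dom c x -> forall I : 6.-tuple 'I_6,
    4^-1 * @wedge R 6 3 3 (Psi_plus c (chart_map c x))
             (hodge3 g su3_J Psi_plus c (chart_map c x)) I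
    = volume_form (orientation_sign (su3_J c (chart_map c x)))
        (g c (chart_map c x)) I
}.

Definition su3_omega g (S : su3_structure g) : @ktensor_field R 6 M 2 :=
  fundamental_form g (su3_J S).

Definition Psi_minus g (S : su3_structure g) : @ktensor_field R 6 M 3 :=
  hodge3 g (su3_J S) (Psi_plus S).

End SU3.

(* Main.v *)
Require Import Defs.
From mathcomp Require Import all_boot all_order all_algebra all_fingroup.
From mathcomp Require Import boolp classical_sets functions.
From mathcomp Require Import reals topology normedtype landau derive.
From mathcomp Require Import complex ring lra.

Set Implicit Arguments.
Unset Strict Implicit.
Unset Printing Implicit Defensive.

Import Order.TTheory GRing.Theory Num.Theory.
Import numFieldNormedType.Exports.
Local Open Scope classical_set_scope.
Local Open Scope ring_scope.

(* Psi- has type (3,0)+(0,3), that is, inserting J gives the same tensor in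
   every slot. Differentiating this identity and using that nabla Psi- is
   alternating, one finds in an adapted frame at a point, with W = omega,
       nabla W = lam Psi+   and   nabla Psi- = - lam/2 W /\ W
   for a number lam. The Ricci identity for W, summed over alternations with the
   first Bianchi identity, then forces d lam = 0, and the Ricci identity for
   Psi- gives scal = 30 lam^2. As d W = 3 lam Psi+ and Psi+ has no zeros, lam is
   independent of the chart; so it is constant on the connected M, and the two
   cases are lam = 0 and lam <> 0. *)

(** * Partial derivatives and smooth functions *)

(** Why nabla W is a multiple of Psi+: write A_X for nabla_X J and psi_X for the interior product of
    X with Psi-. In the differentiated slot identity take both free arguments equal to X. The
    derivative of Psi- drops out, being alternating, and psi_X A_X = A_X^T psi_X remains; applied to
    X it gives psi_X (A_X X) = 0. The kernel of psi_X is spanned by X and J X, and A_X X is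
    orthogonal to both, so A_X X = 0. Hence nabla W is alternating. J moves between its slots as
    well, so it is a combination of Psi+ and Psi-, and one component of the slot identity excludes
    Psi-. The same identity then determines nabla Psi- up to a form of type (4,0)+(0,4), and there
    is none in complex dimension 3. *)

Section PartialRules.
Context {R : realType} {n : nat}.
Implicit Types (f h : 'rV[R]_n -> R) (y : 'rV[R]_n) (U : set 'rV[R]_n).

Lemma partial_near i f h y :
  (\forall z \near y, f z = h z) -> partial i f y = partial i h y.
Proof. by move=> fh; rewrite /partial; exact: near_eq_derive. Qed.

Lemma partial_ext i f h y : f =1 h -> partial i f y = partial i h y.
Proof. by move=> /funext ->. Qed.

Lemma partialD i f h y : differentiable f y -> differentiable h y ->
  partial i (fun z => f z + h z) y = partial i f y + partial i h y.
Proof. by move=> df dh; rewrite /partial deriveD//; exact: diff_derivable. Qed.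

Lemma partialN i f y : differentiable f y ->
  partial i (fun z => - f z) y = - partial i f y.
Proof. by move=> df; rewrite /partial deriveN//; exact: diff_derivable. Qed.

Lemma partialM i f h y : differentiable f y -> differentiable h y ->
  partial i (fun z => f z * h z) y = partial i f y * h y + f y * partial i h y.
Proof.
move=> df dh; rewrite /partial deriveM; [|exact: diff_derivable..].
by rewrite addrC [h y *: _]mulrC.
Qed.

Lemma partial_cst i (a : R) y : partial i (fun=> a) y = 0.
Proof. exact: derive_cst. Qed.

Lemma differentiable_bigsum (I : Type) (s : seq I) (P : pred I)
    (F : I -> 'rV[R]_n -> R) y :
  (forall k, P k -> differentiable (F k) y) ->
  differentiable (fun z => \sum_(k <- s | P k) F k z) y.
Proof.
move=> dF; elim: s => [|k s IH].
  rewrite (_ : (fun z => _) = cst 0); first exact: differentiable_cst.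
  by apply/funext => z; rewrite big_nil.
have [Pk|NPk] := boolP (P k); last first.
  rewrite (_ : (fun z => _) = (fun z => \sum_(k <- s | P k) F k z)) //.
  by apply/funext => z; rewrite big_cons (negPf NPk).
rewrite (_ : (fun z => _) = (fun z => F k z + \sum_(k <- s | P k) F k z)).
  by apply: differentiableD => //; exact: dF.
by apply/funext => z; rewrite big_cons Pk.
Qed.

Lemma partial_sum i (I : Type) (s : seq I) (F : I -> 'rV[R]_n -> R) y :
  (forall k, differentiable (F k) y) ->
  partial i (fun z => \sum_(k <- s) F k z) y = \sum_(k <- s) partial i (F k) y.
Proof.
move=> dF; elim: s => [|k s IH].
  rewrite (_ : (fun z => _) = cst 0) ?partial_cst ?big_nil//.
  by apply/funext => z; rewrite big_nil.
rewrite big_cons -IH -partialD//; last exact: differentiable_bigsum.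
by apply: partial_ext => z; rewrite big_cons.
Qed.

Lemma differentiable_bigprod (I : Type) (s : seq I) (P : pred I)
    (F : I -> 'rV[R]_n -> R) y :
  (forall k, P k -> differentiable (F k) y) ->
  differentiable (fun z => \prod_(k <- s | P k) F k z) y.
Proof.
move=> dF; elim: s => [|k s IH].
  rewrite (_ : (fun z => _) = cst 1); first exact: differentiable_cst.
  by apply/funext => z; rewrite big_nil.
have [Pk|NPk] := boolP (P k); last first.
  rewrite (_ : (fun z => _) = (fun z => \prod_(k <- s | P k) F k z)) //.
  by apply/funext => z; rewrite big_cons (negPf NPk).
rewrite (_ : (fun z => _) = (fun z => F k z * \prod_(k <- s | P k) F k z)).
  by apply: differentiableM => //; exact: dF.
by apply/funext => z; rewrite big_cons Pk.
Qed.

(** The zero map is a differential, since the remainder vanishes near y. Through the splitting h = f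
    + (h - f) this makes differentiability local in [differentiable_near]. *)
Lemma near0_differentiable f y : (\forall z \near y, f z = 0) -> differentiable f y.
Proof.
move=> f0.
have fo : f \o shift y = cst (f y) + (\0 : 'rV[R]_n -> R) +o_ (0 : 'rV[R]_n) id.
  apply/eqaddoP => e e0.
  rewrite (nbhs_singleton f0).
  have : \forall h \near (0 : 'rV[R]_n), f (h + y) = 0.
    by move: f0; rewrite (near_shift 0)/= subr0.
  apply: filterS => h /= fh.
  rewrite -[X in `|X|]/(f (h + y) - (0 + 0)) fh addr0 subrr normr0.
  by apply: mulr_ge0; [exact: ltW|exact: normr_ge0].
apply/diff_locallyP.
have c0 : continuous (\0 : {linear 'rV[R]_n -> R}) by exact: cst_continuous.
by rewrite (diff_unique c0 fo).
Qed.

Lemma differentiable_near f h y :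
  (\forall z \near y, f z = h z) -> differentiable f y -> differentiable h y.
Proof.
move=> fh df; rewrite (_ : h = fun z => f z + (h z - f z)); last first.
  by apply/funext => z; rewrite addrC subrK.
apply: differentiableD => //; apply: near0_differentiable.
by apply: filterS fh => z ->; rewrite subrr.
Qed.

End PartialRules.

Section SmoothFunctions.
Context {R : realType} {n : nat}.
Implicit Types (f h : 'rV[R]_n -> R) (y : 'rV[R]_n) (U : set 'rV[R]_n).

Lemma open_near U y (P : set 'rV[R]_n) :
  open U -> U y -> (forall z, U z -> P z) -> \forall z \near y, P z.
Proof. by move=> oU Uy UP; apply: filterS UP _; exact: open_nbhs_nbhs. Qed.

Lemma Ck_on_ext k U f h : open U -> (forall y, U y -> f y = h y) ->
  Ck_on k U f -> Ck_on k U h.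
Proof.
move=> oU; elim: k f h => [|k IH] f h fh /=.
  move=> cf y Uy; have fhy := open_near oU Uy fh.
  have := cf y Uy; rewrite /prop_for /continuous_at (fh y Uy).
  by apply: cvg_trans; exact: near_eq_cvg fhy.
move=> [df Cf]; split => [y Uy|i].
  exact: differentiable_near (open_near oU Uy fh) (df y Uy).
apply: IH (Cf i) => y Uy; exact: partial_near (open_near oU Uy fh).
Qed.

Lemma Ck_onW k U f : Ck_on k.+1 U f -> Ck_on k U f.
Proof.
elim: k f => [|k IH] f [df Cf]; last by split => // i; exact: IH.
by move=> y Uy; exact/differentiable_continuous/df.
Qed.

Lemma Ck_on_cst k U (a : R) : open U -> Ck_on k U (fun=> a).
Proof.
move=> oU; elim: k a => [|k IH] a /=; first by move=> y _; exact: cst_continuous.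
split=> [y _|i]; first exact: differentiable_cst.
by apply: Ck_on_ext (IH 0) => // y _; rewrite partial_cst.
Qed.

Lemma Ck_onD k U f h : open U -> Ck_on k U f -> Ck_on k U h ->
  Ck_on k U (fun z => f z + h z).
Proof.
move=> oU; elim: k f h => [|k IH] f h.
  by move=> cf ch y Uy; exact: (continuousD (cf y Uy) (ch y Uy)).
move=> [df Cf] [dh Ch]; split => [y Uy|i].
  by apply: differentiableD; [exact: df|exact: dh].
apply: Ck_on_ext (IH _ _ (Cf i) (Ch i)) => // y Uy.
by rewrite partialD//; [exact: df|exact: dh].
Qed.

Lemma Ck_onM k U f h : open U -> Ck_on k U f -> Ck_on k U h ->
  Ck_on k U (fun z => f z * h z).
Proof.
move=> oU; elim: k f h => [|k IH] f h.
  by move=> cf ch y Uy; exact: (continuousM (cf y Uy) (ch y Uy)).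
(* The Leibniz rule also needs the undifferentiated factors at order k. *)
move=> Cf Ch; have [Cf0 Ch0] := (Ck_onW Cf, Ck_onW Ch).
move: Cf Ch => [df Cf] [dh Ch]; split => [y Uy|i].
  by apply: differentiableM; [exact: df|exact: dh].
apply: Ck_on_ext (Ck_onD oU (IH _ _ (Cf i) Ch0) (IH _ _ Cf0 (Ch i))) => // y Uy.
by rewrite partialM//; [exact: df|exact: dh].
Qed.

Lemma smooth_on_ext U f h : open U -> (forall y, U y -> f y = h y) ->
  smooth_on U f -> smooth_on U h.
Proof. by move=> oU fh sf k; exact: Ck_on_ext fh (sf k). Qed.

Lemma smooth_onM U f h : open U -> smooth_on U f -> smooth_on U h ->
  smooth_on U (fun z => f z * h z).
Proof. by move=> oU sf sh k; exact: Ck_onM. Qed.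

Lemma smooth_onN U f : open U -> smooth_on U f -> smooth_on U (fun z => - f z).
Proof.
move=> oU sf; apply: (@smooth_on_ext _ (fun z => -1 * f z)) => //.
  by move=> y _; rewrite mulN1r.
by apply: smooth_onM => // k; exact: Ck_on_cst.
Qed.

Lemma smooth_on_sum (I : Type) (s : seq I) (F : I -> 'rV[R]_n -> R) U : open U ->
  (forall k, smooth_on U (F k)) -> smooth_on U (fun z => \sum_(k <- s) F k z).
Proof.
move=> oU sF; elim: s => [|k s IH].
  apply: (@smooth_on_ext _ (fun=> 0)) => [//|y _|k]; first by rewrite big_nil.
  exact: Ck_on_cst.
apply: (@smooth_on_ext _ (fun z => F k z + \sum_(k <- s) F k z)) => //.
  by move=> y _; rewrite big_cons.
by move=> m; apply: Ck_onD; [|exact: sF|exact: IH].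
Qed.

Lemma smooth_on_differentiable U f y : smooth_on U f -> U y -> differentiable f y.
Proof. by move=> /(_ 1)[+ _]; apply. Qed.

Lemma smooth_on_partial U f i : smooth_on U f -> smooth_on U (partial i f).
Proof. by move=> sf k; have [_] := sf k.+1; apply. Qed.

Lemma smooth_on_continuous U f y : smooth_on U f -> U y -> {for y, continuous f}.
Proof. by move=> /(_ 0); apply. Qed.

End SmoothFunctions.

(** * Mean value theorem on segments, symmetry of second derivatives, chain rule *)

Section MeanValue.
Context {R : realType} {n : nat}.
Implicit Types (f h : 'rV[R]_n -> R) (y v : 'rV[R]_n) (U : set 'rV[R]_n).

Lemma is_derive_line f y v (t : R) : derivable f (t *: v + y) v ->
  is_derive t 1 (fun s : R => f (s *: v + y)) ('D_v f (t *: v + y)).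
Proof.
move=> df.
have E : (fun h : R => h^-1 *: (((fun s : R => f (s *: v + y)) \o shift t) (h *: 1)
              - f (t *: v + y))) =
         (fun h : R => h^-1 *: ((f \o shift (t *: v + y)) (h *: v) - f (t *: v + y))).
  apply/funext => h; congr (_ *: (f _ - _)) => /=.
  by rewrite [h *: 1]mulr1 scalerDl addrA.
by split; rewrite /derivable /derive E.
Qed.

Lemma derive_translate f c y v : 'D_v (fun z => f (c + z)) y = 'D_v f (c + y).
Proof.
rewrite /derive.
suff -> : (fun h : R => h^-1 *: (((fun z => f (c + z)) \o shift y) (h *: v) - f (c + y))) =
  (fun h : R => h^-1 *: ((f \o shift (c + y)) (h *: v) - f (c + y))) by [].
by apply/funext => k /=; rewrite addrCA.
Qed.

Lemma mean_value_line f y v (h : R) : 0 < h ->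
  (forall t, 0 <= t <= h -> differentiable f (t *: v + y)) ->
  exists2 t, 0 < t < h & f (h *: v + y) - f y = h * 'D_v f (t *: v + y).
Proof.
move=> h0 df.
have dl t : 0 <= t <= h ->
    is_derive t 1 (fun s : R => f (s *: v + y)) ('D_v f (t *: v + y)).
  by move=> /df/(@diff_derivable _ _ _ _ _ v); exact: is_derive_line.
have dlo t : t \in `]0, h[ ->
    is_derive t 1 (fun s : R => f (s *: v + y)) ('D_v f (t *: v + y)).
  by rewrite in_itv/= => /andP[t0 th]; apply: dl; rewrite !ltW.
have cl : {within `[0, h], continuous (fun s : R => f (s *: v + y))}.
  apply: derivable_within_continuous => t; rewrite in_itv/= => th.
  by have [] := dl t th.
have [t] := MVT h0 dlo cl.
rewrite in_itv/= => th; rewrite scale0r add0r subr0 mulrC => E.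
by exists t.
Qed.

End MeanValue.

Section Schwarz.
Context {R : realType} {n : nat}.
Implicit Types (f h : 'rV[R]_n -> R) (y v : 'rV[R]_n) (U : set 'rV[R]_n).

(** The mean value theorem twice: for F z = f (h e_j + z) - f z in direction e_i, then for the
    e_i-derivative of f in direction e_j. The left-hand side is symmetric in i and j, which
    [partial_comm] exploits. *)
Lemma second_difference f y (i j : 'I_n) (h : R) (U : set 'rV[R]_n) : 0 < h ->
  open U -> smooth_on U f ->
  (forall s t : R, 0 <= s <= h -> 0 <= t <= h ->
     U (s *: delta_mx 0 i + (t *: delta_mx 0 j + y))) ->
  exists s t : R, [/\ 0 < s < h, 0 < t < h &
    f (h *: delta_mx 0 i + (h *: delta_mx 0 j + y)) - f (h *: delta_mx 0 i + y)
    - f (h *: delta_mx 0 j + y) + f y =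
    h * (h * partial j (partial i f) (s *: delta_mx 0 i + (t *: delta_mx 0 j + y)))].
Proof.
move=> h0 oU sf Uq.
set ei := delta_mx 0 i; set ej := delta_mx 0 j.
have hh : 0 <= h <= h by rewrite lexx ltW.
have oo : 0 <= (0 : R) <= h by rewrite lexx ltW.
have dfU z : U z -> differentiable f z by exact: smooth_on_differentiable.
have Uq0 (s : R) : 0 <= s <= h -> U (s *: ei + y).
  by move=> sh; have := Uq _ _ sh oo; rewrite scale0r add0r.
pose F (z : 'rV[R]_n) := f (h *: ej + z) - f z.
have dsh (z : 'rV[R]_n) : differentiable f (h *: ej + z) -> differentiable (fun z => f (h *: ej + z)) z.
  by move=> dfz; apply: (@differentiable_comp _ _ _ _ (fun z => h *: ej + z) f).
have dF (t : R) : 0 <= t <= h -> differentiable F (t *: ei + y).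
  move=> th; apply: differentiableB; last exact/dfU/Uq0.
  by apply/dsh/dfU; rewrite addrCA; exact: Uq.
have [s sh E] := mean_value_line h0 dF.
have /andP[s0 sh'] := sh; have sh2 : 0 <= s <= h by rewrite !ltW.
have DF : 'D_ei F (s *: ei + y) =
    partial i f (h *: ej + (s *: ei + y)) - partial i f (s *: ei + y).
  rewrite deriveB; last 2 first.
  - by apply/diff_derivable/dsh/dfU; rewrite addrCA; exact: Uq.
  - exact/diff_derivable/dfU/Uq0.
  by rewrite (derive_translate f (h *: ej) (s *: ei + y) ei).
have [|t th E2] := @mean_value_line _ _ (partial i f) (s *: ei + y) ej h h0.
  move=> t th; apply: (@smooth_on_differentiable _ _ U); first exact: smooth_on_partial.
  by rewrite addrCA; exact: Uq.
exists s, t; split => //.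
have -> : s *: ei + (t *: ej + y) = t *: ej + (s *: ei + y) by rewrite addrCA.
have -> : h *: ei + (h *: ej + y) = h *: ej + (h *: ei + y) by rewrite addrCA.
have <- := E2; have <- := DF; have <- := E; rewrite /F; lra.
Qed.

Let norm_close (p q r e : R) :
  `|p - r| < e / 2 -> `|q - r| < e / 2 -> `|p - q| <= e.
Proof.
move=> H1 H2; rewrite (_ : p - q = (p - r) - (q - r)); last by lra.
by apply: le_trans (ler_normB _ _) _; lra.
Qed.

(** By [second_difference] for (i, j) and for (j, i), the two mixed derivatives agree at two,
    possibly different, points of any small square at y; continuity compares both values with those
    at y. *)
Theorem partial_comm U f y (i j : 'I_n) : open U -> smooth_on U f -> U y ->
  partial i (partial j f) y = partial j (partial i f) y.
Proof.
move=> oU sf Uy; apply/eqP; rewrite -subr_eq0 -normr_le0; apply/ler_addgt0Pr => e e0.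
rewrite add0r.
have cc a b : \forall z \near y, `|partial a (partial b f) y - partial a (partial b f) z| < e / 2.
  have /(_ y Uy) : forall z, U z -> {for z, continuous (partial a (partial b f))}.
    by move=> z; exact/smooth_on_continuous/smooth_on_partial/smooth_on_partial.
  by move=> /cvgrPdist_lt; apply; rewrite divr_gt0.
have : \forall z \near y, [/\ U z,
    `|partial i (partial j f) y - partial i (partial j f) z| < e / 2 &
    `|partial j (partial i f) y - partial j (partial i f) z| < e / 2].
  have nU : \forall z \near y, U z by exact: open_near Uy (fun z Uz => Uz).
  by apply: filterS (filterI nU (filterI (cc i j) (cc j i))) => z [Uz [cij cji]]; split.
move=> /nbhs_ballP[d d0 dP].
(* Points of the square of side d / 3 are within 2 d / 3 of y in the sup norm, hence in the ball. *)
set h := d / 3; have h0 : 0 < h by rewrite divr_gt0.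
have inb (a b : 'I_n) (s t : R) : 0 <= s <= h -> 0 <= t <= h ->
    ball y d (s *: delta_mx 0 a + (t *: delta_mx 0 b + y)).
  move=> /andP[s0 sh] /andP[t0 th].
  rewrite -ball_normE/= addrA opprD addrCA subrr addr0 normrN.
  have nd (c : 'I_n) : `|delta_mx 0 c : 'rV[R]_n| <= 1.
    rewrite [leLHS]mx_normrE; apply: bigmax_le => // p _.
    by rewrite mxE; case: (_ && _); rewrite ?normr1 ?normr0.
  apply: le_lt_trans (ler_normD _ _) _; rewrite !normrZ !ger0_norm//.
  have := ler_pM s0 (normr_ge0 _) sh (nd a).
  have := ler_pM t0 (normr_ge0 _) th (nd b).
  rewrite !mulr1 /h; have : 0 < d by []. lra.
have Uq s t : 0 <= s <= h -> 0 <= t <= h ->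
    U (s *: delta_mx 0 i + (t *: delta_mx 0 j + y)).
  by move=> sh th; have [] := dP _ (inb i j s t sh th).
have Uq' s t : 0 <= s <= h -> 0 <= t <= h ->
    U (s *: delta_mx 0 j + (t *: delta_mx 0 i + y)).
  by move=> sh th; have [] := dP _ (inb j i s t sh th).
have [s [t [/andP[s0 sh] /andP[t0 th] E]]] := second_difference h0 oU sf Uq.
have [s' [t' [/andP[s0' sh'] /andP[t0' th'] E']]] := second_difference h0 oU sf Uq'.
have wb (x : R) : 0 < x -> x < h -> 0 <= x <= h by move=> ? ?; rewrite !ltW.
have [_ _ H1] := dP _ (inb i j s t (wb _ s0 sh) (wb _ t0 th)).
have [_ H2 _] := dP _ (inb j i s' t' (wb _ s0' sh') (wb _ t0' th')).
have hh : h * h != 0 by rewrite mulf_neq0// gt_eqF.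
have EE : partial j (partial i f) (s *: delta_mx 0 i + (t *: delta_mx 0 j + y)) =
    partial i (partial j f) (s' *: delta_mx 0 j + (t' *: delta_mx 0 i + y)).
  apply: (mulfI hh).
  have C : h *: delta_mx 0 j + (h *: delta_mx 0 i + y) =
    h *: delta_mx 0 i + (h *: delta_mx 0 j + y) by rewrite addrCA.
  rewrite C in E'; apply: etrans (esym (mulrA h h _)) _.
  apply: etrans (esym E) _; apply: etrans _ (mulrA h h _).
  by apply: etrans _ E'; congr (_ + _); exact: addrAC.
rewrite EE in H1.
exact: norm_close H2 H1.
Qed.
End Schwarz.

Section ChainRule.
Context {R : realType} {n : nat}.
Implicit Types (f h : 'rV[R]_n -> R) (y v : 'rV[R]_n) (U : set 'rV[R]_n).

Lemma derive_partial f y v : differentiable f y ->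
  'D_v f y = \sum_i v 0 i * partial i f y.
Proof.
move=> df; rewrite deriveE// [in LHS](row_sum_delta v) linear_sum.
by apply: eq_bigr => i _; rewrite linearZ/= /partial deriveE.
Qed.

(** A ball around y inside U contains the segment from y to each of its points, and the derivative
    of f along that segment is a combination of partial derivatives. *)
Lemma near_constant f (U : set 'rV[R]_n) y : open U -> U y ->
  (forall z, U z -> differentiable f z) ->
  (forall z i, U z -> partial i f z = 0) -> \forall z \near y, f z = f y.
Proof.
move=> oU Uy df f0.
have /nbhs_ballP[d d0 dU] : nbhs y U by exact: open_nbhs_nbhs.
apply/nbhs_ballP; exists d => // z yz.
have seg (t : R) : 0 <= t <= 1 -> U (t *: (z - y) + y).
  move=> /andP[t0 t1]; apply: dU; move: yz; rewrite -!ball_normE/=.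
  rewrite opprD addrCA subrr addr0 normrN normrZ ger0_norm// distrC => yz.
  by apply: le_lt_trans yz; rewrite ler_piMl.
have dseg (t : R) : 0 <= t <= 1 -> differentiable f (t *: (z - y) + y).
  by move=> /seg; exact: df.
have [t /andP[t0 t1]] := mean_value_line ltr01 dseg.
rewrite scale1r subrK derive_partial; last by apply: dseg; rewrite !ltW.
rewrite big1 ?mulr0 => [/eqP|i _]; first by rewrite subr_eq0 => /eqP.
by rewrite f0 ?mulr0//; apply: seg; rewrite !ltW.
Qed.

Lemma differentiable_row (T : 'rV[R]_n -> 'rV[R]_n) y :
  (forall a, differentiable (fun z => T z 0 a) y) -> differentiable T y.
Proof.
move=> dT; rewrite (_ : T = \sum_a (fun z => T z 0 a *: delta_mx 0 a)); last first.
  by apply/funext => z; rewrite [LHS]row_sum_delta fct_sumE.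
by apply: differentiable_sum => a; apply: differentiableZl.
Qed.

Lemma partial_comp i f (T : 'rV[R]_n -> 'rV[R]_n) y :
  (forall a, differentiable (fun z => T z 0 a) y) -> differentiable f (T y) ->
  partial i (fun z => f (T z)) y = \sum_a partial a f (T y) * jac T y a i.
Proof.
move=> dTa df; have dT := differentiable_row dTa.
have dfT : differentiable (f \o T) y by exact: differentiable_comp.
rewrite [LHS](deriveE _ dfT) diff_comp//= -(deriveE _ dT).
rewrite -(deriveE _ df) derive_partial//; apply: eq_bigr => a _.
rewrite mulrC; congr (_ * _); rewrite mxE derive_mx ?mxE//.
exact: diff_derivable.
Qed.

End ChainRule.

(** * Matrix-valued functions *)

Section MatrixCalculus.
Context {R : realType} {n : nat}.
Implicit Types (y : 'rV[R]_n) (U : set 'rV[R]_n).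

Definition mdiff p q (F : 'rV[R]_n -> 'M[R]_(p, q)) y :=
  forall i j, differentiable (fun z => F z i j) y.

Definition dmx p q m (F : 'rV[R]_n -> 'M[R]_(p, q)) y : 'M[R]_(p, q) :=
  \matrix_(i, j) partial m (fun z => F z i j) y.

Definition msmooth p q U (F : 'rV[R]_n -> 'M[R]_(p, q)) :=
  forall i j, smooth_on U (fun z => F z i j).

Lemma msmooth_mdiff p q U (F : 'rV[R]_n -> 'M[R]_(p, q)) y :
  msmooth U F -> U y -> mdiff F y.
Proof. by move=> sF Uy i j; exact: smooth_on_differentiable (sF i j) Uy. Qed.

Lemma msmooth_dmx p q U (F : 'rV[R]_n -> 'M[R]_(p, q)) m : open U ->
  msmooth U F -> msmooth U (dmx m F).
Proof.
move=> oU sF i j; apply: smooth_on_ext (smooth_on_partial m (sF i j)) => // z _.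
by rewrite mxE.
Qed.

Lemma msmoothM p q r U (F : 'rV[R]_n -> 'M[R]_(p, q))
    (H : 'rV[R]_n -> 'M[R]_(q, r)) : open U ->
  msmooth U F -> msmooth U H -> msmooth U (fun z => F z *m H z).
Proof.
move=> oU sF sH i j.
apply: (@smooth_on_ext _ _ _ (fun z => \sum_k F z i k * H z k j)) => //.
  by move=> z _; rewrite mxE.
by apply: smooth_on_sum => // k; exact: smooth_onM.
Qed.

Lemma msmoothN p q U (F : 'rV[R]_n -> 'M[R]_(p, q)) : open U ->
  msmooth U F -> msmooth U (fun z => - F z).
Proof.
move=> oU sF i j; apply: smooth_on_ext (smooth_onN oU (sF i j)) => // z _.
by rewrite mxE.
Qed.

Lemma msmooth_tr p q U (F : 'rV[R]_n -> 'M[R]_(p, q)) : open U ->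
  msmooth U F -> msmooth U (fun z => (F z)^T).
Proof.
move=> oU sF i j; apply: smooth_on_ext (sF j i) => // z _; by rewrite mxE.
Qed.

Lemma mdiff_ext p q (F H : 'rV[R]_n -> 'M[R]_(p, q)) y :
  (\forall z \near y, F z = H z) -> mdiff F y -> mdiff H y.
Proof.
move=> FH dF i j; apply: differentiable_near (dF i j).
by apply: filterS FH => z ->.
Qed.

Lemma mdiffD p q (F H : 'rV[R]_n -> 'M[R]_(p, q)) y :
  mdiff F y -> mdiff H y -> mdiff (fun z => F z + H z) y.
Proof.
move=> dF dH i j; rewrite (_ : (fun z => _) = (fun z => F z i j + H z i j)).
  exact: differentiableD.
by apply/funext => z; rewrite mxE.
Qed.

Lemma mdiffN p q (F : 'rV[R]_n -> 'M[R]_(p, q)) y :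
  mdiff F y -> mdiff (fun z => - F z) y.
Proof.
move=> dF i j; rewrite (_ : (fun z => _) = (fun z => - F z i j)).
  exact: differentiableN.
by apply/funext => z; rewrite mxE.
Qed.

Lemma mdiffZ p q (f : 'rV[R]_n -> R) (F : 'rV[R]_n -> 'M[R]_(p, q)) y :
  differentiable f y -> mdiff F y -> mdiff (fun z => f z *: F z) y.
Proof.
move=> df dF i j; rewrite (_ : (fun z => _) = (fun z => f z * F z i j)).
  exact: differentiableM.
by apply/funext => z; rewrite mxE.
Qed.

Lemma mdiffM p q r (F : 'rV[R]_n -> 'M[R]_(p, q)) (H : 'rV[R]_n -> 'M[R]_(q, r)) y :
  mdiff F y -> mdiff H y -> mdiff (fun z => F z *m H z) y.
Proof.
move=> dF dH i j; rewrite (_ : (fun z => _) = (fun z => \sum_k F z i k * H z k j)).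
  by apply: differentiable_bigsum => k _; exact: differentiableM.
by apply/funext => z; rewrite mxE.
Qed.

Lemma mdiff_tr p q (F : 'rV[R]_n -> 'M[R]_(p, q)) y :
  mdiff F y -> mdiff (fun z => (F z)^T) y.
Proof.
move=> dF i j; rewrite (_ : (fun z => _) = (fun z => F z j i)) //.
by apply/funext => z; rewrite mxE.
Qed.

Lemma mdiff_sum p q (I : Type) (s : seq I) (F : I -> 'rV[R]_n -> 'M[R]_(p, q)) y :
  (forall k, mdiff (F k) y) -> mdiff (fun z => \sum_(k <- s) F k z) y.
Proof.
move=> dF i j; rewrite (_ : (fun z => _) = (fun z => \sum_(k <- s) F k z i j)).
  by apply: differentiable_bigsum => k _; exact: dF.
by apply/funext => z; rewrite summxE.
Qed.

Lemma differentiable_det p (F : 'rV[R]_n -> 'M[R]_p) y :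
  mdiff F y -> differentiable (fun z => \det (F z)) y.
Proof.
move=> dF; apply: differentiable_bigsum => s _; apply: differentiableM.
  exact: differentiable_cst.
by apply: differentiable_bigprod => i _; exact: dF.
Qed.

Lemma mdiff_invmx p (F : 'rV[R]_n -> 'M[R]_p) y : mdiff F y ->
  (\forall z \near y, F z \in unitmx) -> mdiff (fun z => invmx (F z)) y.
Proof.
move=> dF uF.
(* Cramer's formula; it is only valid near y, because [invmx] returns a singular matrix
   unchanged. *)
apply: (@mdiff_ext _ _ (fun z => (\det (F z))^-1 *: \adj (F z))).
  by apply: filterS uF => z uz; rewrite /invmx uz.
apply: mdiffZ.
  apply: differentiableV; first exact: differentiable_det.
  by have := nbhs_singleton uF; rewrite unitmxE unitfE.
move=> i j; rewrite (_ : (fun z => _) = (fun z => cofactor (F z) j i)); last first.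
  by apply/funext => z; rewrite mxE.
apply: differentiableM; first exact: differentiable_cst.
apply: differentiable_det => a b.
rewrite (_ : (fun z => _) = (fun z => F z (lift j a) (lift i b))) //.
by apply/funext => z; rewrite !mxE.
Qed.

Lemma dmx_near p q m (F H : 'rV[R]_n -> 'M[R]_(p, q)) y :
  (\forall z \near y, F z = H z) -> dmx m F y = dmx m H y.
Proof.
move=> FH; apply/matrixP => i j; rewrite !mxE; apply: partial_near.
by apply: filterS FH => z ->.
Qed.

Lemma dmxD p q m (F H : 'rV[R]_n -> 'M[R]_(p, q)) y : mdiff F y -> mdiff H y ->
  dmx m (fun z => F z + H z) y = dmx m F y + dmx m H y.
Proof.
move=> dF dH; apply/matrixP => i j; rewrite !mxE -partialD//.
by apply: partial_ext => z; rewrite mxE.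
Qed.

Lemma dmxN p q m (F : 'rV[R]_n -> 'M[R]_(p, q)) y : mdiff F y ->
  dmx m (fun z => - F z) y = - dmx m F y.
Proof.
move=> dF; apply/matrixP => i j; rewrite !mxE -partialN//.
by apply: partial_ext => z; rewrite mxE.
Qed.

Lemma dmxB p q m (F H : 'rV[R]_n -> 'M[R]_(p, q)) y : mdiff F y -> mdiff H y ->
  dmx m (fun z => F z - H z) y = dmx m F y - dmx m H y.
Proof. by move=> dF dH; rewrite dmxD ?dmxN//; exact: mdiffN. Qed.

Lemma dmxZ p q m (f : 'rV[R]_n -> R) (F : 'rV[R]_n -> 'M[R]_(p, q)) y :
  differentiable f y -> mdiff F y ->
  dmx m (fun z => f z *: F z) y = partial m f y *: F y + f y *: dmx m F y.
Proof.
move=> df dF; apply/matrixP => i j; rewrite !mxE -partialM//.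
by apply: partial_ext => z; rewrite mxE.
Qed.

Lemma dmxM p q r m (F : 'rV[R]_n -> 'M[R]_(p, q)) (H : 'rV[R]_n -> 'M[R]_(q, r)) y :
  mdiff F y -> mdiff H y ->
  dmx m (fun z => F z *m H z) y = dmx m F y *m H y + F y *m dmx m H y.
Proof.
move=> dF dH; apply/matrixP => i j; rewrite !mxE -big_split/=.
rewrite (_ : (fun z => _) = (fun z => \sum_k F z i k * H z k j)).
  rewrite partial_sum => [|k]; last exact: differentiableM.
  by apply: eq_bigr => k _; rewrite partialM// !mxE.
by apply/funext => z; rewrite mxE.
Qed.

Lemma dmx_tr p q m (F : 'rV[R]_n -> 'M[R]_(p, q)) y :
  dmx m (fun z => (F z)^T) y = (dmx m F y)^T.
Proof.
apply/matrixP => i j; rewrite !mxE.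
by apply: partial_ext => z; rewrite mxE.
Qed.

Lemma dmx_sum p q m (I : Type) (s : seq I) (F : I -> 'rV[R]_n -> 'M[R]_(p, q)) y :
  (forall k, mdiff (F k) y) ->
  dmx m (fun z => \sum_(k <- s) F k z) y = \sum_(k <- s) dmx m (F k) y.
Proof.
move=> dF; apply/matrixP => i j; rewrite mxE summxE.
under eq_bigr do rewrite mxE.
rewrite -partial_sum => [|k]; last exact: dF.
by apply: partial_ext => z; rewrite summxE.
Qed.

Lemma dmx_cst p q m (A : 'M[R]_(p, q)) y : dmx m (fun=> A) y = 0.
Proof. by apply/matrixP => i j; rewrite !mxE partial_cst. Qed.

Lemma dmx_comm p q i j (F : 'rV[R]_n -> 'M[R]_(p, q)) U y : open U -> U y ->
  msmooth U F -> dmx i (dmx j F) y = dmx j (dmx i F) y.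
Proof.
move=> oU Uy sF; apply/matrixP => a b; rewrite [LHS]mxE [RHS]mxE.
have E c d : partial c (fun z => dmx d F z a b) y =
    partial c (partial d (fun z => F z a b)) y.
  by apply: partial_ext => z; rewrite mxE.
exact: etrans (E i j) (etrans (partial_comm i j oU (sF a b) Uy) (esym (E j i))).
Qed.

End MatrixCalculus.

(** * Covariant derivatives and curvature in a chart *)

(** Decides identities between sums of matrix products: after distribution each monomial is an atom,
    and the identity becomes linear in the entries. *)
Ltac mx_abel :=
  repeat match goal with |- context [@trmx ?r ?a ?b ?A] => move: (@trmx r a b A) => ? end;
  rewrite ?(mulmxDl, mulmxDr, mulmxBl, mulmxBr, mulNmx, mulmxN, mulmxA);
  repeat match goal with |- context [@mulmx ?r ?a ?b ?c ?A ?B] =>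
    move: (@mulmx r a b c A B) => ? end;
  apply/matrixP => ? ?; rewrite !mxE; ring.

Section LocalGeometry.
Context {R : realType} {n : nat} {M : manifold R n}.
Variables (g : @matrix_field R n M) (c : chart M).
Implicit Types (y : 'rV[R]_n) (U : set 'rV[R]_n) (B F : 'rV[R]_n -> 'M[R]_n).

Definition chrmx m y : 'M[R]_n := \matrix_(l, j) christoffel g c l m j y.

(* nabla_m of a bilinear form B, of an endomorphism F, and of the 3-tensor with
   components (X k) i j (slice k of the result) *)
Definition covB m B y := dmx m B y - (chrmx m y)^T *m B y - B y *m chrmx m y.

Definition covE m F y := dmx m F y + chrmx m y *m F y - F y *m chrmx m y.

Definition covF m k (X : 'I_n -> 'rV[R]_n -> 'M[R]_n) y :=
  covB m (X k) y - \sum_l chrmx m y l k *: X l y.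

(** Component (i, j) of the curvature d Gamma + Gamma /\ Gamma of the connection matrices; rows
    carry the upper index. *)
Definition riemx i j y : 'M[R]_n :=
  dmx i (chrmx j) y - dmx j (chrmx i) y
  + chrmx i y *m chrmx j y - chrmx j y *m chrmx i y.

Ltac mx_gen := repeat match goal with
  | |- context [dmx ?a ?b ?c] => generalize (dmx a b c)
  | |- context [chrmx ?a ?b] => generalize (chrmx a b)
  end; intros; mx_abel.

Lemma nabla_endo_basisE (J : @matrix_field R n M) y m :
  nabla_endo_basis g J c y m = covE m (J c) y.
Proof.
apply/matrixP => i j; rewrite !mxE; congr (_ + _ - _).
  by apply: eq_bigr => l _; rewrite mxE.
by apply: eq_bigr => l _; rewrite mxE mulrC.
Qed.

Lemma dmx_chrmx i m y l j :
  dmx i (chrmx m) y l j = partial i (christoffel g c l m j) y.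
Proof. by rewrite mxE; apply: partial_ext => z; rewrite mxE. Qed.

Lemma riemannE l k i j y : riemann g c l k i j y = riemx i j y l k.
Proof.
rewrite /riemann -!dmx_chrmx big_split/= sumrN addrA.
have mx4 (A B C D : 'M[R]_n) a b :
    (A - B + C - D) a b = A a b - B a b + C a b - D a b by rewrite !mxE.
rewrite /riemx mx4.
congr (_ + _ - _); rewrite mxE; apply: eq_bigr => m _.
  by rewrite [chrmx i y _ _]mxE [chrmx j y _ _]mxE.
by rewrite [chrmx j y _ _]mxE [chrmx i y _ _]mxE.
Qed.

Lemma covB_near m B H y : (\forall z \near y, B z = H z) ->
  covB m B y = covB m H y.
Proof. by move=> BH; rewrite /covB (dmx_near m BH) (nbhs_singleton BH). Qed.

Lemma covE_near m B H y : (\forall z \near y, B z = H z) ->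
  covE m B y = covE m H y.
Proof. by move=> BH; rewrite /covE (dmx_near m BH) (nbhs_singleton BH). Qed.

Lemma covBM m B F y : mdiff B y -> mdiff F y ->
  covB m (fun z => B z *m F z) y = covB m B y *m F y + B y *m covE m F y.
Proof. by move=> dB dF; rewrite /covB /covE dmxM//; mx_gen. Qed.

Lemma covEM m B F y : mdiff B y -> mdiff F y ->
  covE m (fun z => B z *m F z) y = covE m B y *m F y + B y *m covE m F y.
Proof. by move=> dB dF; rewrite /covE dmxM//; mx_gen. Qed.

Lemma covE_scalar m (a : R) y : covE m (fun=> a%:M) y = 0.
Proof. by rewrite /covE dmx_cst scalar_mxC add0r subrr. Qed.

Lemma covB_tr m B y : covB m (fun z => (B z)^T) y = (covB m B y)^T.
Proof.
have trB (a b e : 'M[R]_n) : (a - b - e)^T = a^T - b^T - e^T.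
  by apply/matrixP => i j; rewrite !mxE.
by rewrite /covB dmx_tr trB !trmx_mul trmxK addrAC.
Qed.

Lemma covBZ m (f : 'rV[R]_n -> R) B y : differentiable f y -> mdiff B y ->
  covB m (fun z => f z *: B z) y = partial m f y *: B y + f y *: covB m B y.
Proof.
move=> df dB; rewrite /covB dmxZ// -scalemxAr -scalemxAl; mx_gen.
Qed.

Lemma covBN m B y : mdiff B y -> covB m (fun z => - B z) y = - covB m B y.
Proof. by move=> dB; rewrite /covB dmxN//; mx_gen. Qed.

Lemma covBB m B H y : mdiff B y -> mdiff H y ->
  covB m (fun z => B z - H z) y = covB m B y - covB m H y.
Proof. by move=> dB dH; rewrite /covB dmxB//; mx_gen. Qed.

Lemma covB_sum m (I : Type) (s : seq I) (F : I -> 'rV[R]_n -> 'M[R]_n) y :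
  (forall k, mdiff (F k) y) ->
  covB m (fun z => \sum_(k <- s) F k z) y = \sum_(k <- s) covB m (F k) y.
Proof.
move=> dF; rewrite /covB dmx_sum// !sumrB; congr (_ - _ - _).
  by rewrite mulmx_sumr.
by rewrite mulmx_suml.
Qed.

Lemma covBE m B y :
  covB m B y = dmx m B y - (chrmx m y)^T *m B y - B y *m chrmx m y.
Proof. by []. Qed.

(** The atoms: [b] is the form, [bi] and [bj] are its partial derivatives, [bb] the common mixed
    one, [Gi] and [Gj] the connection matrices, [dij] the derivative of [Gj] in direction i. *)
Let ricci_algebra (b bi bj bb Gi Gj dij dji : 'M[R]_n) :
  (bb - (dij^T *m b + Gj^T *m bi) - (bi *m Gj + b *m dij)
     - Gi^T *m (bj - Gj^T *m b - b *m Gj) - (bj - Gj^T *m b - b *m Gj) *m Gi)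
  - (bb - (dji^T *m b + Gi^T *m bj) - (bj *m Gi + b *m dji)
     - Gj^T *m (bi - Gi^T *m b - b *m Gi) - (bi - Gi^T *m b - b *m Gi) *m Gj) =
  - ((dij - dji + Gi *m Gj - Gj *m Gi)^T *m b + b *m (dij - dji + Gi *m Gj - Gj *m Gi)).
Proof.
have -> : (dij - dji + Gi *m Gj - Gj *m Gi)^T =
    dij^T - dji^T + Gj^T *m Gi^T - Gi^T *m Gj^T.
  by rewrite -!trmx_mul; apply/matrixP => u v; rewrite !mxE.
mx_abel.
Qed.

Lemma mdiff_covB U m B y : open U -> U y -> msmooth U B -> mdiff (chrmx m) y ->
  mdiff (covB m B) y.
Proof.
move=> oU Uy sB dm; have dB := msmooth_mdiff sB Uy.
have ddB := msmooth_mdiff (msmooth_dmx m oU sB) Uy.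
have dt := mdiff_tr dm.
exact: mdiffD (mdiffD ddB (mdiffN (mdiffM dt dB))) (mdiffN (mdiffM dB dm)).
Qed.

(** The iterates differentiate along coordinate fields, whose brackets vanish, so the commutator is
    the curvature acting as a derivation on both arguments of B. *)
Lemma ricci_identity U B y i j : open U -> U y -> msmooth U B ->
  mdiff (chrmx i) y -> mdiff (chrmx j) y ->
  covB i (covB j B) y - covB j (covB i B) y =
  - ((riemx i j y)^T *m B y + B y *m riemx i j y).
Proof.
move=> oU Uy sB di dj; have dB := msmooth_mdiff sB Uy.
have ddB a := msmooth_mdiff (msmooth_dmx a oU sB) Uy.
have E a b : mdiff (chrmx b) y -> dmx a (covB b B) y =
    dmx a (dmx b B) y - ((dmx a (chrmx b) y)^T *m B y + (chrmx b y)^T *m dmx a B y)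
    - (dmx a B y *m chrmx b y + B y *m dmx a (chrmx b) y).
  move=> db; have dt := mdiff_tr db.
  have d1 := mdiffM dt dB; have d2 := mdiffM dB db.
  rewrite (dmxB _ (mdiffD (ddB b) (mdiffN d1)) d2) (dmxB _ (ddB b) d1).
  by rewrite (dmxM _ dt dB) (dmxM _ dB db) dmx_tr.
rewrite (covBE i (covB j B)) (covBE j (covB i B)) (E _ _ di) (E _ _ dj).
rewrite (dmx_comm i j oU Uy sB) (covBE i B) (covBE j B).
exact: ricci_algebra.
Qed.

Let ricci_sum_algebra (L1 L2 S1 S2 c1 c2 a1 a2 x1 x2 q1 q2 T w : 'M[R]_n) :
  L1 = c1 - (a1 + x1) -> L2 = c2 - (a2 + x2) -> S1 = x2 - q2 -> S2 = x1 - q1 ->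
  T = a1 - a2 + q1 - q2 -> c1 - c2 = - w -> (L1 - S1) - (L2 - S2) = - (w + T).
Proof.
move=> -> -> -> -> -> /(canRL (subrK _)) ->.
by apply/matrixP => a b; rewrite !mxE; ring.
Qed.

(** Each bracket is [covF i k] applied to the family of all [covF j l X]. The slice index k is a
    third covariant argument, which adds the last curvature sum. *)
Lemma ricci_identityF U (X : 'I_n -> 'rV[R]_n -> 'M[R]_n) y i j k :
  open U -> U y -> (forall k, msmooth U (X k)) ->
  mdiff (chrmx i) y -> mdiff (chrmx j) y ->
  (covB i (covF j k X) y - \sum_l chrmx i y l k *: covF j l X y)
  - (covB j (covF i k X) y - \sum_l chrmx j y l k *: covF i l X y) =
  - ((riemx i j y)^T *m X k y + X k y *m riemx i j y
     + \sum_l riemx i j y l k *: X l y).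
Proof.
move=> oU Uy sX di dj; have dX a := msmooth_mdiff (sX a) Uy.
have E a b : mdiff (chrmx b) y -> covB a (covF b k X) y =
    covB a (covB b (X k)) y - (\sum_l dmx a (chrmx b) y l k *: X l y
      + \sum_l chrmx b y l k *: covB a (X l) y).
  move=> db; have ds l : mdiff (fun z => chrmx b z l k *: X l z) y by exact: mdiffZ.
  rewrite (covBB _ (mdiff_covB oU Uy (sX k) db) (mdiff_sum _ ds)) covB_sum//.
  congr (_ - _); rewrite -big_split; apply: eq_bigr => l _ /=.
  by rewrite covBZ//; congr (_ *: _ + _); rewrite [RHS]mxE.
have F a b : \sum_l chrmx a y l k *: covF b l X y =
    \sum_l chrmx a y l k *: covB b (X l) y
    - \sum_l (chrmx b y *m chrmx a y) l k *: X l y.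
  rewrite /covF; under eq_bigr do rewrite scalerBr scaler_sumr.
  rewrite sumrB exchange_big/=; congr (_ - _); apply: eq_bigr => l _.
  rewrite mxE scaler_suml; apply: eq_bigr => p _.
  by rewrite scalerA mulrC.
have S : \sum_l riemx i j y l k *: X l y =
    \sum_l dmx i (chrmx j) y l k *: X l y - \sum_l dmx j (chrmx i) y l k *: X l y
    + \sum_l (chrmx i y *m chrmx j y) l k *: X l y
    - \sum_l (chrmx j y *m chrmx i y) l k *: X l y.
  rewrite -!(sumrB, big_split)/=; apply: eq_bigr => l _.
  rewrite -!(scalerBl, scalerDl); congr (_ *: _).
  by rewrite /riemx; move: (dmx _ _ _) (dmx _ _ _) (_ *m _) (_ *m _) => ? ? ? ?; rewrite !mxE.
exact: ricci_sum_algebra (E i j dj) (E j i di) (F i j) (F j i) S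
  (ricci_identity oU Uy (sX k) di dj).
Qed.

End LocalGeometry.

Lemma positive_definite_unitmx (R : realType) n (G : 'M[R]_n) :
  positive_definite G -> G \in unitmx.
Proof.
move=> [Gs Gp]; rewrite unitmxE unitfE; apply/negP => /det0P[v v0 vG].
have := Gp v^T; rewrite trmxK vG mul0mx mxE ltxx.
by apply/implyP; rewrite -trmx0 (inj_eq trmx_inj) v0.
Qed.

(** * The Levi-Civita connection: torsion, metric compatibility, symmetries of the curvature *)

Section MetricGeometry.
Context {R : realType} {n : nat} {M : manifold R n}.
Variables (g : @matrix_field R n M) (c : chart M) (U : set 'rV[R]_n).
Hypotheses (oU : open U) (sg : msmooth U (g c)).
Hypothesis pg : forall z, U z -> positive_definite (g c z).
Implicit Types (y : 'rV[R]_n).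

Let gsym z i j : U z -> g c z i j = g c z j i.
Proof. by move=> /pg[gT _]; rewrite -[in LHS]gT mxE. Qed.

Let dgsym y m i j : U y ->
  partial m (fun z => g c z i j) y = partial m (fun z => g c z j i) y.
Proof.
by move=> Uy; apply: partial_near; apply: open_near oU Uy _ => z; exact: gsym.
Qed.

(** Christoffel symbols of the first kind, doubled. *)
Let K m y : 'M[R]_n := \matrix_(p, j) (partial m (fun z => g c z j p) y
  + partial j (fun z => g c z m p) y - partial p (fun z => g c z m j) y).

Let chrmxE m y : chrmx g c m y = 2^-1 *: (invmx (g c y) *m K m y).
Proof.
apply/matrixP => l j; rewrite !mxE; congr (_ * _); apply: eq_bigr => p _.
by rewrite mxE.
Qed.

Lemma chrmx_sym y l i j : U y -> chrmx g c i y l j = chrmx g c j y l i.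
Proof.
move=> Uy; rewrite !chrmxE [LHS]mxE [RHS]mxE; congr (_ * _).
rewrite [LHS]mxE [RHS]mxE; apply: eq_bigr => p _; congr (_ * _).
by rewrite [LHS]mxE [RHS]mxE (dgsym p j i Uy) [X in X - _]addrC.
Qed.

Lemma mdiff_chrmx m y : U y -> mdiff (chrmx g c m) y.
Proof.
move=> Uy; apply: (@mdiff_ext _ _ _ _ (fun z => 2^-1 *: (invmx (g c z) *m K m z))).
  by near=> z; rewrite chrmxE.
apply: mdiffZ; first exact: differentiable_cst.
apply: mdiffM.
  apply: mdiff_invmx; first exact: msmooth_mdiff Uy.
  by apply: open_near oU Uy _ => z /pg/positive_definite_unitmx.
have dp a i j : differentiable (partial a (fun z => g c z i j)) y.
  exact: smooth_on_differentiable (smooth_on_partial a (sg i j)) Uy.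
move=> i j; rewrite (_ : (fun z => _) = (fun z => partial m (fun z => g c z j i) z
  + partial j (fun z => g c z m i) z - partial i (fun z => g c z m j) z)).
  by apply: differentiableB => //; exact: differentiableD.
by apply/funext => z; rewrite mxE.
Unshelve. all: by end_near.
Qed.

Lemma covB_metric m y : U y -> covB g c m (g c) y = 0.
Proof.
move=> Uy; have [gT _] := pg Uy; have ug := positive_definite_unitmx (pg Uy).
have gG : g c y *m chrmx g c m y = 2^-1 *: K m y.
  by rewrite chrmxE -scalemxAr mulmxA mulmxV// mul1mx.
have Gg : (chrmx g c m y)^T *m g c y = (2^-1 *: K m y)^T.
  by rewrite -gG trmx_mul gT.
rewrite covBE Gg gG; apply/matrixP => i j.
rewrite !mxE (dgsym m j i Uy) (dgsym i m j Uy) (dgsym j m i Uy).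
rewrite (dgsym i j m Uy) (dgsym j i m Uy); lra.
Qed.

Let mxE4 (A B C D : 'M[R]_n) a b :
  (A - B + C - D) a b = A a b - B a b + C a b - D a b.
Proof. by rewrite !mxE. Qed.

Let bianchi_algebra (r1 r2 r3 a1 a2 a3 b1 b2 b3 p1 p2 p3 q1 q2 q3 : R) :
  r1 = a1 - b1 + p1 - q1 -> r2 = a2 - b2 + p2 - q2 -> r3 = a3 - b3 + p3 - q3 ->
  a1 = b3 -> b1 = a2 -> b2 = a3 -> p1 = q3 -> q1 = p2 -> q2 = p3 ->
  r1 + r2 + r3 = 0.
Proof. by move=> -> -> -> -> -> -> -> -> ->; ring. Qed.

(** By the symmetry of the Christoffel symbols in their lower indices, the derivative terms and the
    products each cancel in pairs in the cyclic sum. *)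
Lemma riemx_bianchi i j k l y : U y ->
  riemx g c i j y l k + riemx g c j k y l i + riemx g c k i y l j = 0.
Proof.
move=> Uy.
have dS a b e : dmx a (chrmx g c b) y l e = dmx a (chrmx g c e) y l b.
  rewrite [LHS]mxE [RHS]mxE; apply: partial_near; apply: open_near oU Uy _ => z.
  exact: chrmx_sym.
have pS a b e : (chrmx g c a y *m chrmx g c b y) l e
    = (chrmx g c a y *m chrmx g c e y) l b.
  by rewrite !mxE; apply: eq_bigr => p _; congr (_ * _); exact: chrmx_sym.
have E a b e : riemx g c a b y l e = dmx a (chrmx g c b) y l e
    - dmx b (chrmx g c a) y l e + (chrmx g c a y *m chrmx g c b y) l e
    - (chrmx g c b y *m chrmx g c a y) l e by exact: mxE4.
exact: bianchi_algebra (E i j k) (E j k i) (E k i j) (dS i j k) (dS j i k) (dS k j i)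
  (pS i j k) (pS j i k) (pS k j i).
Qed.

Lemma riemx_antisym i j y : riemx g c j i y = - riemx g c i j y.
Proof.
rewrite /riemx; move: (dmx _ _ _) (dmx _ _ _) (_ *m _) (_ *m _) => a b e f.
by apply/matrixP => u v; rewrite !mxE; ring.
Qed.

(** The Ricci identity for the metric itself, whose covariant derivatives vanish on all of U and so
    can be differentiated again. *)
Lemma riemx_skew i j y : U y ->
  (riemx g c i j y)^T *m g c y + g c y *m riemx g c i j y = 0.
Proof.
move=> Uy; apply/eqP; rewrite -oppr_eq0.
rewrite -(ricci_identity oU Uy sg (mdiff_chrmx i Uy) (mdiff_chrmx j Uy)).
have Z a b : covB g c a (covB g c b (g c)) y = 0.
  have gz : \forall z \near y, covB g c b (g c) z = 0.
    by apply: open_near oU Uy _ => z; exact: covB_metric.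
  by rewrite (covB_near _ _ _ gz) covBE dmx_cst mulmx0 mul0mx !subr0.
by rewrite !Z subrr.
Qed.

End MetricGeometry.

(** * Hodge star and wedge product in an orthonormal frame *)

Section TupleSums.
Context {T : finType} {V : nmodType}.

Lemma sum_cat_tuple k l (F : (k + l).-tuple T -> V) :
  \sum_P F P = \sum_(I : k.-tuple T) \sum_(K : l.-tuple T) F [tuple of I ++ K].
Proof.
rewrite pair_bigA/=.
rewrite (reindex (fun p : k.-tuple T * l.-tuple T => [tuple of p.1 ++ p.2]))//.
exists (fun P : (k + l).-tuple T =>
  ([tuple tnth P (lshift l a) | a < k], [tuple tnth P (rshift k b) | b < l])).
  move=> [I K] _; congr (_, _); apply: eq_from_tnth => a; rewrite tnth_mktuple.
    by rewrite tnth_lshift.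
  by rewrite tnth_rshift.
move=> P _; apply: eq_from_tnth => a; rewrite /=.
by case: (split_ordP a) => b ->; rewrite ?tnth_lshift ?tnth_rshift tnth_mktuple.
Qed.

Lemma sum_tuple3 (F : 3.-tuple T -> V) :
  \sum_P F P = \sum_i \sum_j \sum_k F [tuple i; j; k].
Proof.
rewrite pair_bigA/= pair_bigA/=.
rewrite (reindex (fun p : T * T * T => [tuple p.1.1; p.1.2; p.2]))//.
exists (fun P : 3.-tuple T => (tnth P ord0, tnth P (inord 1), tnth P (inord 2))).
  by move=> [[i j] k] _; congr (_, _, _); rewrite (tnth_nth i)/= ?inordK.
move=> [[|x [|y [|z []]]] // sP] _; apply: val_inj.
by rewrite /= !(tnth_nth x)/= !inordK.
Qed.

End TupleSums.

Lemma prod_sum_tuple (R : comPzSemiRingType) (T : finType) k (F : 'I_k -> T -> R) :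
  \prod_a \sum_x F a x = \sum_(C : k.-tuple T) \prod_a F a (tnth C a).
Proof.
rewrite bigA_distr_bigA/=.
rewrite (reindex (fun C : k.-tuple T => [ffun a => tnth C a]))/=.
  by apply: eq_bigr => C _; apply: eq_bigr => a _; rewrite ffunE.
exists (fun f : {ffun 'I_k -> T} => [tuple f a | a < k]).
  by move=> C _; apply: eq_from_tnth => a; rewrite tnth_mktuple ffunE.
by move=> f _; apply/ffunP => a; rewrite ffunE tnth_mktuple.
Qed.

Section FrameComponents.
Context {R : realType}.

Definition tframe n (E : 'M[R]_n) k (T : @ktensor R n k) : @ktensor R n k :=
  fun L => \sum_(K : k.-tuple 'I_n) (\prod_a E (tnth K a) (tnth L a)) * T K.

(** Both sides are the determinant of the matrix whose row a is row [tnth Q a] of E^T, on the left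
    expanded multilinearly over the tuples P. *)
Lemma levi_civita_det n (E : 'M[R]_n) (Q : n.-tuple 'I_n) :
  \sum_(P : n.-tuple 'I_n) (\prod_a E (tnth P a) (tnth Q a)) * levi_civita P
  = \det E * levi_civita Q.
Proof.
transitivity (\det (\matrix_(a, b) (tnth Q a == b)%:R *m E^T)); last first.
  by rewrite det_mulmx det_tr mulrC.
rewrite /levi_civita /determinant.
under eq_bigr do rewrite mulr_sumr.
rewrite exchange_big/=; apply: eq_bigr => s _.
under eq_bigr do rewrite mulrCA -big_split/=.
rewrite -mulr_sumr; congr (_ * _).
transitivity (\prod_a \sum_x E x (tnth Q a) * (x == s a)%:R).
  rewrite prod_sum_tuple; apply: eq_bigr => P _; apply: eq_bigr => a _.
  by rewrite mxE.
apply: eq_bigr => a _; rewrite mxE (bigD1 (s a))//= eqxx mulr1 big1 ?addr0.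
  rewrite (bigD1 (tnth Q a))//= !mxE eqxx mul1r big1 ?addr0// => b.
  by rewrite mxE eq_sym => /negPf ->; rewrite mul0r.
by move=> x /negPf ->; rewrite mulr0.
Qed.

Lemma sum_levi_civita n (F : n.-tuple 'I_n -> R) :
  \sum_Q levi_civita Q * F Q = \sum_(s : 'S_n) (-1) ^+ s * F [tuple s a | a < n].
Proof.
rewrite /levi_civita /determinant.
under eq_bigr do rewrite mulr_suml.
rewrite exchange_big/=; apply: eq_bigr => s _.
rewrite (bigD1 [tuple s a | a < n])//= big1 ?addr0 => [|a _]; last first.
  by rewrite !mxE tnth_mktuple eqxx.
rewrite mulr1 big1 ?addr0// => Q /eqP Qs.
have [a Qa] : exists a, tnth Q a != s a.
  apply/existsP; rewrite -negb_forall; apply/forallP => QE; apply: Qs.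
  by apply: eq_from_tnth => a; rewrite tnth_mktuple (eqP (QE a)).
by rewrite (bigD1 a)//= mxE (negPf Qa) mul0r mulr0 mul0r.
Qed.

Section Hodge.
Variables (k l : nat) (o : R) (G E : 'M[R]_(k + l)).
Hypothesis EGE : E^T *m G *m E = 1%:M.

Let invG : invmx G = E *m E^T.
Proof.
have EG : E^T *m (G *m E) = 1%:M by rewrite mulmxA.
have EE : (G *m E) *m E^T = 1%:M by exact: mulmx1C.
have GEE : G *m (E *m E^T) = 1%:M by rewrite mulmxA.
by rewrite -[LHS]mulmx1 -GEE mulKmx//; have [] := mulmx1_unit GEE.
Qed.

(** Value of the volume form on the columns of E; for o = 1 or -1 and an orthonormal frame it is a
    sign. *)
Definition frame_sign := o * Num.sqrt (\det G) * \det E.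

Lemma frame_sign_sqr : o ^+ 2 = 1 -> 0 <= \det G -> frame_sign ^+ 2 = 1.
Proof.
move=> o2 G0; rewrite /frame_sign !exprMn o2 mul1r sqr_sqrtr//.
by have := congr1 determinant EGE; rewrite !det_mulmx det_tr det1 => <-; ring.
Qed.

(** Orthonormality gives G^-1 = E E^T: one factor turns T into frame components, the other expands
    the result in the frame. *)
Lemma raise_frame (T : @ktensor R (k + l) k) I :
  raise G T I = \sum_C (\prod_a E (tnth I a) (tnth C a)) * tframe E T C.
Proof.
rewrite /raise /tframe; under [RHS]eq_bigr do rewrite mulr_sumr.
rewrite exchange_big/=; apply: eq_bigr => K _.
under [RHS]eq_bigr do rewrite mulrA -big_split/=.
rewrite -mulr_suml; congr (_ * _).
rewrite -(prod_sum_tuple (fun a x => E (tnth I a) x * E (tnth K a) x)).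
apply: eq_bigr => a _; rewrite invG mxE; apply: eq_bigr => x _; by rewrite mxE.
Qed.

Lemma prod_cat_tuple (I C : k.-tuple 'I_(k + l)) (K L : l.-tuple 'I_(k + l)) :
  \prod_p E (tnth [tuple of I ++ K] p) (tnth [tuple of C ++ L] p) =
  (\prod_a E (tnth I a) (tnth C a)) * \prod_b E (tnth K b) (tnth L b).
Proof.
rewrite big_split_ord/=; congr (_ * _); apply: eq_bigr => a _.
  by rewrite !tnth_lshift.
by rewrite !tnth_rshift.
Qed.

(** In an orthonormal frame raising indices is invisible, and the volume form becomes [frame_sign]
    times the Levi-Civita symbol. *)
Lemma hodge_frame (T : @ktensor R (k + l) k) L :
  tframe E (hodge o G T) L = frame_sign *
    (k`!%:R^-1 * \sum_C tframe E T C * levi_civita [tuple of C ++ L]).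
Proof.
rewrite mulrCA.
rewrite {1}/tframe /hodge.
under eq_bigr do rewrite mulrCA.
rewrite -mulr_sumr; congr (_ * _); rewrite [RHS]mulr_sumr.
under eq_bigr do rewrite mulr_sumr.
transitivity (\sum_C tframe E T C * (o * Num.sqrt (\det G)) *
   \sum_(P : (k + l).-tuple _) (\prod_p E (tnth P p) (tnth [tuple of C ++ L] p))
      * levi_civita P).
  under [RHS]eq_bigr do rewrite sum_cat_tuple mulr_sumr.
  rewrite [RHS]exchange_big/= exchange_big/=; apply: eq_bigr => I _.
  under [RHS]eq_bigr do rewrite mulr_sumr.
  rewrite [RHS]exchange_big/=; apply: eq_bigr => K _.
  rewrite raise_frame /volume_form mulr_suml mulr_sumr; apply: eq_bigr => C _.
  by rewrite prod_cat_tuple; ring.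
apply: eq_bigr => C _; rewrite levi_civita_det /frame_sign; ring.
Qed.

(** The volume normalisation evaluated on the frame E. The sum over permutations in [wedge] becomes
    one over all pairs of tuples, because the Levi-Civita symbol vanishes off the permutations. *)
Lemma wedge_frame (S : @ktensor R (k + l) k) (T : @ktensor R (k + l) l) :
  (forall I, 4^-1 * wedge S T I = volume_form o G I) ->
  \sum_(A : k.-tuple _) \sum_(B : l.-tuple _) levi_civita [tuple of A ++ B] *
    (tframe E S A * tframe E T B) =
  4 * (k`!%:R * l`!%:R) * frame_sign.
Proof.
move=> ST.
have kl0 : k`!%:R * l`!%:R != 0 :> R by rewrite mulf_neq0// pnatr_eq0 -lt0n fact_gt0.
have lc1 : levi_civita (ord_tuple (k + l)) = 1 :> R.
  rewrite /levi_civita (_ : \matrix_(_, _) _ = 1%:M) ?det1//.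
  by apply/matrixP => a b; rewrite !mxE tnth_ord_tuple.
have detE := levi_civita_det E (ord_tuple (k + l)).
rewrite lc1 mulr1 in detE; rewrite /frame_sign -detE !mulr_sumr.
transitivity (\sum_(P : (k + l).-tuple _)
   (\prod_a E (tnth P a) (tnth (ord_tuple (k + l)) a)) * (k`!%:R * l`!%:R * wedge S T P)); last first.
  apply: eq_bigr => P _.
  have -> : wedge S T P = 4 * volume_form o G P by rewrite -ST mulVKf// pnatr_eq0.
  by rewrite /volume_form; ring.
under [RHS]eq_bigr do rewrite /wedge mulVKf// mulr_sumr.
rewrite [RHS]exchange_big/=.
pose F (Q : (k + l).-tuple 'I_(k + l)) :=
  tframe E S [tuple tnth Q (lshift l a) | a < k] *
  tframe E T [tuple tnth Q (rshift k b) | b < l].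
transitivity (\sum_Q levi_civita Q * F Q).
  rewrite sum_cat_tuple; apply: eq_bigr => A _; apply: eq_bigr => B _.
  congr (_ * (tframe E S _ * tframe E T _)); apply: eq_from_tnth => a; rewrite tnth_mktuple.
    by rewrite tnth_lshift.
  by rewrite tnth_rshift.
rewrite sum_levi_civita; apply: eq_bigr => s _.
pose h (P : (k + l).-tuple 'I_(k + l)) := [tuple tnth P (s a) | a < k + l].
pose h' (P : (k + l).-tuple 'I_(k + l)) := [tuple tnth P ((s^-1)%g a) | a < k + l].
(* Permuting P by s^-1 undoes the permutation inside [wedge], so that P splits as A followed by
   B. *)
rewrite [RHS](reindex h'); last first.
  exists h => P _; apply: eq_from_tnth => a; rewrite !tnth_mktuple ?permK//.
  by rewrite permKV.
rewrite sum_cat_tuple /F /tframe mulr_suml mulr_sumr.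
apply: eq_bigr => A _; rewrite !mulr_sumr; apply: eq_bigr => B _.
set P := [tuple of A ++ B].
have -> : \prod_a E (tnth (h' P) a) (tnth (ord_tuple (k + l)) a) =
    \prod_a E (tnth P a) (s a).
  rewrite (reindex_inj (@perm_inj _ s)); apply: eq_bigr => a _.
  by rewrite tnth_mktuple permK tnth_ord_tuple.
rewrite big_split_ord/=.
have -> : [tuple tnth (h' P) (s (lshift l a)) | a < k] = A.
  by apply: eq_from_tnth => a; rewrite !tnth_mktuple permK tnth_lshift.
have -> : [tuple tnth (h' P) (s (rshift k b)) | b < l] = B.
  by apply: eq_from_tnth => a; rewrite !tnth_mktuple permK tnth_rshift.
have -> : \prod_(a < k) E (tnth A a)
    (tnth [tuple tnth [tuple s a | a < k + l] (lshift l a) | a < k] a) =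
    \prod_(a < k) E (tnth P (lshift l a)) (s (lshift l a)).
  by apply: eq_bigr => a _; rewrite !tnth_mktuple tnth_lshift.
have -> : \prod_(a < l) E (tnth B a)
    (tnth [tuple tnth [tuple s a | a < k + l] (rshift k a) | a < l] a) =
    \prod_(a < l) E (tnth P (rshift k a)) (s (rshift k a)).
  by apply: eq_bigr => a _; rewrite !tnth_mktuple tnth_rshift.
have alg (e p q u v : R) : e * ((p * u) * (q * v)) = (p * q) * (e * u * v) by ring.
exact: alg.
Qed.

End Hodge.
End FrameComponents.

(** * The standard complex volume form *)

Definition isgn (i j : nat) : int := if (i < j)%N then 1 else if (j < i)%N then -1 else 0.

(** The Levi-Civita symbol as the product of the signs of all pairwise differences, which evaluates
    without expanding a determinant. *)
Definition eps6 (a b c d e f : nat) : int :=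
  isgn a b * isgn a c * isgn a d * isgn a e * isgn a f *
  (isgn b c * isgn b d * isgn b e * isgn b f) *
  (isgn c d * isgn c e * isgn c f) * (isgn d e * isgn d f) * isgn e f.

Definition eps3 (a b c : nat) : int := isgn a b * isgn a c * isgn b c.

(* real and imaginary parts of the m-th power of the imaginary unit, for m <= 3 *)
Definition re_pow_i (m : nat) : int := nth 0 [:: 1; 0; -1; 0] m.
Definition im_pow_i (m : nat) : int := nth 0 [:: 0; 1; 0; -1] m.

(* components of Re and Im (dz_0 /\ dz_1 /\ dz_2), z_a = x_2a + i x_(2a+1);
   integers indexed by nat, so that the finite identities they satisfy can be
   decided by evaluation *)
Definition re_dz (i j k : nat) : int :=
  eps3 i./2 j./2 k./2 * re_pow_i (odd i + odd j + odd k).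
Definition im_dz (i j k : nat) : int :=
  eps3 i./2 j./2 k./2 * im_pow_i (odd i + odd j + odd k).

Definition sum6 (f : nat -> int) : int := f 0 + f 1 + f 2 + f 3 + f 4 + f 5.
Definition all6 (P : nat -> bool) := [&& P 0, P 1, P 2, P 3, P 4 & P 5].

Lemma sum6E (R : pzRingType) (f : nat -> int) :
  \sum_(i < 6) (f i)%:~R = (sum6 f)%:~R :> R.
Proof. by rewrite /sum6 !big_ord_recr big_ord0/= add0r !rmorphD. Qed.

Lemma all6P (P : nat -> bool) (i : 'I_6) : all6 P -> P i.
Proof.
by case/and5P=> ? ? ? ? /andP[? ?]; case: i => -[|[|[|[|[|[|//]]]]]].
Qed.

(** The Hodge star takes the real part of dz_0 /\ dz_1 /\ dz_2 to its imaginary part; 6 = 3! since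
    the sum runs over all triples rather than increasing ones. *)
Lemma hodge_re_check : all6 (fun l => all6 (fun m => all6 (fun n =>
  sum6 (fun i => sum6 (fun j => sum6 (fun k => re_dz i j k * eps6 i j k l m n)))
  == 6 * im_dz l m n))).
Proof. by vm_compute. Qed.

Lemma hodge_im_check : all6 (fun l => all6 (fun m => all6 (fun n =>
  sum6 (fun i => sum6 (fun j => sum6 (fun k => im_dz i j k * eps6 i j k l m n)))
  == - (6 * re_dz l m n)))).
Proof. by vm_compute. Qed.

(** Four increasing triples carry a component 1 or -1, each in 3! orders. *)
Lemma re_dz_norm : sum6 (fun i => sum6 (fun j => sum6 (fun k => re_dz i j k * re_dz i j k))) = 24.
Proof. by vm_compute. Qed.
Lemma im_dz_norm : sum6 (fun i => sum6 (fun j => sum6 (fun k => im_dz i j k * im_dz i j k))) = 24.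
Proof. by vm_compute. Qed.
Lemma re_im_dz_orth : sum6 (fun i => sum6 (fun j => sum6 (fun k => re_dz i j k * im_dz i j k))) = 0.
Proof. by vm_compute. Qed.

(** The symbol is 0, 1 or -1, hence its own sign, and can be read off from any quantity of that
    sign. *)
Lemma levi_civita_sg (R : realType) n (I : n.-tuple 'I_n) :
  Num.sg (levi_civita I : R) = levi_civita I.
Proof.
have [inj|ninj] := boolP (injectiveb (tnth I)).
  rewrite /levi_civita (_ : \matrix_(_, _) _ = perm_mx (perm (injectiveP _ inj))).
    by rewrite det_perm; case: (odd_perm _); rewrite ?expr1 ?sgrN sgr1.
  by apply/matrixP => a b; rewrite !mxE permE.
have [a [b [ab Iab]]] : exists a b, a != b /\ tnth I a = tnth I b.
  have [a [b ba Iab]] := injectivePn _ ninj; by exists a, b.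
rewrite /levi_civita (determinant_alternate ab) ?sgr0// => x.
by rewrite !mxE Iab.
Qed.

Lemma sg_isgn (R : realType) (i j : nat) : Num.sg (j%:R - i%:R : R) = (isgn i j)%:~R.
Proof.
rewrite /isgn; case: ltngtP => [ij|ji|->]; last by rewrite subrr sgr0.
  by rewrite gtr0_sg// subr_gt0 ltr_nat.
by rewrite ltr0_sg// subr_lt0 ltr_nat.
Qed.

(** Selecting nodes by I multiplies the Vandermonde determinant of 0, ..., 5, which is positive, by
    the symbol. The symbol is therefore the sign of a product of differences. *)
Lemma levi_civita6 (R : realType) (a b c d e f : 'I_6) :
  levi_civita [tuple a; b; c; d; e; f] = (eps6 a b c d e f)%:~R :> R.
Proof.
rewrite -levi_civita_sg; set I := [tuple a; b; c; d; e; f].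
pose v (K : 6.-tuple 'I_6) : 'rV[R]_6 := \row_p (tnth K p)%:R.
have VE : \det (\matrix_(p, q) (tnth I p == q)%:R) * \det (Vandermonde 6 (v (ord_tuple 6)))
    = \det (Vandermonde 6 (v I)) :> R.
  rewrite -[X in _ * X]det_tr -det_mulmx -[RHS]det_tr; congr (\det _).
  apply/matrixP => p q; rewrite !mxE (bigD1 (tnth I p))//= !mxE eqxx mul1r.
  rewrite tnth_ord_tuple big1 ?addr0// => x /negPf xI.
  by rewrite !mxE eq_sym xI mul0r.
have V0 : 0 < \det (Vandermonde 6 (v (ord_tuple 6))).
  rewrite det_Vandermonde; apply: prodr_gt0 => p _; apply: prodr_gt0 => q pq.
  by rewrite !mxE !tnth_ord_tuple subr_gt0 ltr_nat.
have := congr1 Num.sg VE; rewrite sgrM (gtr0_sg V0) mulr1 => ->.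
rewrite det_Vandermonde.
rewrite (big_morph Num.sg (@sgrM R) (@sgr1 R)).
transitivity (\prod_(p < 6) \prod_(q < 6 | (p < q)%N)
    (isgn (nth a I p) (nth a I q))%:~R : R).
  apply: eq_bigr => p _; rewrite (big_morph Num.sg (@sgrM R) (@sgr1 R)).
  by apply: eq_bigr => q _; rewrite !mxE !(tnth_nth a) sg_isgn.
pose G (p q : nat) : R := (isgn (nth a I p) (nth a I q))%:~R.
rewrite -(big_mkord xpredT (fun p => \prod_(q < 6 | (p < q)%N) G p q)).
under eq_bigr do rewrite -(big_mkord (fun q => _ < q)%N (G _)).
rewrite !big_nat_recr ?big_nil//=.
rewrite unlock /= /G /= /eps6 !rmorphM /= !mulr1 !mul1r.
by rewrite -?mulrA.
Qed.

(** * Orientation of frames adapted to a complex structure *)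

Section Orientation.
Context {R : realType}.

(** The block matrix is the real form of A + iB, and its determinant is that of A + iB times its
    conjugate: unipotent complex block matrices make it block triangular. *)
Lemma det_complex_block_ge0 p (A B : 'M[R]_p) : 0 <= \det (block_mx A (- B) B A).
Proof.
pose f := real_complex R.
pose Z := map_mx f A + 'i%C *: map_mx f B.
have Zc : \det (map_mx f A - 'i%C *: map_mx f B) = conjc (\det Z).
  rewrite -[RHS]det_map_mx; congr (\det _); apply/matrixP => i j.
  by rewrite !mxE; apply/eqP; rewrite eq_complex /=; apply/andP; split; apply/eqP; ring.
have E : block_mx 1%:M ('i%C)%:M 0 1%:M *m block_mx (map_mx f A) (- map_mx f B)
      (map_mx f B) (map_mx f A) *m block_mx 1%:M (- ('i%C)%:M) 0 1%:M
    = block_mx Z 0 (map_mx f B) (map_mx f A - 'i%C *: map_mx f B).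
  rewrite mulmx_block !mul1mx !mul0mx !add0r mulmx_block !mulmx1 !mulmx0 !addr0.
  rewrite !mulmxN !mul_mx_scalar !mul_scalar_mx; congr block_mx.
    apply/matrixP => u v; rewrite !mxE.
    rewrite (_ : _ + _ = - ('i%C * 'i%C + 1) * (B u v)%:C%C); last by rewrite /f/=; ring.
    by rewrite -expr2 sqr_i addrC subrr oppr0 mul0r.
  by rewrite addrC.
have := congr1 determinant E.
rewrite !det_mulmx !det_ublock !det1 det_lblock !mul1r !mulr1 Zc.
rewrite -(map_mxN (real_complex R) B) -(map_block_mx (real_complex R)) det_map_mx => H.
suff : 0 <= (\det (block_mx A (- B) B A))%:C%C by rewrite lecR.
by rewrite [X in _ <= X]H mul_conjC_ge0.
Qed.

(** The two column orders differ by a permutation matrix that does not depend on V; p is its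
    determinant. *)
Lemma det_complex_frame_row (J : 'M[R]_6) : exists p : R, forall V : 'M[R]_(6, 3),
  \det (complex_frame J V) = \det (row_mx V (J *m V) : 'M_(6, 3 + 3)) * p.
Proof.
pose h (a : 'I_6) : 'I_(3 + 3) :=
  if odd a then rshift 3 (inord a./2) else lshift 3 (inord a./2).
exists (\det (\matrix_(b, a) (b == h a)%:R)) => V.
rewrite -det_mulmx; congr (\det _); apply/matrixP => i a.
rewrite [LHS]mxE [RHS]mxE (bigD1 (h a))//= [X in _ * X + _]mxE eqxx mulr1 big1 ?addr0 => [|b /negPf ba]; last first.
  by rewrite [X in _ * X]mxE ba mulr0.
rewrite /h; case: (odd a) => /=; first exact: esym (row_mxEr _ _ _ _).
exact: esym (row_mxEl _ _ _ _).
Qed.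

(** Any V' is V A + J V B, so its frame determinant is that of V times the determinant of the real
    form of A + iB, which is nonnegative. One nondegenerate frame thus settles the existential
    condition in [orientation_sign]. *)
Lemma orientation_sign_frame (J : 'M[R]_6) (V : 'M[R]_(6, 3)) :
  J *m J = - 1%:M -> \det (complex_frame J V) != 0 ->
  orientation_sign J = Num.sg (\det (complex_frame J V)).
Proof.
move=> JJ dV; have [p pE] := det_complex_frame_row J.
pose N : 'M_(6, 3 + 3) := row_mx V (J *m V).
have uN : (N : 'M_6) \in unitmx.
  by rewrite unitmxE unitfE; apply: contraNneq dV => d0; rewrite pE [\det _]d0 mul0r.
have rel V' : exists2 d, 0 <= d & \det (complex_frame J V') = d * \det (complex_frame J V).
  pose C := invmx (N : 'M_6) *m V'.
  pose A : 'M_3 := usubmx (C : 'M_(3 + 3, 3)); pose B : 'M_3 := dsubmx (C : 'M_(3 + 3, 3)).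
  exists (\det (block_mx A (- B) B A)); first exact: det_complex_block_ge0.
  rewrite !pE mulrA [_ * \det (row_mx V _)]mulrC -det_mulmx; congr (\det _ * _).
  have V'E : V' = V *m A + J *m V *m B.
    by rewrite -mul_row_col vsubmxK mulKVmx.
  apply: etrans _ (esym (mul_row_block V (J *m V) A (- B) B A)); rewrite -V'E.
  congr row_mx.
  by rewrite V'E mulmxDr !mulmxA JJ !mulNmx mul1mx mulmxN addrC.
rewrite /orientation_sign; case: asboolP => [[V' V'0]|nV].
  have [d d0 dE] := rel V'; move: V'0; rewrite dE => dV0.
  have d1 : 0 < d.
    by rewrite lt_neqAle d0 andbT eq_sym; apply: contraTneq dV0 => ->; rewrite mul0r ltxx.
  by rewrite gtr0_sg// -(pmulr_rgt0 _ d1).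
rewrite ltr0_sg// lt_neqAle dV/= leNgt; apply/negP => dV0; by apply: nV; exists V.
Qed.

End Orientation.

(* J e_p = jsg p e_(jdx p) in an adapted frame *)
Definition jdx (p : nat) : nat := if odd p then p.-1 else p.+1.
Definition jsg (p : nat) : int := if odd p then -1 else 1.

(** * Real 3-forms of type (3,0)+(0,3) in standard coordinates *)

Section StandardForm.
Context {R : realType}.

Lemma alternating3_std (X : nat -> nat -> nat -> R) :
  (forall i j k, X i j k = - X j i k) -> (forall i j k, X i j k = - X i k j) ->
  forall i j k, (i < 3)%N -> (j < 3)%N -> (k < 3)%N ->
  X i j k = X 0 1 2 * (eps3 i j k)%:~R.
Proof.
move=> A B.
have Z0 i j : X i i j = 0 by have := A i i j; lra.
have Z1 i j : X i j j = 0 by have := B i j j; lra.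
have Z2 i j : X i j i = 0 by rewrite B Z0 oppr0.
have E0 : X 0 2 1 = - X 0 1 2 by rewrite B.
have E1 : X 1 0 2 = - X 0 1 2 by rewrite A.
have E2 : X 1 2 0 = X 0 1 2 by rewrite B E1 opprK.
have E3 : X 2 0 1 = X 0 1 2 by rewrite A E0 opprK.
have E4 : X 2 1 0 = - X 0 1 2 by rewrite B E3.
move=> [|[|[|//]]] [|[|[|//]]] [|[|[|//]]] _ _ _;
  rewrite ?Z0 ?Z1 ?Z2 ?E0 ?E1 ?E2 ?E3 ?E4 /eps3 /isgn /=; ring.
Qed.

(** As J moves between slots, t is determined by its values with all indices even and with only the
    first odd. Both are alternating in the halved indices, hence given by one number each. *)
Lemma complex3form_std (t : nat -> nat -> nat -> R) :
  (forall i j k, t i j k = - t j i k) -> (forall i j k, t i j k = - t i k j) ->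
  (forall i j k, (i < 6)%N -> (j < 6)%N -> (k < 6)%N ->
    (jsg j)%:~R * t i (jdx j) k = (jsg k)%:~R * t i j (jdx k)) ->
  forall i j k, (i < 6)%N -> (j < 6)%N -> (k < 6)%N ->
  t i j k = t 0 2 4 * (re_dz i j k)%:~R + t 1 2 4 * (im_dz i j k)%:~R.
Proof.
move=> A B S.
have S12 i j k : (i < 6)%N -> (j < 6)%N -> (k < 6)%N ->
    (jsg i)%:~R * t (jdx i) j k = (jsg j)%:~R * t i (jdx j) k.
  move=> i6 j6 k6; have := S k i j k6 i6 j6.
  by rewrite A B !(A k i) !(B i k) !(mulrN, opprK).
have half i : (i < 6)%N -> exists a u, [/\ (a < 3)%N & i = (u : bool) + a.*2]%N.
  move=> i6; exists i./2, (odd i); rewrite odd_double_half; split => //.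
  by case: i i6 => [|[|[|[|[|[|//]]]]]].
have L0 a : (a < 3)%N -> (a.*2 < 6)%N by case: a => [|[|[|//]]].
have L1 a : (a < 3)%N -> (a.*2.+1 < 6)%N by case: a => [|[|[|//]]].
have J0 a : jdx a.*2 = a.*2.+1 by rewrite /jdx odd_double.
have J1 a : jdx a.*2.+1 = a.*2 by rewrite /jdx /= odd_double.
have s0 a : jsg a.*2 = 1 by rewrite /jsg odd_double.
have s1 a : jsg a.*2.+1 = -1 by rewrite /jsg /= odd_double.
pose X a b c := t a.*2 b.*2 c.*2.
pose Y a b c := t a.*2.+1 b.*2 c.*2.
(* Two odd indices cost a sign, as J has square -1: with 0, 1, 2 or 3 odd indices the component is
   X, Y, - X or - Y. *)
have m3 a b c : (a < 3)%N -> (b < 3)%N -> (c < 3)%N ->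
   [/\ t a.*2 b.*2.+1 c.*2 = Y a b c, t a.*2 b.*2 c.*2.+1 = Y a b c,
       t a.*2.+1 b.*2.+1 c.*2 = - X a b c, t a.*2.+1 b.*2 c.*2.+1 = - X a b c &
       t a.*2 b.*2.+1 c.*2.+1 = - X a b c /\ t a.*2.+1 b.*2.+1 c.*2.+1 = - Y a b c].
  move=> a3 b3 c3; rewrite /X /Y.
  have := S12 _ _ c.*2 (L0 a a3) (L0 b b3) (L0 c c3).
  have := S12 _ _ c.*2 (L1 a a3) (L0 b b3) (L0 c c3).
  have := S12 _ _ c.*2.+1 (L1 a a3) (L0 b b3) (L1 c c3).
  have := S a.*2 _ _ (L0 a a3) (L0 b b3) (L0 c c3).
  have := S a.*2.+1 _ _ (L1 a a3) (L0 b b3) (L0 c c3).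
  have := S a.*2 _ _ (L0 a a3) (L1 b b3) (L0 c c3).
  rewrite !(J0, J1, s0, s1) => *; split; [lra..|split; lra].
have XE a b c := @alternating3_std X (fun i j k => A _ _ _) (fun i j k => B _ _ _) a b c.
have YE a b c : (a < 3)%N -> (b < 3)%N -> (c < 3)%N ->
    Y a b c = Y 0 1 2 * (eps3 a b c)%:~R.
  (* Antisymmetry of Y in its first two arguments rests on the slot identity, known only below 3;
     extension by 0 makes it hold for all indices. *)
  pose Y' a b c := if [&& (a < 3)%N, (b < 3)%N & (c < 3)%N] then Y a b c else 0.
  move=> a3 b3 c3; rewrite -[LHS](_ : Y' a b c = _); last by rewrite /Y' a3 b3 c3.
  apply: (@alternating3_std Y') => // i j k; rewrite /Y'.
    rewrite andbCA; case: ifP; rewrite ?oppr0// => /and3P[j3 i3 k3].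
    have [e1 _ _ _ _] := m3 i j k i3 j3 k3; rewrite -e1.
    by rewrite A.
  rewrite [X in _ = - (if _ && X then _ else _)]andbC.
  by case: ifP; rewrite ?oppr0// => _; rewrite /Y B.
move=> i j k /half[a [u [a3 ->]]] /half[b [v [b3 ->]]] /half[c [w [c3 ->]]].
rewrite /re_dz /im_dz !half_bit_double !oddD !odd_double !addbF !oddb 2!intrM.
have [e1 e2 e3 e4 [e5 e6]] := m3 a b c a3 b3 c3.
have := XE a b c a3 b3 c3; have := YE a b c a3 b3 c3.
rewrite -[X 0%N 1%N 2]/(t 0 2 4) -[Y 0%N 1%N 2]/(t 1 2 4).
move: (_%:~R) => e.
move: e1 e2 e3 e4 e5 e6; rewrite /X /Y.
case: u; case: v; case: w; rewrite ?add0n ?add1n /= => *;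
  rewrite /re_pow_i /im_pow_i /=; lra.
Qed.

End StandardForm.

Section Families.
Context {R : realType} {n : nat}.
Implicit Types (E : 'M[R]_n) (X Y : 'I_n -> 'M[R]_n) (T : @ktensor R n 3).

Definition fam T (k : 'I_n) : 'M[R]_n := \matrix_(i, j) T [tuple k; i; j].

(* X stands for the 3-tensor X k i j; the columns of E are the new frame *)
Definition fcomp E X (p : 'I_n) : 'M[R]_n :=
  \sum_k E k p *: (E^T *m X k *m E).

Lemma fcompE E X p q r : fcomp E X p q r =
  \sum_k \sum_i \sum_j E k p * E i q * E j r * X k i j.
Proof.
rewrite /fcomp summxE; apply: eq_bigr => k _; rewrite !mxE mulr_sumr.
rewrite exchange_big/=; apply: eq_bigr => j _; rewrite mxE mulr_suml mulr_sumr.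
by apply: eq_bigr => i _; rewrite mxE; ring.
Qed.

Lemma tframe3E E T p q r : tframe E T [tuple p; q; r] =
  \sum_k \sum_i \sum_j E k p * E i q * E j r * T [tuple k; i; j].
Proof.
rewrite /tframe sum_tuple3; do 3 (apply: eq_bigr => ? _).
by rewrite !big_ord_recl big_ord0 !(tnth_nth p)/= mulr1 !mulrA.
Qed.

Lemma fcomp_fam E T p q r : fcomp E (fam T) p q r = tframe E T [tuple p; q; r].
Proof. by rewrite fcompE tframe3E; do 3 (apply: eq_bigr => ? _); rewrite mxE. Qed.

Lemma fcomp_inj E X Y : E \in unitmx ->
  (forall p, fcomp E X p = fcomp E Y p) -> forall k, X k = Y k.
Proof.
move=> uE XY k; pose Z k := X k - Y k.
have Z0 p : \sum_k E k p *: Z k = 0.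
  have : E^T *m (\sum_k E k p *: Z k) *m E = 0.
    rewrite mulmx_sumr mulmx_suml -[RHS](subrr (fcomp E Y p)) -{1}XY -sumrB.
    apply: eq_bigr => j _.
    by rewrite -scalemxAr -scalemxAl mulmxBr mulmxBl scalerBr.
  move=> /(canRL (mulmxK uE)); rewrite mul0mx => /(canRL (mulKmx _)).
  by rewrite unitmx_tr mulmx0; apply.
apply/eqP; rewrite -subr_eq0 -/(Z k).
transitivity (\sum_p invmx E p k *: \sum_j E j p *: Z j == 0); last first.
  by apply/eqP; rewrite big1// => p _; rewrite Z0 scaler0.
congr (_ == 0); under eq_bigr do rewrite scaler_sumr.
rewrite exchange_big/= (bigD1 k)//= [X in _ = _ + X]big1 ?addr0.
  under eq_bigr do rewrite scalerA mulrC.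
  rewrite -scaler_suml; have := mulmxV uE => /matrixP/(_ k k).
  by rewrite !mxE eqxx => ->; rewrite scale1r.
move=> j /negPf jk; under eq_bigr do rewrite scalerA mulrC.
rewrite -scaler_suml; have := mulmxV uE => /matrixP/(_ j k).
by rewrite !mxE jk => ->; rewrite scale0r.
Qed.

Lemma alternating_swap12 T : alternating T ->
  forall i j k, T [tuple i; j; k] = - T [tuple j; i; k].
Proof.
move=> aT i j k; have := aT [tuple j; i; k] (tperm ord0 (inord 1)).
rewrite odd_tperm -val_eqE/= inordK//= => <-; congr T.
apply: eq_from_tnth => a; rewrite tnth_mktuple; case: a => -[|[|[|//]]] a3.
- by rewrite (_ : Ordinal a3 = ord0) ?tpermL; [rewrite !(tnth_nth i)/= inordK|exact: val_inj].
- rewrite (_ : Ordinal a3 = inord 1) ?tpermR; last by apply: val_inj; rewrite /= inordK.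
  by rewrite !(tnth_nth i)/= inordK.
- rewrite tpermD; first by rewrite !(tnth_nth i).
  + by rewrite -val_eqE.
  + by rewrite -val_eqE/= inordK.
Qed.

Lemma alternating_swap23 T : alternating T ->
  forall i j k, T [tuple i; j; k] = - T [tuple i; k; j].
Proof.
move=> aT i j k; have := aT [tuple i; k; j] (tperm (inord 1) (inord 2)).
rewrite odd_tperm -val_eqE/= !inordK//= => <-; congr T.
apply: eq_from_tnth => a; rewrite tnth_mktuple; case: a => -[|[|[|//]]] a3.
- rewrite tpermD; first by rewrite !(tnth_nth i).
  + by rewrite -val_eqE/= inordK.
  + by rewrite -val_eqE/= inordK.
- rewrite (_ : Ordinal a3 = inord 1) ?tpermL; last by apply: val_inj; rewrite /= inordK.
  by rewrite !(tnth_nth i)/= !inordK.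
- rewrite (_ : Ordinal a3 = inord 2) ?tpermR; last by apply: val_inj; rewrite /= inordK.
  by rewrite !(tnth_nth i)/= !inordK.
Qed.

Lemma fcomp_swap12 E X : (forall i j k, X i j k = - X j i k) ->
  forall p q r, fcomp E X p q r = - fcomp E X q p r.
Proof.
move=> sX p q r; rewrite !fcompE exchange_big/= -sumrN; apply: eq_bigr => i _.
rewrite -sumrN; apply: eq_bigr => j _; rewrite -sumrN; apply: eq_bigr => k _.
by rewrite sX; ring.
Qed.

Lemma fcomp_swap23 E X : (forall i j k, X i j k = - X i k j) ->
  forall p q r, fcomp E X p q r = - fcomp E X p r q.
Proof.
move=> sX p q r; rewrite !fcompE -sumrN; apply: eq_bigr => i _.
rewrite exchange_big/= -sumrN; apply: eq_bigr => j _; rewrite -sumrN.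
by apply: eq_bigr => k _; rewrite sX; ring.
Qed.

End Families.

Section StandardComplexStructure.
Context {R : realType}.

Lemma jdx_lt p : (p < 6)%N -> (jdx p < 6)%N.
Proof. by case: p => [|[|[|[|[|[|//]]]]]]. Qed.

Definition jord (p : 'I_6) : 'I_6 := Ordinal (jdx_lt (ltn_ord p)).

Definition J0 : 'M[R]_6 := \matrix_(i, j) ((jsg j)%:~R *+ (i == jord j)).

Lemma mulmxJ0 m (X : 'M[R]_(m, 6)) i p : (X *m J0) i p = (jsg p)%:~R * X i (jord p).
Proof.
rewrite mxE (bigD1 (jord p))//= mxE eqxx mulr1n big1 ?addr0 1?mulrC// => j /negPf jp.
by rewrite mxE jp mulr0.
Qed.

Lemma mulJ0Tmx m (X : 'M[R]_(6, m)) p i :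
  (J0^T *m X) p i = (jsg p)%:~R * X (jord p) i.
Proof. by rewrite -[_ *m X]trmxK mxE trmx_mul trmxK mulmxJ0 mxE. Qed.

Lemma jordK p : jord (jord p) = p.
Proof.
by apply: val_inj; case: p => -[|[|[|[|[|[|//]]]]]].
Qed.

Lemma jsg_jord p : jsg (jord p) = - jsg p.
Proof. by case: p => -[|[|[|[|[|[|//]]]]]]. Qed.

Lemma J0_tr : J0^T = - J0.
Proof.
apply/matrixP => i j; rewrite !mxE -mulNrn.
have -> : (j == jord i) = (i == jord j) by apply/eqP/eqP => ->; rewrite jordK.
by case: eqP => [->|//]; rewrite jsg_jord rmorphN.
Qed.

End StandardComplexStructure.

(** * Adapted frames *)

Section UnitaryFrames.
Context {R : realType}.
Variables (G J : 'M[R]_6).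
Hypothesis pG : positive_definite G.
Hypothesis JJ : J *m J = - 1%:M.
Hypothesis JGJ : J^T *m G *m J = G.

Let GT : G^T = G. Proof. by have [] := pG. Qed.

Lemma compatible_skew : J^T *m G = - (G *m J).
Proof.
have : J^T *m G *m J *m J = G *m J by rewrite JGJ.
by rewrite -mulmxA JJ mulmxN mulmx1 => <-; rewrite opprK.
Qed.

(** G C has fewer than 6 columns, hence a nonzero vector in its left kernel, which is then
    normalised. *)
Lemma exists_unit_orthogonal m (C : 'M[R]_(6, m)) : (m < 6)%N ->
  exists v : 'cV[R]_6, v^T *m G *m v = 1%:M /\ v^T *m G *m C = 0.
Proof.
move=> m6; have : kermx (G *m C) != 0.
  rewrite -mxrank_eq0 mxrank_ker subn_eq0 -ltnNge.
  by apply: leq_ltn_trans m6; exact: rank_leq_col.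
move=> /rowV0Pn[w wK w0]; have wGC : w *m G *m C = 0.
  by rewrite -mulmxA; exact/sub_kermxP.
have h0 : 0 < (w *m G *m w^T) 0 0.
  have [_ /(_ w^T)] := pG; rewrite trmxK; apply.
  by rewrite -trmx0 (inj_eq trmx_inj).
set h := (w *m G *m w^T) 0 0 in h0.
exists ((Num.sqrt h)^-1 *: w^T); split; last first.
  by rewrite linearZ/= trmxK -!scalemxAl wGC scaler0.
rewrite -scalemxAr linearZ/= trmxK -!scalemxAl scalerA.
rewrite [w *m G *m w^T]mx11_scalar -/h scale_scalar_mx -expr2 exprVn sqr_sqrtr ?ltW//.
by rewrite mulVf// gt_eqF.
Qed.

(** The columns are orthonormal for the Hermitian form with real part G; the two conditions are the
    real and imaginary parts of this. *)
Definition unitary (V : 'M[R]_(6, 3)) :=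
  V^T *m G *m V = 1%:M /\ V^T *m G *m (J *m V) = 0.

Let ent m1 m2 (A : 'M[R]_(6, m1)) (B : 'M[R]_(6, m2)) a b :
  (A^T *m G *m B) a b = \sum_j \sum_i A i a * G i j * B j b.
Proof.
rewrite mxE; apply: eq_bigr => j _; rewrite mxE mulr_suml; apply: eq_bigr => i _.
by rewrite mxE.
Qed.

(** Hermitian Gram-Schmidt: each new unit vector is orthogonal to the earlier ones and to their
    images under J, at most 4 < 6 vectors. *)
Lemma unitary_exists : exists V, unitary V.
Proof.
have m0 (v w : 'cV[R]_6) : v^T *m G *m w = 0 -> w^T *m G *m v = 0.
  move=> vw; rewrite -[LHS]trmxK -[RHS](trmx0 R 1 1) -vw.
  by rewrite !trmx_mul !trmxK GT mulmxA.
have mJ (v w : 'cV[R]_6) : v^T *m G *m (J *m w) = - ((J *m v)^T *m G *m w).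
  by rewrite trmx_mul -(mulmxA v^T J^T G) compatible_skew mulmxN mulNmx opprK !mulmxA.
have mJJ (v : 'cV[R]_6) : v^T *m G *m (J *m v) = 0.
  apply/matrixP => i j; rewrite !ord1.
  have := congr1 (fun A : 'M_1 => A 0 0) (mJ v v).
  have -> : (J *m v)^T *m G *m v = (v^T *m G *m (J *m v))^T.
    by rewrite !trmx_mul !trmxK GT mulmxA.
  by rewrite !mxE; set x := \sum_j _; move=> ?; lra.
have [v0 [n0 _]] := @exists_unit_orthogonal 0 0 isT.
have [v1 [n1]] := @exists_unit_orthogonal (1 + 1) (row_mx v0 (J *m v0)) isT.
rewrite mul_mx_row; move/eqP; rewrite row_mx_eq0 => /andP[/eqP o10 /eqP p10].
have [v2 [n2]] := @exists_unit_orthogonal (1 + 1 + (1 + 1))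
  (row_mx (row_mx v0 (J *m v0)) (row_mx v1 (J *m v1))) isT.
rewrite !mul_mx_row; move/eqP; rewrite !row_mx_eq0.
move=> /andP[/andP[/eqP o20 /eqP p20] /andP[/eqP o21 /eqP p21]].
have sJ (v w : 'cV[R]_6) : v^T *m G *m (J *m w) = 0 -> w^T *m G *m (J *m v) = 0.
  by move=> vw; rewrite mJ (m0 _ _ vw) oppr0.
pose v (a : 'I_3) := nth v0 [:: v0; v1; v2] a.
pose V : 'M[R]_(6, 3) := \matrix_(i, a) v a i 0.
have VE (B : 'M[R]_6) a b : (V^T *m G *m (B *m V)) a b =
    ((v a)^T *m G *m (B *m v b)) 0 0.
  rewrite !ent; apply: eq_bigr => j _; apply: eq_bigr => i _; rewrite [V _ _]mxE.
  by congr (_ * _); rewrite !mxE; apply: eq_bigr => k _; rewrite mxE.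
exists V; split; last first.
  apply/matrixP => a b; rewrite VE [RHS]mxE.
  by case: a => -[|[|[|//]]] ?; case: b => -[|[|[|//]]] ?; rewrite /v/=
    ?mJJ ?p10 ?p20 ?p21 ?(sJ _ _ p10) ?(sJ _ _ p20) ?(sJ _ _ p21) mxE.
apply/matrixP => a b; rewrite -[X in _ *m X](mul1mx V) VE mul1mx [RHS]mxE.
by case: a => -[|[|[|//]]] ?; case: b => -[|[|[|//]]] ?; rewrite /v/= ?n0 ?n1 ?n2
    ?o10 ?o20 ?o21 ?(m0 _ _ o10) ?(m0 _ _ o20) ?(m0 _ _ o21) mxE.
Qed.

Definition adapted (E : 'M[R]_6) := E^T *m G *m E = 1%:M /\ J *m E = E *m J0.

Lemma complex_frame_adapted V : unitary V -> adapted (complex_frame J V).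
Proof.
move=> [VV VJV]; set E := complex_frame J V.
pose W b := if b then J *m V else V.
have EE i a : E i a = W (odd a) i (inord a./2) by rewrite mxE.
split; last first.
  have hj (p : 'I_6) : (jdx p)./2 = p./2 by case: p => -[|[|[|[|[|[|//]]]]]].
  have oj (p : 'I_6) : odd (jdx p) = ~~ odd p by case: p => -[|[|[|[|[|[|//]]]]]].
  apply/matrixP => i p; rewrite mulmxJ0 mxE EE/= hj oj.
  under eq_bigr do rewrite EE.
  rewrite /W /jsg; case: (odd p) => /=; last by rewrite mul1r mxE.
  transitivity ((J *m (J *m V)) i (inord p./2)); first by rewrite [RHS]mxE.
  by rewrite mulmxA JJ mulNmx mul1mx mxE mulN1r.
have WW b b' : (W b)^T *m G *m W b' = if b == b' then 1%:M else 0.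
  case: b; case: b' => //=.
  - by rewrite trmx_mul -(mulmxA V^T J^T G) mulmxA -(mulmxA V^T _ J) JGJ VV.
  - have -> : (J *m V)^T *m G *m V = (V^T *m G *m (J *m V))^T.
      by rewrite !trmx_mul !trmxK GT mulmxA.
    by rewrite VJV trmx0.
apply/matrixP => p q; rewrite ent.
transitivity (((W (odd p))^T *m G *m W (odd q)) (inord p./2) (inord q./2)).
  by rewrite ent; apply: eq_bigr => j _; apply: eq_bigr => i _; rewrite !EE.
have h3 (x : 'I_6) : (x./2 < 3)%N by case: x => -[|[|[|[|[|[|//]]]]]].
rewrite WW mxE; case: (eqVneq (odd p) (odd q)) => [opq|opq]; last first.
  by rewrite mxE; case: eqVneq => // pq; rewrite pq eqxx in opq.
rewrite mxE -!val_eqE/= !inordK//; congr (_%:R).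
by rewrite -[in RHS](odd_double_half p) -[in RHS](odd_double_half q) opq eqn_add2l (inj_eq double_inj).
Qed.

Lemma adapted_unitmx E : adapted E -> E \in unitmx.
Proof. by move=> [EGE _]; have [] := mulmx1_unit EGE. Qed.

End UnitaryFrames.

(** J multiplies the (3,0) part by i and the (0,3) part by -i, whichever slot it is inserted in.
    This real identity replaces the complex type in the sequel. *)
Lemma type_slot (R : realType) n (J : 'M[R]_n) (T : @ktensor R n 3) :
  type_k0_0k J T -> forall k, fam T k *m J = J^T *m fam T k.
Proof.
move=> [S [S' [[_ eS] [_ eS'] TE]]] k; apply/matrixP => i j; rewrite !mxE.
have key (I : 3.-tuple 'I_n) a : (\sum_l J l (tnth I a) * T (tupd I a l))%:C%C
    = 'i%C * S I - 'i%C * S' I.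
  rewrite -mulNr -(eS I a) -(eS' I a) -big_split rmorph_sum; apply: eq_bigr => l _ /=.
  by rewrite rmorphM/= TE mulrDr.
have tu1 l : tupd [tuple k; i; j] (inord 1) l = [tuple k; l; j].
  apply: eq_from_tnth => a; rewrite tnth_mktuple -val_eqE/= inordK// (tnth_nth k).
  by case: a => -[|[|[|//]]] ?; rewrite !(tnth_nth k).
have tu2 l : tupd [tuple k; i; j] (inord 2) l = [tuple k; i; l].
  apply: eq_from_tnth => a; rewrite tnth_mktuple -val_eqE/= inordK// (tnth_nth k).
  by case: a => -[|[|[|//]]] ?; rewrite !(tnth_nth k).
apply: (@complexI R).
transitivity ((\sum_l J l (tnth [tuple k; i; j] (inord 2)) *
    T (tupd [tuple k; i; j] (inord 2) l))%:C%C).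
  congr (_%:C%C); apply: eq_bigr => l _.
  by rewrite tu2 mxE mulrC (tnth_nth k)/= inordK.
rewrite key -(key _ (inord 1)); congr (_%:C%C); apply: eq_bigr => l _.
by rewrite tu1 !mxE (tnth_nth k)/= inordK.
Qed.

Lemma sum6_triple (R : pzRingType) (F : 'I_6 -> 'I_6 -> 'I_6 -> R) (a b c : R)
    (f g h : nat -> nat -> nat -> int) :
  (forall i j k, F i j k = a * (f i j k)%:~R + b * (g i j k)%:~R + c * (h i j k)%:~R) ->
  \sum_i \sum_j \sum_k F i j k =
  a * (sum6 (fun i => sum6 (fun j => sum6 (fun k => f i j k))))%:~R +
  b * (sum6 (fun i => sum6 (fun j => sum6 (fun k => g i j k))))%:~R +
  c * (sum6 (fun i => sum6 (fun j => sum6 (fun k => h i j k))))%:~R.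
Proof.
have S (u : nat -> nat -> nat -> int) : \sum_(i < 6) \sum_(j < 6) \sum_(k < 6) (u i j k)%:~R =
    (sum6 (fun i => sum6 (fun j => sum6 (fun k => u i j k))))%:~R :> R.
  rewrite -sum6E; apply: eq_bigr => i _; rewrite -sum6E; apply: eq_bigr => j _.
  by rewrite -sum6E.
move=> FE; rewrite -!S !mulr_sumr -!big_split/=; apply: eq_bigr => i _.
rewrite !mulr_sumr -!big_split/=; apply: eq_bigr => j _.
by rewrite !mulr_sumr -!big_split/=; apply: eq_bigr => k _.
Qed.

(** * Normal form of an SU(3)-structure at a point *)

Section SU3Frame.
Context {R : realType}.
Variables (G J : 'M[R]_6) (T : @ktensor R 6 3).
Hypothesis pG : positive_definite G.
Hypothesis JJ : J *m J = - 1%:M.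
Hypothesis JGJ : J^T *m G *m J = G.
Hypothesis aT : alternating T.
Hypothesis sT : forall k, fam T k *m J = J^T *m fam T k.
Let o := orientation_sign J.
Let H : @ktensor R 6 3 := @hodge R 3 3 o G T.
Hypothesis vT : forall I : 6.-tuple 'I_6,
  4^-1 * @wedge R 6 3 3 T H I = volume_form o G I.

Lemma det_metric_gt0 : 0 < \det G.
Proof.
have [V uV] := unitary_exists pG JJ JGJ.
have [EGE _] := complex_frame_adapted pG JJ JGJ uV.
have := congr1 determinant EGE; rewrite !det_mulmx det_tr det1 mulrAC -expr2 => dE.
rewrite ltNge; apply/negP => dG.
have := mulr_ge0_le0 (sqr_ge0 (\det (complex_frame J V))) dG.
by rewrite dE ler10.
Qed.

(** The orientation sign is the sign of det E, so [frame_sign] is |det E| sqrt (det G) > 0, while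
    its square is 1. *)
Lemma frame_sign1 V : unitary G J V -> @frame_sign R 3 3 o G (complex_frame J V) = 1.
Proof.
move=> uV; have aE := complex_frame_adapted pG JJ JGJ uV.
have uE := adapted_unitmx aE; set E := complex_frame J V in aE uE *.
have dE0 : \det E != 0 by rewrite -unitfE -unitmxE.
have oE : o = Num.sg (\det E) by exact: orientation_sign_frame.
have o2 : o ^+ 2 = 1 by rewrite oE sqr_sg dE0.
have [EGE _] := aE.
have := @frame_sign_sqr R 3 3 o G E EGE o2 (ltW det_metric_gt0).
move/eqP; rewrite sqrf_eq1 => /orP[/eqP//|/eqP s1].
have : 0 < @frame_sign R 3 3 o G E.
  rewrite /frame_sign oE mulrAC -normrEsg mulr_gt0 ?normr_gt0// sqrtr_gt0.
  exact: det_metric_gt0.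
by rewrite s1 oppr_gt0 ltr10.
Qed.

Lemma adapted_slot E : adapted G J E ->
  forall p, fcomp E (fam T) p *m J0 = J0^T *m fcomp E (fam T) p.
Proof.
move=> [_ JE] p; rewrite /fcomp mulmx_suml mulmx_sumr; apply: eq_bigr => k _.
rewrite -scalemxAl -scalemxAr; congr (_ *: _).
rewrite -mulmxA -JE !mulmxA -trmx_mul -JE trmx_mul.
by rewrite -(mulmxA _ (fam T k) J) sT mulmxA.
Qed.

Lemma adapted_comp E : adapted G J E -> exists a b : R,
  [/\ a = fcomp E (fam T) (inord 0) (inord 2) (inord 4),
      b = fcomp E (fam T) (inord 1) (inord 2) (inord 4) &
  forall p q r, fcomp E (fam T) p q r =
    a * (re_dz p q r)%:~R + b * (im_dz p q r)%:~R].
Proof.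
move=> aE; pose t (i j k : nat) := fcomp E (fam T) (inord i) (inord j) (inord k).
exists (t 0 2 4), (t 1 2 4); split => // p q r.
have fT12 i j k : fam T i j k = - fam T j i k by rewrite !mxE (alternating_swap12 aT).
have fT23 i j k : fam T i j k = - fam T i k j by rewrite !mxE (alternating_swap23 aT).
rewrite -[LHS](_ : t p q r = _); last by rewrite /t !inord_val.
apply: complex3form_std => // [i j k|i j k|i j k i6 j6 k6].
- exact: fcomp_swap12.
- exact: fcomp_swap23.
have := adapted_slot aE (inord i) => /matrixP/(_ (inord j) (inord k)).
rewrite mulmxJ0 mulJ0Tmx !inordK// /t => e; apply/esym.
have jE m : (m < 6)%N -> jord (inord m) = inord (jdx m).
  by move=> m6; apply: val_inj; rewrite /= !inordK// jdx_lt.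
by rewrite -!jE.
Qed.

Lemma hodge_comp V a b : unitary G J V ->
  (forall p q r, fcomp (complex_frame J V) (fam T) p q r =
    a * (re_dz p q r)%:~R + b * (im_dz p q r)%:~R) ->
  forall p q r, fcomp (complex_frame J V) (fam H) p q r =
    a * (im_dz p q r)%:~R - b * (re_dz p q r)%:~R.
Proof.
move=> uV TE l m n; have [EGE _] := complex_frame_adapted pG JJ JGJ uV.
rewrite fcomp_fam [LHS](@hodge_frame R 3 3 o G _ EGE T _) frame_sign1// mul1r sum_tuple3.
have E i j k : tframe (complex_frame J V) T [tuple i; j; k] *
    levi_civita [tuple of [tuple i; j; k] ++ [tuple l; m; n]] =
    a * (re_dz i j k * eps6 i j k l m n)%:~R + b * (im_dz i j k * eps6 i j k l m n)%:~R
    + 0 * 0%:~R.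
  rewrite -fcomp_fam TE (_ : [tuple of _] = [tuple i; j; k; l; m; n]); last exact: val_inj.
  by rewrite levi_civita6 !intrM; ring.
rewrite (sum6_triple (f := fun i j k => re_dz i j k * eps6 i j k l m n)
  (g := fun i j k => im_dz i j k * eps6 i j k l m n) (h := fun _ _ _ => 0) E).
rewrite mul0r addr0.
have /(all6P l)/(all6P m)/(all6P n)/eqP -> := hodge_re_check.
have /(all6P l)/(all6P m)/(all6P n)/eqP -> := hodge_im_check.
have f6 : (3`!)%:R = 6 :> R by [].
have e6 : (6 : int)%:~R = 6 :> R by [].
rewrite f6 rmorphN 2!intrM e6; move: (_%:~R) (_%:~R) => x y.
by field.
Qed.

(** In the frame the volume condition reads 6 * 24 * (a^2 + b^2) = 4 * 3! * 3!. *)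
Lemma comp_norm V a b : unitary G J V ->
  (forall p q r, fcomp (complex_frame J V) (fam T) p q r =
    a * (re_dz p q r)%:~R + b * (im_dz p q r)%:~R) -> a ^+ 2 + b ^+ 2 = 1.
Proof.
move=> uV TE; have [EGE _] := complex_frame_adapted pG JJ JGJ uV.
have HE := hodge_comp uV TE.
have := @wedge_frame R 3 3 o G (complex_frame J V) T H vT; rewrite frame_sign1// mulr1 exchange_big/=.
have E (B : 3.-tuple 'I_6) : \sum_(A : 3.-tuple 'I_6) levi_civita [tuple of A ++ B] *
      (tframe (complex_frame J V) T A * tframe (complex_frame J V) H B) =
    6 * tframe (complex_frame J V) H B ^+ 2.
  transitivity (6 * (3`!%:R^-1 * \sum_(A : 3.-tuple 'I_6) tframe (complex_frame J V) T A *
      levi_civita [tuple of A ++ B]) * tframe (complex_frame J V) H B).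
    rewrite (_ : 6 * _ = \sum_(A : 3.-tuple 'I_6) tframe (complex_frame J V) T A *
      levi_civita [tuple of A ++ B]); last by rewrite mulrA divff ?mul1r// pnatr_eq0.
    by rewrite mulr_suml; apply: eq_bigr => A _; rewrite mulrA [levi_civita _ * _]mulrC.
  have -> : tframe (complex_frame J V) H B = 3`!%:R^-1 *
      \sum_(A : 3.-tuple 'I_6) tframe (complex_frame J V) T A *
      levi_civita [tuple of A ++ B].
    by rewrite [LHS](@hodge_frame R 3 3 o G _ EGE T _) frame_sign1// mul1r.
  by rewrite -mulrA expr2.
under eq_bigr do rewrite E.
rewrite -mulr_sumr sum_tuple3.
have E2 i j k : tframe (complex_frame J V) H [tuple i; j; k] ^+ 2 =
    a ^+ 2 * (im_dz i j k * im_dz i j k)%:~R + b ^+ 2 * (re_dz i j k * re_dz i j k)%:~R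
    + (- 2 * a * b) * (re_dz i j k * im_dz i j k)%:~R.
  by rewrite -fcomp_fam HE !intrM; ring.
rewrite (sum6_triple (f := fun i j k => im_dz i j k * im_dz i j k)
  (g := fun i j k => re_dz i j k * re_dz i j k)
  (h := fun i j k => re_dz i j k * im_dz i j k) E2).
rewrite re_dz_norm im_dz_norm re_im_dz_orth.
have f6 : (3`!)%:R = 6 :> R by [].
have e24 : (24 : int)%:~R = 24 :> R by [].
by rewrite f6 e24 mulr0 addr0 => e; lra.
Qed.

(** In a unitary frame Psi+ is a Re + b Im with (a, b) on the unit circle. A phase on the first
    vector keeps the frame unitary and can move (a, b) to (1, 0). *)
Theorem su3_frame : exists E, [/\ adapted G J E,
  forall p q r, fcomp E (fam T) p q r = (re_dz p q r)%:~R &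
  forall p q r, fcomp E (fam H) p q r = (im_dz p q r)%:~R].
Proof.
have [V uV] := unitary_exists pG JJ JGJ.
have aE := complex_frame_adapted pG JJ JGJ uV.
have [a [b [aD bD TE]]] := adapted_comp aE.
have ab := comp_norm uV TE.
have [VV VJV] := uV.
(* the phase rotation of the first vector that makes Psi real *)
pose da : 'rV[R]_3 := \row_i (if i == ord0 then a else 1).
pose db : 'rV[R]_3 := \row_i (if i == ord0 then b else 0).
pose D := diag_mx da; pose B := diag_mx db; pose V' := V *m D + J *m V *m B.
have DD : D *m D + B *m B = 1%:M.
  rewrite /D /B !mulmx_diag -linearD/= -diag_const_mx; congr diag_mx.
  by apply/rowP => i; rewrite !mxE; case: ifP => _; rewrite -?expr2//; ring.
have DB : D *m B = B *m D by rewrite /D /B diag_mx_comm.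
have JVV : (J *m V)^T *m G *m V = 0.
  have -> : (J *m V)^T *m G *m V = (V^T *m G *m (J *m V))^T.
    by have [GT _] := pG; rewrite !trmx_mul !trmxK GT mulmxA.
  by rewrite VJV trmx0.
have JVJV : (J *m V)^T *m G *m (J *m V) = 1%:M.
  by rewrite trmx_mul -(mulmxA V^T J^T G) mulmxA -(mulmxA V^T _ J) JGJ VV.
have JV' : J *m V' = J *m V *m D - V *m B.
  by rewrite /V' mulmxDr !mulmxA JJ !mulNmx mul1mx.
have V'T : V'^T = D *m V^T + B *m (J *m V)^T.
  by rewrite /V' linearD/= !trmx_mul !tr_diag_mx.
have quad (X Y : 'M[R]_(6, 3)) (C F : 'M[R]_3) :
    C *m X^T *m G *m (Y *m F) = C *m (X^T *m G *m Y) *m F by rewrite !mulmxA.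
have uV' : unitary G J V'.
  split; rewrite V'T.
    rewrite /V' !(mulmxDl, mulmxDr) !quad VV VJV JVV JVJV.
    by rewrite !mulmx0 !mul0mx !mulmx1 addr0 add0r.
  rewrite JV' !(mulmxDl, mulmxBr) !quad VV VJV JVV JVJV.
  by rewrite !mulmx0 !mul0mx !mulmx1 sub0r subr0 DB addrC subrr.
have aE' := complex_frame_adapted pG JJ JGJ uV'.
have [a' [b' [a'D b'D TE']]] := adapted_comp aE'.
have Eent (W : 'M[R]_(6, 3)) i k : (k < 3)%N -> complex_frame J W i (inord k.*2) = W i (inord k).
  by move=> k3; rewrite mxE inordK ?odd_double ?doubleK//; case: k k3 => [|[|[|//]]].
have Eent1 (W : 'M[R]_(6, 3)) i : complex_frame J W i (inord 1) = (J *m W) i ord0.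
  by rewrite mxE !inordK//=; congr ((J *m W) i _); apply: val_inj; rewrite /= inordK.
have V'i i k : V' i k = V i k * da 0 k + (J *m V) i k * db 0 k.
  by rewrite /V' /D /B !mul_mx_diag [LHS]mxE; congr (_ + _); rewrite mxE.
have JV'i i k : (J *m V') i k = (J *m V) i k * da 0 k - V i k * db 0 k.
  rewrite JV' /D /B !mul_mx_diag [LHS]mxE; congr (_ + _); first by rewrite mxE.
  by rewrite [LHS]mxE; congr (- _); rewrite mxE.
have V'E (k : nat) i : (0 < k < 3)%N -> V' i (inord k) = V i (inord k).
  move=> /andP[k0 k3]; rewrite V'i [da _ _]mxE [db _ _]mxE.
  by rewrite -!val_eqE/= !inordK//= gtn_eqF// mulr1 mulr0 addr0.
have i0 : inord 0 = ord0 :> 'I_3 by apply: val_inj; rewrite /= inordK.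
have da0 : da 0 ord0 = a by rewrite mxE.
have db0 : db 0 ord0 = b by rewrite mxE.
have V'0 i : complex_frame J V' i (inord 0) =
    a * complex_frame J V i (inord 0) + b * complex_frame J V i (inord 1).
  by rewrite !(@Eent _ _ 0)// Eent1 i0 V'i da0 db0; ring.
have V'1 i : complex_frame J V' i (inord 1) =
    a * complex_frame J V i (inord 1) - b * complex_frame J V i (inord 0).
  by rewrite !(@Eent _ _ 0)// !Eent1 i0 JV'i da0 db0; ring.
have lin (x y : R) (p : 'I_6) : (forall i, complex_frame J V' i p =
      x * complex_frame J V i (inord 0) + y * complex_frame J V i (inord 1)) ->
    fcomp (complex_frame J V') (fam T) p (inord 2) (inord 4) =
    x * fcomp (complex_frame J V) (fam T) (inord 0) (inord 2) (inord 4) +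
    y * fcomp (complex_frame J V) (fam T) (inord 1) (inord 2) (inord 4).
  move=> pE; rewrite !fcompE !mulr_sumr -big_split/=; apply: eq_bigr => k _.
  rewrite !mulr_sumr -big_split/=; apply: eq_bigr => i _.
  rewrite !mulr_sumr -big_split/=; apply: eq_bigr => j _.
  rewrite pE (@Eent V' _ 1)// (@Eent V' _ 2)// !V'E//.
  by rewrite -(@Eent V _ 1)// -(@Eent V _ 2)//; ring.
(* The new coefficients are a^2 + b^2 = 1 and a b - b a = 0. *)
have a'1 : a' = 1 by rewrite a'D (lin _ _ _ V'0) -aD -bD -ab; ring.
have b'0 : b' = 0.
  rewrite b'D (lin (- b) a) -?aD -?bD; first by ring.
  by move=> i; rewrite V'1; ring.
exists (complex_frame J V'); split => // p q r.
  by rewrite TE' a'1 b'0 mul1r mul0r addr0.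
by rewrite (hodge_comp uV' TE') a'1 b'0 mul1r mul0r subr0.
Qed.

End SU3Frame.

(** * The intrinsic torsion in an adapted frame *)

Definition om6 (p q : nat) : int := if q == jdx p then jsg p else 0.
(** Components of (omega /\ omega) / 2. *)
Definition om_om (p q r s : nat) : int :=
  om6 p q * om6 r s - om6 p r * om6 q s + om6 p s * om6 q r.

(** For A = Re dz, the form (omega /\ omega) / 2 solves the differentiated slot identity. Any
    solution then differs from a particular one by a solution of the homogeneous identity, to which
    [complex4form_eq0] applies. *)
Lemma om_om_slot_check : all6 (fun p => all6 (fun q => all6 (fun r => all6 (fun s =>
  jsg s * om_om p q r (jdx s) - jsg r * om_om p q (jdx r) s ==
  sum6 (fun l => re_dz p l r * im_dz q l s - im_dz q r l * re_dz p l s))))).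
Proof. by vm_compute. Qed.

Lemma om_om_alt_check : all6 (fun p => all6 (fun q => all6 (fun r => all6 (fun s =>
  [&& om_om p q r s == - om_om q p r s, om_om p q r s == - om_om p r q s
    & om_om p q r s == - om_om p q s r])))).
Proof. by vm_compute. Qed.

Lemma im_dz_alt_check : all6 (fun p => all6 (fun q => all6 (fun r =>
  (im_dz p q r == - im_dz q p r) && (im_dz p q r == - im_dz p r q)))).
Proof. by vm_compute. Qed.

Definition del6 (p q : nat) : int := if p == q then 1 else 0.
Definition jj6 (p q : nat) : int := if p == jdx q then jsg q else 0.

(** [psx_sqr] is quadratic in x; this is its polarised form on basis vectors, with all terms
    doubled. *)
Lemma psx_sqr_check : all6 (fun q => all6 (fun q' => all6 (fun r => all6 (fun s =>
  sum6 (fun l => im_dz q r l * im_dz q' l s + im_dz q' r l * im_dz q l s) ==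
  del6 q r * del6 q' s + del6 q s * del6 q' r + jj6 r q * jj6 s q' + jj6 s q * jj6 r q'
  - 2 * del6 q q' * del6 r s)))).
Proof. by vm_compute. Qed.

Ltac dz_simpl := rewrite /re_dz /im_dz /eps3 /isgn /re_pow_i /im_pow_i /=.

Section Torsion.
Context {R : realType}.

Lemma complex3form_ord (t : 'I_6 -> 'I_6 -> 'I_6 -> R) :
  (forall i j k, t i j k = - t j i k) -> (forall i j k, t i j k = - t i k j) ->
  (forall i j k : 'I_6, (jsg j)%:~R * t i (jord j) k = (jsg k)%:~R * t i j (jord k)) ->
  forall i j k, t i j k = t (inord 0) (inord 2) (inord 4) * (re_dz i j k)%:~R
                        + t (inord 1) (inord 2) (inord 4) * (im_dz i j k)%:~R.
Proof.
move=> A B S i j k.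
pose t' (a b c : nat) := t (inord a) (inord b) (inord c).
rewrite -[LHS](_ : t' i j k = _); last by rewrite /t' !inord_val.
apply: (complex3form_std (t := t')) => // [a b c|a b c|a b c a6 b6 c6].
- exact: A.
- exact: B.
have jE m : (m < 6)%N -> inord (jdx m) = jord (inord m).
  by move=> m6; apply: val_inj; rewrite /= !inordK// jdx_lt.
by rewrite /t' !jE//; have := S (inord a) (inord b) (inord c); rewrite !inordK.
Qed.

(** There are no forms of type (4,0)+(0,4) on C^3. Fixing the first argument e_p leaves t0 Re + t1
    Im, which must still vanish on e_p; two evaluations there give t0 = t1 = 0. *)
Lemma complex4form_eq0 (t : 'I_6 -> 'I_6 -> 'I_6 -> 'I_6 -> R) :
  (forall p i j k, t p i j k = - t i p j k) -> (forall p i j k, t p i j k = - t p j i k) ->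
  (forall p i j k, t p i j k = - t p i k j) ->
  (forall p i j k : 'I_6, (jsg j)%:~R * t p i (jord j) k = (jsg k)%:~R * t p i j (jord k)) ->
  forall p i j k, t p i j k = 0.
Proof.
move=> A B C S p; have std := complex3form_ord (B p) (C p) (S p).
set t0 := t p _ _ _ in std; set t1 := t p (inord 1) _ _ in std.
have pp j k : t p p j k = 0 by have := A p p j k; lra.
have ev (a b : nat) : (a < 6)%N -> (b < 6)%N ->
    t0 * (re_dz p a b)%:~R + t1 * (im_dz p a b)%:~R = 0.
  move=> a6 b6; have := std p (inord a) (inord b).
  by rewrite pp !inordK.
have [t00 t10] : t0 = 0 /\ t1 = 0.
  have := ev; case: (p) => -[|[|[|[|[|[|//]]]]]] p6 e.
  - by have := e 2 4 isT isT; have := e 2 5 isT isT; dz_simpl => *; split; lra.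
  - by have := e 2 4 isT isT; have := e 2 5 isT isT; dz_simpl => *; split; lra.
  - by have := e 4 0 isT isT; have := e 4 1 isT isT; dz_simpl => *; split; lra.
  - by have := e 4 0 isT isT; have := e 4 1 isT isT; dz_simpl => *; split; lra.
  - by have := e 0 2 isT isT; have := e 0 3 isT isT; dz_simpl => *; split; lra.
  - by have := e 0 2 isT isT; have := e 0 3 isT isT; dz_simpl => *; split; lra.
by move=> i j k; rewrite std t00 t10 !mul0r addr0.
Qed.

Definition ps0 (q : 'I_6) : 'M[R]_6 := \matrix_(r, s) (im_dz q r s)%:~R.
(* interior product of x with Psi- *)
Definition psx (x : 'cV[R]_6) : 'M[R]_6 := \sum_q x q 0 *: ps0 q.

Lemma psx_sqr x : psx x *m psx x =
  x *m x^T + (J0 *m x) *m (J0 *m x)^T - (x^T *m x) 0 0 *: 1%:M.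
Proof.
have pr (f h : 'I_6 -> R) :
    \sum_q \sum_q' x q 0 * x q' 0 * (f q * h q') =
    (\sum_q x q 0 * f q) * (\sum_q' x q' 0 * h q').
  rewrite mulr_suml; apply: eq_bigr => q _; rewrite mulr_sumr.
  by apply: eq_bigr => q' _; ring.
have xE (r : 'I_6) : \sum_q x q 0 * (del6 q r)%:~R = x r 0.
  rewrite (bigD1 r)//= /del6 eqxx mulr1 big1 ?addr0// => q /negPf qr.
  by rewrite val_eqE qr mulr0.
have JxE (r : 'I_6) : \sum_q x q 0 * (jj6 r q)%:~R = (J0 *m x) r 0.
  rewrite mxE; apply: eq_bigr => q _; rewrite mxE mulrC; congr (_ * _).
  by rewrite /jj6 -val_eqE /=; case: eqP.
have psE (r s : 'I_6) : psx x r s = \sum_q x q 0 * (im_dz q r s)%:~R.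
  by rewrite summxE; apply: eq_bigr => q _; rewrite !mxE.
have C (q q' r s : 'I_6) : \sum_(l < 6) ((im_dz q r l)%:~R * (im_dz q' l s)%:~R
      + (im_dz q' r l)%:~R * (im_dz q l s)%:~R) =
    (del6 q r)%:~R * (del6 q' s)%:~R + (del6 q s)%:~R * (del6 q' r)%:~R
    + (jj6 r q)%:~R * (jj6 s q')%:~R + (jj6 s q)%:~R * (jj6 r q')%:~R
    - 2 * (del6 q q')%:~R * (del6 r s)%:~R :> R.
  have := psx_sqr_check => /(all6P q)/(all6P q')/(all6P r)/(all6P s)/eqP e.
  transitivity ((sum6 (fun l => im_dz q r l * im_dz q' l s + im_dz q' r l * im_dz q l s))%:~R : R).
    by rewrite -sum6E; apply: eq_bigr => l _; rewrite intrD !intrM.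
  by rewrite e rmorphB/= !rmorphD/= !rmorphM/=.
apply/matrixP => r s.
have mx3 (A B D : 'M[R]_6) : (A + B - D) r s = A r s + B r s - D r s by rewrite !mxE.
have two0 : (2 : R) != 0 by rewrite pnatr_eq0.
apply: (mulfI two0); rewrite mx3.
have -> : (x *m x^T) r s = x r 0 * x s 0 by rewrite mxE big_ord1 mxE.
have -> : (J0 *m x *m (J0 *m x)^T) r s = (J0 *m x) r 0 * (J0 *m x) s 0.
  by rewrite mxE big_ord1 [_^T _ _]mxE.
have -> : ((x^T *m x) 0 0 *: 1%:M) r s = (\sum_q x q 0 * x q 0) * (del6 r s)%:~R.
  rewrite mxE [1%:M _ _]mxE mxE; congr (_ * _).
    by apply: eq_bigr => q _; rewrite mxE.
  by rewrite /del6 -val_eqE; case: eqP.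
transitivity (\sum_q \sum_q' x q 0 * x q' 0 * \sum_(l < 6)
   ((im_dz q r l)%:~R * (im_dz q' l s)%:~R + (im_dz q' r l)%:~R * (im_dz q l s)%:~R)).
  have S1 : (psx x *m psx x) r s = \sum_q \sum_q' x q 0 * x q' 0 *
      \sum_(l < 6) (im_dz q r l)%:~R * (im_dz q' l s)%:~R.
    rewrite mxE; under eq_bigr do rewrite !psE mulr_suml.
    rewrite exchange_big; apply: eq_bigr => q _ /=.
    under eq_bigr do rewrite mulr_sumr.
    rewrite exchange_big; apply: eq_bigr => q' _ /=; rewrite mulr_sumr.
    by apply: eq_bigr => l _; ring.
  rewrite mulr_natl mulr2n {2}S1 exchange_big S1 -big_split; apply: eq_bigr => q _ /=.
  rewrite -big_split; apply: eq_bigr => q' _ /=; rewrite big_split/= mulrDr.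
  by congr (_ + _); rewrite mulrC [x q' 0 * _]mulrC mulrC.
under eq_bigr do under eq_bigr do rewrite C mulrBr !mulrDr.
under eq_bigr do rewrite sumrB !big_split/=.
rewrite sumrB !big_split/= !pr !xE !JxE.
have -> : \sum_(q < 6) \sum_(q' < 6) x q 0 * x q' 0 * (2 * (del6 q q')%:~R * (del6 r s)%:~R) =
    2 * ((\sum_q x q 0 * x q 0) * (del6 r s)%:~R).
  rewrite mulr_suml mulr_sumr; apply: eq_bigr => q _.
  rewrite (bigD1 q)//= /del6 eqxx big1 ?addr0; first by ring.
  by move=> q' /negPf q'q; rewrite eq_sym val_eqE q'q; ring.
ring.
Qed.

End Torsion.

Section TorsionTheorem.
Context {R : realType}.
Variables (At : 'I_6 -> 'M[R]_6) (Qt : 'I_6 -> 'I_6 -> 'M[R]_6).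
Hypothesis AJ : forall p, At p *m J0 + J0 *m At p = 0.
Hypothesis Askew : forall p, (At p)^T = - At p.
Hypothesis Q12 : forall p q r s, Qt p q r s = - Qt q p r s.
Hypothesis Q23 : forall p q r s, Qt p q r s = - Qt p r q s.
Hypothesis Q34 : forall p q r s, Qt p q r s = - Qt p q s r.
Hypothesis QA : forall p q,
  Qt p q *m J0 + ps0 q *m At p = (At p)^T *m ps0 q + J0^T *m Qt p q.

Let ps0_skew (q r s : 'I_6) : ps0 q r s = - ps0 r q s :> R.
Proof.
rewrite !mxE -rmorphN; congr (_%:~R).
by have /(all6P q)/(all6P r)/(all6P s)/andP[/eqP-> _] := im_dz_alt_check.
Qed.

Let ps0_skew' (q r s : 'I_6) : ps0 q r s = - ps0 q s r :> R.
Proof.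
rewrite !mxE -rmorphN; congr (_%:~R).
by have /(all6P q)/(all6P r)/(all6P s)/andP[_ /eqP->] := im_dz_alt_check.
Qed.

Lemma torsion_nearly_kaehler (x : 'cV[R]_6) : (\sum_p x p 0 *: At p) *m x = 0.
Proof.
set A := \sum_p _; pose u := A *m x.
have ATE : A^T = \sum_p x p 0 *: (At p)^T.
  by rewrite /A linear_sum/=; apply: eq_bigr => p _; rewrite linearZ.
have AT : A^T = - A.
  by rewrite ATE /A -sumrN; apply: eq_bigr => p _; rewrite Askew scalerN.
have AJx : A *m J0 = - (J0 *m A).
  apply/eqP; rewrite -addr_eq0 /A mulmx_suml mulmx_sumr -big_split/=; apply/eqP.
  by apply: big1 => p _; rewrite -scalemxAl -scalemxAr -scalerDr AJ scaler0.
(* Equal first two arguments kill the alternating derivative of Psi-. *)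
have Qx : \sum_p \sum_q (x p 0 * x q 0) *: Qt p q = 0.
  apply/matrixP => r s.
  have e : \sum_p \sum_q x p 0 * x q 0 * Qt p q r s =
      - \sum_p \sum_q x p 0 * x q 0 * Qt p q r s.
    rewrite {1}exchange_big -sumrN; apply: eq_bigr => p _ /=.
    by rewrite -sumrN; apply: eq_bigr => q _; rewrite Q12; ring.
  rewrite !summxE mxE; transitivity (\sum_p \sum_q x p 0 * x q 0 * Qt p q r s); last by lra.
  by apply: eq_bigr => p _; rewrite summxE; apply: eq_bigr => q _; rewrite mxE.
have psA : psx x *m A = A^T *m psx x.
  have E : \sum_p \sum_q (x p 0 * x q 0) *: (Qt p q *m J0 + ps0 q *m At p) =
      \sum_p \sum_q (x p 0 * x q 0) *: ((At p)^T *m ps0 q + J0^T *m Qt p q).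
    by apply: eq_bigr => p _; apply: eq_bigr => q _; rewrite QA.
  have L : \sum_p \sum_q (x p 0 * x q 0) *: (Qt p q *m J0 + ps0 q *m At p) = psx x *m A.
    under eq_bigr do under eq_bigr do rewrite scalerDr scalemxAl.
    under eq_bigr do rewrite big_split/= -mulmx_suml.
    rewrite big_split/= -mulmx_suml Qx mul0mx add0r /psx /A mulmx_suml exchange_big/=.
    apply: eq_bigr => q _; rewrite mulmx_sumr; apply: eq_bigr => p _.
    by rewrite -scalemxAl -scalemxAr scalerA mulrC.
  have L' : \sum_p \sum_q (x p 0 * x q 0) *: ((At p)^T *m ps0 q + J0^T *m Qt p q) =
      A^T *m psx x.
    under eq_bigr do under eq_bigr do rewrite scalerDr [X in _ + X]scalemxAr.
    under eq_bigr do rewrite big_split/= -mulmx_sumr.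
    rewrite big_split/= -mulmx_sumr Qx mulmx0 addr0 /psx ATE mulmx_suml.
    apply: eq_bigr => p _; rewrite mulmx_sumr; apply: eq_bigr => q _.
    by rewrite -scalemxAl -scalemxAr scalerA.
  by rewrite -L E L'.
have psx0 : psx x *m x = 0.
  apply/matrixP => r i; rewrite ord1 !mxE.
  have e : \sum_s \sum_q x s 0 * x q 0 * ps0 q r s =
      - \sum_s \sum_q x s 0 * x q 0 * ps0 q r s :> R.
    rewrite {1}exchange_big -sumrN; apply: eq_bigr => s _ /=.
    rewrite -sumrN; apply: eq_bigr => q _.
    have -> : ps0 q r s = - ps0 s r q :> R.
      by rewrite ps0_skew ps0_skew' ps0_skew opprK.
    ring.
  transitivity (\sum_s \sum_q x s 0 * x q 0 * ps0 q r s); last by lra.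
  apply: eq_bigr => s _; rewrite /psx summxE mulr_suml; apply: eq_bigr => q _.
  by rewrite mxE; ring.
have psu : psx x *m u = 0 by rewrite /u mulmxA psA -mulmxA psx0 mulmx0.
have sc (z : 'M[R]_1) : z^T = - z -> z = 0.
  move=> zT; apply/matrixP => i j; rewrite !ord1 mxE.
  by have := congr1 (fun m : 'M_1 => m 0 0) zT; rewrite !mxE => e; lra.
(* u is orthogonal to x and J x because A and J A are skew. *)
have xu : x^T *m u = 0.
  by apply: sc; rewrite /u !trmx_mul trmxK AT mulmxN mulNmx mulmxA.
have Jxu : (J0 *m x)^T *m u = 0.
  apply: sc; rewrite /u trmx_mul trmxK !trmx_mul AT J0_tr.
  rewrite !mulmxN !mulNmx opprK !mulmxA -(mulmxA x^T A J0) AJx.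
  by rewrite mulmxN mulNmx opprK mulmxA.
have := congr1 (fun z => psx x *m z) psu.
rewrite mulmx0 mulmxA psx_sqr mulmxBl mulmxDl -!(mulmxA _ _^T u) xu Jxu !mulmx0 addr0 sub0r.
rewrite -scalemxAl mul1mx -scaleNr => /eqP; rewrite scaler_eq0 oppr_eq0 => /orP[|/eqP//].
have [x0 _|x0] := eqVneq x 0; first by rewrite -/u /u x0 mulmx0.
move/eqP => xx; case/eqP: x0; apply/matrixP => i j; rewrite ord1 [RHS]mxE.
have : \sum_q x q 0 ^+ 2 = 0.
  by rewrite -[RHS]xx mxE; apply: eq_bigr => q _; rewrite mxE expr2.
move/eqP; rewrite psumr_eq0 => [/allP/(_ i)|q _]; last exact: sqr_ge0.
by rewrite mem_index_enum => /(_ isT); rewrite /= sqrf_eq0 => /eqP.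
Qed.

Theorem torsion_form : exists lambda : R,
  (forall p r s, At p r s = - lambda * (re_dz p r s)%:~R) /\
  (forall p q r s, Qt p q r s = - lambda * (om_om p q r s)%:~R).
Proof.
(* A_x x = 0 polarises to antisymmetry of A in its first and last indices. *)
have A12 p l s : At p l s = - At s l p.
  have E (x : 'cV[R]_6) r : \sum_k \sum_t x k 0 * x t 0 * At k r t = 0.
    transitivity (((\sum_p x p 0 *: At p) *m x) r 0); last first.
      by rewrite torsion_nearly_kaehler mxE.
    rewrite exchange_big [RHS]mxE; apply: eq_bigr => t _ /=; rewrite summxE mulr_suml.
    by apply: eq_bigr => k _; rewrite mxE; ring.
  have D (a : 'I_6) (f : 'I_6 -> R) :
      \sum_k (delta_mx a 0 : 'cV[R]_6) k 0 * f k = f a.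
    rewrite (bigD1 a)//= mxE !eqxx mul1r big1 ?addr0// => k /negPf ka.
    by rewrite mxE ka mul0r.
  have B2 (x y : 'cV[R]_6) r : \sum_k \sum_t (x k 0 * y t 0 * At k r t + y k 0 * x t 0 * At k r t) = 0.
    transitivity (\sum_k \sum_t (x + y) k 0 * (x + y) t 0 * At k r t
        - \sum_k \sum_t x k 0 * x t 0 * At k r t - \sum_k \sum_t y k 0 * y t 0 * At k r t).
      rewrite -!sumrB; apply: eq_bigr => k _; rewrite -!sumrB; apply: eq_bigr => t _.
      by rewrite ![(x + y) _ _]mxE; ring.
    by rewrite !E !subr0.
  have := B2 (delta_mx p 0) (delta_mx s 0) l.
  under eq_bigr do rewrite big_split/=.
  under eq_bigr do under eq_bigr do rewrite -mulrA.
  under eq_bigr do rewrite -mulr_sumr D.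
  under eq_bigr do under [X in _ + X]eq_bigr do rewrite -mulrA.
  under eq_bigr do rewrite -[X in _ + X]mulr_sumr D.
  by rewrite big_split/= !D => e; lra.
have A23 p l s : At p l s = - At p s l.
  by have := Askew p => /matrixP/(_ s l); rewrite !mxE.
have Aslot (p r s : 'I_6) : (jsg r)%:~R * At p (jord r) s = (jsg s)%:~R * At p r (jord s).
  have e : At p *m J0 = J0^T *m At p.
    by apply/eqP; rewrite -subr_eq0 -mulNmx J0_tr opprK AJ.
  by have := congr1 (fun m : 'M_6 => m r s) e; rewrite /= mulmxJ0 mulJ0Tmx.
have A12' p l s : At p l s = - At l p s.
  by rewrite A23 A12 A23 opprK A23.
have std := complex3form_ord A12' A23 Aslot.
set a := At _ _ _ in std; set b := At (inord 1) _ _ in std.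
(* At p = q = 0 the derivative of Psi- drops out, and the entry (2, 2) of what remains forces b to
   vanish. *)
have b0 : b = 0.
  have := QA ord0 ord0 => /matrixP/(_ (inord 2) (inord 2)).
  rewrite [LHS]mxE [RHS]mxE mulmxJ0 mulJ0Tmx.
  have -> : Qt ord0 ord0 = 0.
    by apply/matrixP => r s; rewrite mxE; have := Q12 ord0 ord0 r s => e; lra.
  rewrite !(mxE, mulr0, add0r, addr0).
  under [LHS]eq_bigr do rewrite mxE std.
  under [RHS]eq_bigr do rewrite 2!mxE std.
  rewrite !big_ord_recl !big_ord0 !inordK//; dz_simpl => e; lra.
exists (- a); rewrite opprK; split => [p r s|p q r s].
  by rewrite std b0 mul0r addr0.
(* Subtracting the particular solution leaves an alternating t for which J moves between the last
   two slots. *)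
pose t p q r s := Qt p q r s - a * (om_om p q r s)%:~R.
suff : t p q r s = 0 by move=> /eqP; rewrite subr_eq0 => /eqP.
have oo (x y z w : 'I_6) : [/\ om_om x y z w = - om_om y x z w,
    om_om x y z w = - om_om x z y w & om_om x y z w = - om_om x y w z].
  have /(all6P x)/(all6P y)/(all6P z)/(all6P w)/and3P[/eqP e1 /eqP e2 /eqP e3] := om_om_alt_check.
  by split.
apply: complex4form_eq0 => x y z w; rewrite /t.
- by have [e1 _ _] := oo x y z w; rewrite e1 Q12 rmorphN; ring.
- by have [_ e1 _] := oo x y z w; rewrite e1 Q23 rmorphN; ring.
- by have [_ _ e1] := oo x y z w; rewrite e1 Q34 rmorphN; ring.
have := QA x y => /matrixP/(_ z w).
rewrite [LHS]mxE [RHS]mxE mulmxJ0 mulJ0Tmx.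
have /(all6P x)/(all6P y)/(all6P z)/(all6P w)/eqP e := om_om_slot_check.
have sE : (ps0 y *m At x) z w - ((At x)^T *m ps0 y) z w =
    - (a * ((jsg w)%:~R * (om_om x y z (jdx w))%:~R - (jsg z)%:~R * (om_om x y (jdx z) w)%:~R)).
  rewrite -!intrM -intrB e -sum6E [X in X - _]mxE [X in _ - X]mxE -sumrB mulr_sumr -sumrN; apply: eq_bigr => l _.
  by rewrite [ps0 _ _ _]mxE [ps0 _ _ _]mxE [_^T _ _]mxE !std b0 intrB !intrM; ring.
move: sE; move: ((ps0 y *m At x) z w) (((At x)^T *m ps0 y) z w) => m1 m2 sE e1.
have -> : nat_of_ord (jord z) = jdx z by []. have -> : nat_of_ord (jord w) = jdx w by [].
move: e1 sE; lra.
Qed.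

End TorsionTheorem.

(** * Curvature in an adapted frame *)

(* component (q, r, s) of nabla_p Psi+, divided by - lam *)
Definition dre (p q r s : nat) : int :=
  jsg s * om_om p q r (jdx s) + sum6 (fun l => im_dz q r l * re_dz p l s).
(** Coefficient of lam^2 in the Ricci identity for omega. *)
Definition ricci_om (p q r s : nat) : int := dre p q r s - dre q p r s.

(** Component (q, k, l, m) of nabla_p of (omega /\ omega) / 2, divided by lam: the Leibniz rule with
    nabla omega = lam Psi+. *)
Definition dom_om (p q k l m : nat) : int :=
  re_dz p q k * om6 l m + om6 q k * re_dz p l m
  - re_dz p q l * om6 k m - om6 q l * re_dz p k m
  + re_dz p q m * om6 k l + om6 q m * re_dz p k l.
Definition ricci_im (p q k l m : nat) : int := dom_om p q k l m - dom_om q p k l m.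

Lemma re_dz_alt_check : all6 (fun p => all6 (fun q => all6 (fun r =>
  (re_dz p q r == - re_dz q p r) && (re_dz p q r == - re_dz p r q)))).
Proof. by vm_compute. Qed.

(** The lam^2 term has zero total alternation, so only d lam /\ Psi+ survives when the Ricci
    identity for omega is alternated. *)
Lemma ricci_om_alt_check : all6 (fun p => all6 (fun q => all6 (fun r => all6 (fun s =>
  ricci_om p q r s - ricci_om p r q s + ricci_om p s q r + ricci_om q r p s
  - ricci_om q s p r + ricci_om r s p q == 0)))).
Proof. by vm_compute. Qed.

Section CurvatureAlgebra.
Context {R : realType}.
Variables (Rm : 'I_6 -> 'I_6 -> 'M[R]_6) (lam : R) (dl : 'I_6 -> R).
Hypothesis R12 : forall p q l s, Rm q p l s = - Rm p q l s.
Hypothesis R34 : forall p q l s, Rm p q s l = - Rm p q l s.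
Hypothesis bianchi : forall p q s l, Rm p q l s + Rm q s l p + Rm s p l q = 0.
Hypothesis RW : forall p q r s : 'I_6,
  (jsg s)%:~R * Rm p q r (jord s) + (jsg r)%:~R * Rm p q (jord r) s =
  - (dl p * (re_dz q r s)%:~R - dl q * (re_dz p r s)%:~R)
  + lam ^+ 2 * (ricci_om p q r s)%:~R.

Let re12 (x y z : 'I_6) : (re_dz x y z)%:~R = - (re_dz y x z)%:~R :> R.
Proof.
have /(all6P x)/(all6P y)/(all6P z)/andP[/eqP e1 _] := re_dz_alt_check.
by rewrite -rmorphN; congr (_%:~R).
Qed.

Let re23 (x y z : 'I_6) : (re_dz x y z)%:~R = - (re_dz x z y)%:~R :> R.
Proof.
have /(all6P x)/(all6P y)/(all6P z)/andP[_ /eqP e1] := re_dz_alt_check.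
by rewrite -rmorphN; congr (_%:~R).
Qed.

(** S, T, U, V collect the curvature components in which s, r, q, p is replaced by its partner; each
    triple is a Bianchi sum. The letters a, b, c, d are components of Re dz, and 3^-1 appears since
    each term of d lam /\ Psi+ occurs three times. *)
Let alternation_algebra (js jr jq jp S1 S2 S3 T1 T2 T3 U1 U2 U3 V1 V2 V3
    dp dq dr ds a b c d l c1 c2 c3 c4 c5 c6 : R) :
  js * S1 + jr * T1 = - (dp * a - dq * b) + l * c1 ->
  js * S3 + jq * U1 = - (dp * - a - dr * c) + l * c2 ->
  jr * T3 + jq * U3 = - (dp * a - ds * d) + l * c3 ->
  js * S2 + jp * V1 = - (dq * - b - dr * - c) + l * c4 ->
  jr * T2 + jp * V2 = - (dq * b - ds * - d) + l * c5 ->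
  jq * U2 + jp * V3 = - (dr * c - ds * d) + l * c6 ->
  - S1 - S2 + S3 = 0 -> T1 - T2 + T3 = 0 -> U1 - U2 - U3 = 0 -> V1 + V3 - V2 = 0 ->
  c1 - c2 + c3 + c4 - c5 + c6 = 0 ->
  dp * a - dq * b + dr * c - ds * d = 0.
Proof.
move=> e1 e2 e3 e4 e5 e6 b1 b2 b3 b4 ce.
have -> : dp * a - dq * b + dr * c - ds * d = 3^-1 * (- (js * S1 + jr * T1)
  + (js * S3 + jq * U1) - (jr * T3 + jq * U3) - (js * S2 + jp * V1) + (jr * T2 + jp * V2)
  - (jq * U2 + jp * V3) + l * (c1 - c2 + c3 + c4 - c5 + c6)).
  by rewrite e1 e2 e3 e4 e5 e6; field.
have -> : S1 = S3 - S2 by lra. have -> : T1 = T2 - T3 by lra.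
have -> : U1 = U2 + U3 by lra. have -> : V1 = V2 - V3 by lra.
by rewrite ce; ring.
Qed.

(* By the Bianchi identity the total alternation of [RW] has left-hand side 0. *)
Let torsion_constant_key (p q r s : 'I_6) :
  dl p * (re_dz q r s)%:~R - dl q * (re_dz p r s)%:~R
    + dl r * (re_dz p q s)%:~R - dl s * (re_dz p q r)%:~R = 0.
Proof.
have /(all6P p)/(all6P q)/(all6P r)/(all6P s)/eqP c0 := ricci_om_alt_check.
have e1 := RW p q r s; have e2 := RW p r q s; have e3 := RW p s q r.
have e4 := RW q r p s; have e5 := RW q s p r; have e6 := RW r s p q.
rewrite (re12 r q s) in e2.
rewrite (re12 s q r) (re23 q s r) opprK in e3.
rewrite (re12 r p s) (re12 q p s) in e4.
rewrite (re12 s p r) (re23 p s r) opprK (re12 q p r) in e5.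
rewrite (re12 s p q) (re23 p s q) opprK (re12 r p q) (re23 p r q) opprK in e6.
apply: alternation_algebra e1 e2 e3 e4 e5 e6 _ _ _ _ _.
- have := bianchi p q r (jord s).
  by rewrite (R34 p q r) (R34 q r p) (R12 p r) (R34 p r q) opprK.
- have := bianchi p q s (jord r).
  by rewrite (R34 q s p) (R12 p s) (R34 p s q) opprK.
- have := bianchi p r s (jord q).
  by rewrite (R34 r s p) (R12 p s).
- have := bianchi q r s (jord p).
  by rewrite (R12 q s).
have /= := congr1 (fun z : int => z%:~R : R) c0.
by rewrite intrD intrB intrD intrD intrB.
Qed.

(** From d lam /\ Psi+ = 0: for each p the three other indices are such that Re dz vanishes on every
    triple except the one without p. *)
Lemma torsion_constant p : dl p = 0.
Proof.
have key := torsion_constant_key.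
case: p => -[|[|[|[|[|[|//]]]]]] p6.
- by have := key (Ordinal p6) (inord 1) (inord 2) (inord 5); rewrite !inordK//; dz_simpl; lra.
- by have := key (Ordinal p6) (inord 0) (inord 2) (inord 4); rewrite !inordK//; dz_simpl; lra.
- by have := key (Ordinal p6) (inord 0) (inord 3) (inord 5); rewrite !inordK//; dz_simpl; lra.
- by have := key (Ordinal p6) (inord 0) (inord 2) (inord 4); rewrite !inordK//; dz_simpl; lra.
- by have := key (Ordinal p6) (inord 0) (inord 3) (inord 5); rewrite !inordK//; dz_simpl; lra.
- by have := key (Ordinal p6) (inord 0) (inord 2) (inord 4); rewrite !inordK//; dz_simpl; lra.
Qed.

Hypothesis RP : forall p q k l m : 'I_6,
  \sum_s (Rm p q s k * (im_dz s l m)%:~R + Rm p q s l * (im_dz k s m)%:~R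
           + Rm p q s m * (im_dz k l s)%:~R) = lam ^+ 2 * (ricci_im p q k l m)%:~R.

Let r (p q l s : nat) : R := Rm (inord p) (inord q) (inord l) (inord s).

Let RWn p q i s : (p < 6)%N -> (q < 6)%N -> (i < 6)%N -> (s < 6)%N ->
  (jsg s)%:~R * r p q i (jdx s) + (jsg i)%:~R * r p q (jdx i) s =
  lam ^+ 2 * (ricci_om p q i s)%:~R.
Proof.
move=> p6 q6 i6 s6.
have jE m : (m < 6)%N -> inord (jdx m) = jord (inord m).
  by move=> m6; apply: val_inj; rewrite /= !inordK// jdx_lt.
have := RW (inord p) (inord q) (inord i) (inord s).
by rewrite /r !jE// !torsion_constant !mul0r subrr oppr0 add0r !inordK.
Qed.

Let RWn' p q i s (c : int) : (p < 6)%N -> (q < 6)%N -> (i < 6)%N -> (s < 6)%N ->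
  ricci_om p q i s = c ->
  (jsg s)%:~R * r p q i (jdx s) + (jsg i)%:~R * r p q (jdx i) s = lam ^+ 2 * c%:~R.
Proof. by move=> ? ? ? ? <-; exact: RWn. Qed.

Let sum_inord (F : 'I_6 -> R) : \sum_i F i = F (inord 0) + F (inord 1) + F (inord 2)
  + F (inord 3) + F (inord 4) + F (inord 5).
Proof.
rewrite (eq_bigr (fun i : 'I_6 => F (inord i))) => [|i _]; last by rewrite inord_val.
by rewrite -(big_mkord xpredT (fun i => F (inord i))) !big_nat_recr ?big_nil//= add0r.
Qed.

Let r21 p q l s : r q p l s = - r p q l s. Proof. exact: R12. Qed.
Let r43 p q l s : r p q s l = - r p q l s. Proof. exact: R34. Qed.
Let rpp p l s : r p p l s = 0. Proof. by have := r21 p p l s; lra. Qed.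
Let rll p q l : r p q l l = 0. Proof. by have := r43 p q l l; lra. Qed.

(** The Ricci identity for Psi- on e_0, e_2, e_4: only the part of the curvature that turns a vector
    into its partner reaches a nonzero component of Im dz, so the left-hand side is a complex
    trace. *)
Let RPn p q : (p < 6)%N -> (q < 6)%N ->
  r p q 0 1 + r p q 2 3 + r p q 4 5 = - lam ^+ 2 * (ricci_im p q 0 2 4)%:~R.
Proof.
move=> p6 q6; have := RP (inord p) (inord q) (inord 0) (inord 2) (inord 4).
rewrite sum_inord !inordK// -/(r p q _ _).
have := r43 p q 0 1; have := r43 p q 2 3; have := r43 p q 4 5.
have := rll p q 0; have := rll p q 2; have := rll p q 4; rewrite /r.
dz_simpl; lra.
Qed.

(** The sum is twice that of 15 sectional curvatures, 3 of complex lines and 12 mixed. [RPn] for the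
    three complex lines adds up to 3 lam^2; [mixed_std] trades its off-diagonal terms for the mixed
    curvatures, at the cost of 4 lam^2 for each of the three pairs of lines. Hence 30 = 2 (3 +
    12). *)
Lemma scalar_curvature_frame : \sum_p \sum_q Rm p q p q = 30 * lam ^+ 2.
Proof.
have -> : \sum_p \sum_q Rm p q p q = 2 * (
    (r 0 1 0 1 + r 2 3 2 3 + r 4 5 4 5)
    + (r 0 2 0 2 + r 0 3 0 3 + r 1 2 1 2 + r 1 3 1 3)
    + (r 0 4 0 4 + r 0 5 0 5 + r 1 4 1 4 + r 1 5 1 5)
    + (r 2 4 2 4 + r 2 5 2 5 + r 3 4 3 4 + r 3 5 3 5)).
  rewrite sum_inord !sum_inord -!/(r _ _ _ _) !rpp.
  rewrite (r21 0 1 1 0) (r21 2 3 3 2) (r21 4 5 5 4) (r21 0 2 2 0) (r21 0 3 3 0).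
  rewrite (r21 1 2 2 1) (r21 1 3 3 1) (r21 0 4 4 0) (r21 0 5 5 0) (r21 1 4 4 1).
  rewrite (r21 1 5 5 1) (r21 2 4 4 2) (r21 2 5 5 2) (r21 3 4 4 3) (r21 3 5 5 3).
  rewrite (r43 0 1 0 1) (r43 2 3 2 3) (r43 4 5 4 5) (r43 0 2 0 2) (r43 0 3 0 3).
  rewrite (r43 1 2 1 2) (r43 1 3 1 3) (r43 0 4 0 4) (r43 0 5 0 5) (r43 1 4 1 4).
  rewrite (r43 1 5 1 5) (r43 2 4 2 4) (r43 2 5 2 5) (r43 3 4 3 4) (r43 3 5 3 5).
  ring.
have bn p q s l : r p q l s + r q s l p + r s p l q = 0 by exact: bianchi.
(* Four Bianchi identities; c1, ..., c4 measure how far the curvature endomorphisms are from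
   commuting with J. *)
have mixed p p' q q' c1 c2 c3 c4 :
    - r p q p q + r p q p' q' = c1 -> r p q' p q' + r p q' p' q = c2 ->
    - r p' q p' q - r p' q p q' = c3 -> r p' q' p' q' - r p' q' p q = c4 ->
    r p p' q q' + r q q' p p' =
    r p q p q + r p q' p q' + r p' q p' q + r p' q' p' q' + (c1 - c2 + c3 - c4).
  have := bn p p' q' q; rewrite (r43 p' q' p q) (r21 p q' q p') (r43 p q' p' q).
  have := bn p p' q q'; rewrite (r43 p p' q q') (r43 p' q p q') (r21 p q q' p') (r43 p q p' q').
  have := bn q q' p' p; rewrite (r21 p' q' p q).
  have := bn q q' p p'; rewrite (r43 q q' p p') (r21 p q' p' q).
  move: (r p p' q q') (r q q' p p') (r p q p q) (r p q p' q') (r p q' p q') (r p q' p' q)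
    (r p' q p' q) (r p' q p q') (r p' q' p' q') (r p' q' p q).
  by move=> *; lra.
have mixed_std p q : ~~ odd p -> ~~ odd q -> (p.+1 < 6)%N -> (q.+1 < 6)%N ->
    ricci_om p q p q.+1 = -1 -> ricci_om p q.+1 p q = 1 ->
    ricci_om p.+1 q p.+1 q.+1 = -1 -> ricci_om p.+1 q.+1 p.+1 q = 1 ->
    r p p.+1 q q.+1 + r q q.+1 p p.+1 =
    r p q p q + r p q.+1 p q.+1 + r p.+1 q p.+1 q + r p.+1 q.+1 p.+1 q.+1 - 4 * lam ^+ 2.
  move=> /negPf op /negPf oq p6 q6 c1 c2 c3 c4.
  have [p5 q5] := (ltnW p6, ltnW q6).
  have := RWn' p5 q5 p5 q6 c1; have := RWn' p5 q6 p5 q5 c2.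
  have := RWn' p6 q5 p6 q6 c3; have := RWn' p6 q6 p6 q5 c4.
  rewrite /jsg /jdx /= op oq /= => e4 e3 e2 e1.
  rewrite (mixed p p.+1 q q.+1 (- lam ^+ 2) (lam ^+ 2) (- lam ^+ 2) (lam ^+ 2)); first by ring.
  - by move: e1; move: (r _ _ _ _) (r _ _ _ _) => *; lra.
  - by move: e2; move: (r _ _ _ _) (r _ _ _ _) => *; lra.
  - by move: e3; move: (r _ _ _ _) (r _ _ _ _) => *; lra.
  - by move: e4; move: (r _ _ _ _) (r _ _ _ _) => *; lra.
have m02 := @mixed_std 0 2 isT isT isT isT erefl erefl erefl erefl.
have m04 := @mixed_std 0 4 isT isT isT isT erefl erefl erefl erefl.
have m24 := @mixed_std 2 4 isT isT isT isT erefl erefl erefl erefl.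
have k0 := @RPn 0 1 isT isT; have k2 := @RPn 2 3 isT isT; have k4 := @RPn 4 5 isT isT.
have i0 : ricci_im 0 1 0 2 4 = -1 by []. have i2 : ricci_im 2 3 0 2 4 = -1 by [].
have i4 : ricci_im 4 5 0 2 4 = -1 by [].
rewrite i0 in k0; rewrite i2 in k2; rewrite i4 in k4.
move: (lam ^+ 2) m02 m04 m24 k0 k2 k4 => l m02 m04 m24 k0 k2 k4; lra.
Qed.

End CurvatureAlgebra.

(** * From adapted frames to coordinates *)

Section ChangeOfFrame.
Context {R : realType} {n : nat}.
Implicit Types (E X Y : 'M[R]_n).

(* [omx W W] is the 4-form (W /\ W) / 2 with its first two arguments m, k fixed *)
Definition omx X Y (m k : 'I_n) : 'M[R]_n :=
  X m k *: Y - (row m X)^T *m row k Y + (row k Y)^T *m row m X.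

Lemma omxE X Y m k i j : omx X Y m k i j = X m k * Y i j - X m i * Y k j + X m j * Y k i.
Proof.
have mx3 (A B C : 'M[R]_n) : (A - B + C) i j = A i j - B i j + C i j by rewrite !mxE.
rewrite mx3; congr (_ - _ + _); first by rewrite mxE.
  by rewrite mxE big_ord1 !mxE.
by rewrite mxE big_ord1 !mxE mulrC.
Qed.

Lemma trmx_lincomb (a : 'I_n -> R) p q (F : 'I_n -> 'M[R]_(p, q)) :
  (\sum_m a m *: F m)^T = \sum_m a m *: (F m)^T.
Proof.
apply/matrixP => i j; rewrite mxE !summxE; apply: eq_bigr => m _; by rewrite !mxE.
Qed.

Lemma trmx_lincomb2 (a : 'I_n -> 'I_n -> R) p q (F : 'I_n -> 'I_n -> 'M[R]_(p, q)) :
  (\sum_i \sum_j a i j *: F i j)^T = \sum_i \sum_j a i j *: (F i j)^T.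
Proof.
apply/matrixP => x y; rewrite mxE !summxE; apply: eq_bigr => i _.
by rewrite !summxE; apply: eq_bigr => j _; rewrite [LHS]mxE [RHS]mxE [_^T _ _]mxE.
Qed.

Lemma sum_row E X p : \sum_m E m p *: row m X = row p (E^T *m X).
Proof.
apply/rowP => j; rewrite summxE !mxE; apply: eq_bigr => m _.
by rewrite !mxE.
Qed.

Lemma sum2_entry E X p q : \sum_m \sum_k (E m p * E k q) * X m k = (E^T *m X *m E) p q.
Proof.
rewrite mxE exchange_big; apply: eq_bigr => k _ /=; rewrite mxE mulr_suml.
by apply: eq_bigr => m _; rewrite mxE; ring.
Qed.

Lemma omx_frame E X Y p q :
  \sum_m \sum_k (E m p * E k q) *: (E^T *m omx X Y m k *m E) =
  omx (E^T *m X *m E) (E^T *m Y *m E) p q.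
Proof.
have rowE (Z : 'M[R]_n) m : row m Z *m E = row m (Z *m E) by rewrite row_mul.
have e m k : E^T *m omx X Y m k *m E = X m k *: (E^T *m Y *m E)
    - (row m (X *m E))^T *m row k (Y *m E) + (row k (Y *m E))^T *m row m (X *m E).
  rewrite /omx mulmxDr mulmxDl mulmxBr mulmxBl -scalemxAr -scalemxAl -!rowE !trmx_mul.
  by rewrite !mulmxA.
under eq_bigr do under eq_bigr do rewrite e scalerDr scalerBr scalerA.
under eq_bigr do rewrite big_split/= sumrB -scaler_suml.
rewrite big_split/= sumrB -scaler_suml sum2_entry /omx; congr (_ - _ + _).
  rewrite -!mulmxA -!sum_row trmx_lincomb mulmx_suml; apply: eq_bigr => m _.
  rewrite mulmx_sumr; apply: eq_bigr => k _.
  by rewrite -scalemxAl -scalemxAr scalerA.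
rewrite -!mulmxA -!sum_row trmx_lincomb mulmx_suml exchange_big; apply: eq_bigr => k _ /=.
rewrite mulmx_sumr; apply: eq_bigr => m _.
by rewrite -scalemxAl -scalemxAr scalerA mulrC.
Qed.

Lemma lincomb_inj E (V : lmodType R) (X Y : 'I_n -> V) : E \in unitmx ->
  (forall p, \sum_k E k p *: X k = \sum_k E k p *: Y k) -> forall k, X k = Y k.
Proof.
move=> uE XY k.
have inv (Z : 'I_n -> V) : \sum_p invmx E p k *: \sum_j E j p *: Z j = Z k.
  under eq_bigr do rewrite scaler_sumr; rewrite exchange_big/=.
  transitivity (\sum_j (E *m invmx E) j k *: Z j).
    apply: eq_bigr => j _; rewrite mxE scaler_suml; apply: eq_bigr => p _.
    by rewrite scalerA mulrC.
  rewrite mulmxV// (bigD1 k)//= mxE eqxx scale1r big1 ?addr0// => j /negPf jk.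
  by rewrite mxE jk scale0r.
by rewrite -[LHS]inv -[RHS]inv; apply: eq_bigr => p _; rewrite XY.
Qed.

End ChangeOfFrame.

Section Pointwise.
Context {R : realType}.
Variables (G J E : 'M[R]_6) (P N : 'I_6 -> 'M[R]_6).
Hypothesis pG : positive_definite G.
Hypothesis aE : adapted G J E.
Hypothesis PE : forall p q r, fcomp E P p q r = (re_dz p q r)%:~R.
Hypothesis NE : forall p q r, fcomp E N p q r = (im_dz p q r)%:~R.

Let uE : E \in unitmx. Proof. exact: adapted_unitmx aE. Qed.
Let EGE : E^T *m G *m E = 1%:M. Proof. by have [] := aE. Qed.
Let JE : J *m E = E *m J0. Proof. by have [] := aE. Qed.
Let W := J^T *m G.

Let invE : invmx E = E^T *m G.
Proof. by rewrite -[LHS]mul1mx -EGE mulmxK. Qed.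

Let N0 p : fcomp E N p = ps0 p.
Proof. by apply/matrixP => q r; rewrite NE mxE. Qed.

Let WE : E^T *m W *m E = J0^T.
Proof. by rewrite /W mulmxA -trmx_mul JE trmx_mul -!mulmxA (mulmxA E^T) EGE mulmx1. Qed.

Let J0T_om p q : (J0^T : 'M[R]_6) p q = (om6 p q)%:~R.
Proof. by rewrite mxE mxE /om6 -val_eqE /=; case: eqP. Qed.

Let om_omE (p q r s : 'I_6) : omx (J0^T) (J0^T) p q r s = (om_om p q r s)%:~R :> R.
Proof. by rewrite omxE !J0T_om /om_om intrD intrB !intrM. Qed.

Definition conj_frame (A : 'M[R]_6) := invmx E *m A *m E.

Lemma conj_frameM A B : conj_frame (A *m B) = conj_frame A *m conj_frame B.
Proof. by rewrite /conj_frame !mulmxA (mulmxK uE). Qed.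

Lemma conj_frameJ : conj_frame J = J0.
Proof. by rewrite /conj_frame -mulmxA JE mulKmx. Qed.

Let trE (B : 'M[R]_6) A : E^T *m (B *m A) *m E = E^T *m B *m E *m conj_frame A.
Proof. by rewrite /conj_frame !mulmxA (mulmxK uE). Qed.

Let trE' (B : 'M[R]_6) A : E^T *m (A^T *m B) *m E = (conj_frame A)^T *m (E^T *m B *m E).
Proof.
have e : (invmx E)^T *m E^T = 1%:M by rewrite -trmx_mul mulmxV// trmx1.
by rewrite /conj_frame !trmx_mul !mulmxA -[_ *m (invmx E)^T *m E^T]mulmxA e mulmx1.
Qed.

Lemma conj_frame_skew B : B^T *m G = - (G *m B) -> (conj_frame B)^T = - conj_frame B.
Proof.
move=> BG; rewrite /conj_frame invE !trmx_mul trmxK.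
have [GT _] := pG; rewrite GT !mulmxA -(mulmxA E^T B^T G) BG.
by rewrite mulmxN mulNmx !mulmxA.
Qed.

Lemma fcompZ (a : R) X p : fcomp E (fun k => a *: X k) p = a *: fcomp E X p.
Proof.
rewrite /fcomp scaler_sumr; apply: eq_bigr => k _.
by rewrite -scalemxAr -scalemxAl !scalerA mulrC.
Qed.

Section TorsionPoint.
Variables (A : 'I_6 -> 'M[R]_6) (Q : 'I_6 -> 'I_6 -> 'M[R]_6).
Hypothesis AJ : forall m, A m *m J + J *m A m = 0.
Hypothesis AG : forall m, (A m)^T *m G = - (G *m A m).
Hypothesis Q12 : forall p q r s, Q p q r s = - Q q p r s.
Hypothesis Q23 : forall p q r s, Q p q r s = - Q p r q s.
Hypothesis Q34 : forall p q r s, Q p q r s = - Q p q s r.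
Hypothesis QA : forall m k, Q m k *m J + N k *m A m = (A m)^T *m N k + J^T *m Q m k.

Definition endo_frame p := \sum_m E m p *: conj_frame (A m).
Definition form4_frame p q := \sum_m E m p *: fcomp E (Q m) q.

(** In an orthonormal frame the inverse of E is E^T G, so lowering an index does not change
    components. *)
Lemma endo_frame_lower p : endo_frame p = fcomp E (fun m => G *m A m) p.
Proof.
apply: eq_bigr => m _; congr (_ *: _).
by rewrite /conj_frame invE !mulmxA.
Qed.

Lemma omx_form4 (a : R) p q : a *: omx (E^T *m W *m E) (E^T *m W *m E) p q =
  \sum_m E m p *: fcomp E (fun k => a *: omx W W m k) q.
Proof.
rewrite -omx_frame scaler_sumr; apply: eq_bigr => m _.
rewrite /fcomp !scaler_sumr; apply: eq_bigr => b _.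
by rewrite -scalemxAr -scalemxAl !scalerA; congr (_ *: _); ring.
Qed.

(** Frame components of nabla Psi+: the summand [Q m k *m J + N k *m A m] is the product rule for
    Psi+ = Psi- J. *)
Lemma frame_dP p q :
  \sum_m E m p *: \sum_k E k q *: (E^T *m (Q m k *m J + N k *m A m) *m E) =
  form4_frame p q *m J0 + ps0 q *m endo_frame p.
Proof.
rewrite -N0 /form4_frame mulmx_suml mulmx_sumr -big_split; apply: eq_bigr => m _ /=.
rewrite -scalemxAl -scalemxAr -scalerDr; congr (_ *: _).
rewrite /fcomp !mulmx_suml -big_split; apply: eq_bigr => k _ /=.
rewrite -!scalemxAl -scalerDr; congr (_ *: _).
by rewrite mulmxDr mulmxDl !trE conj_frameJ.
Qed.

Lemma torsion_point : exists lam : R,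
  (forall m, G *m A m = - lam *: P m) /\
  (forall m k, Q m k = - lam *: omx W W m k).
Proof.
have H1 p : endo_frame p *m J0 + J0 *m endo_frame p = 0.
  rewrite mulmx_suml mulmx_sumr -big_split/=; apply: big1 => m _.
  rewrite -scalemxAl -scalemxAr -scalerDr -conj_frameJ -!conj_frameM.
  by rewrite /conj_frame -mulmxDl -mulmxDr AJ mulmx0 mul0mx scaler0.
have H2 p : (endo_frame p)^T = - endo_frame p.
  rewrite trmx_lincomb -sumrN; apply: eq_bigr => m _; rewrite -scalerN.
  by congr (_ *: _); exact: conj_frame_skew.
have Qe p q r s : form4_frame p q r s =
    \sum_m \sum_k E m p * E k q * (E^T *m Q m k *m E) r s.
  rewrite summxE; apply: eq_bigr => m _; rewrite mxE summxE mulr_sumr.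
  by apply: eq_bigr => k _; rewrite mxE mulrA.
have H3 p q r s : form4_frame p q r s = - form4_frame q p r s.
  rewrite !Qe exchange_big -sumrN; apply: eq_bigr => m _ /=; rewrite -sumrN.
  apply: eq_bigr => k _; have -> : Q k m = - Q m k by apply/matrixP => i j; rewrite mxE -Q12.
  by rewrite mulmxN mulNmx mxE; ring.
have H4 p q r s : form4_frame p q r s = - form4_frame p r q s.
  rewrite 2!summxE -sumrN; apply: eq_bigr => m _; rewrite !mxE -mulrN; congr (_ * _).
  exact: fcomp_swap12.
have H5 p q r s : form4_frame p q r s = - form4_frame p q s r.
  rewrite 2!summxE -sumrN; apply: eq_bigr => m _; rewrite !mxE -mulrN; congr (_ * _).
  exact: fcomp_swap23.
have H6 p q : form4_frame p q *m J0 + ps0 q *m endo_frame p =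
    (endo_frame p)^T *m ps0 q + J0^T *m form4_frame p q.
  rewrite -frame_dP; under eq_bigr do under eq_bigr do rewrite QA.
  rewrite -N0 /form4_frame /endo_frame trmx_lincomb mulmx_suml mulmx_sumr -big_split.
  apply: eq_bigr => m _ /=; rewrite -scalemxAl -scalemxAr -scalerDr; congr (_ *: _).
  rewrite /fcomp !mulmx_sumr -big_split; apply: eq_bigr => k _ /=.
  rewrite -!scalemxAr -scalerDr; congr (_ *: _).
  by rewrite mulmxDr mulmxDl !trE' conj_frameJ.
have [lam [Al Ql]] := torsion_form H1 H2 H3 H4 H5 H6.
exists lam; split.
  apply: (fcomp_inj uE) => p; apply/matrixP => r s.
  by rewrite -endo_frame_lower Al -PE fcompZ mxE.
move=> m k; have := @fcomp_inj R 6 E (Q m) (fun k => - lam *: omx W W m k) uE.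
apply=> q; pose X m := fcomp E (Q m) q; pose Y m := fcomp E (fun k => - lam *: omx W W m k) q.
rewrite -/(X m) -/(Y m); apply: (lincomb_inj uE) => p; rewrite -/(form4_frame p q).
rewrite -[RHS]omx_form4.
by apply/matrixP => r s; rewrite Ql WE [RHS]mxE om_omE.
Qed.

End TorsionPoint.
Section CurvaturePoint.
Variables (A : 'I_6 -> 'M[R]_6) (Q : 'I_6 -> 'I_6 -> 'M[R]_6).
Variables (Rc : 'I_6 -> 'I_6 -> 'M[R]_6) (lam : R) (dl : 'I_6 -> R).
Hypothesis GA : forall m, G *m A m = - lam *: P m.
Hypothesis QW : forall m k, Q m k = - lam *: omx W W m k.
Hypothesis Rskew : forall i j, (Rc i j)^T *m G + G *m Rc i j = 0.
Hypothesis Ranti : forall i j, Rc j i = - Rc i j.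
Hypothesis Rbianchi : forall i j k l, Rc i j l k + Rc j k l i + Rc k i l j = 0.
Hypothesis RcW : forall i j, (Rc i j)^T *m W + W *m Rc i j =
  - (dl i *: P j - dl j *: P i
     + lam *: ((Q i j *m J + N j *m A i) - (Q j i *m J + N i *m A j))).

Let Rm p q := \sum_i \sum_j (E i p * E j q) *: conj_frame (Rc i j).
Let dlf p := \sum_i E i p * dl i.

Let Rm12 p q l s : Rm q p l s = - Rm p q l s.
Proof.
have -> : Rm q p = - Rm p q; last by rewrite mxE.
rewrite /Rm exchange_big -sumrN; apply: eq_bigr => i _ /=; rewrite -sumrN.
apply: eq_bigr => j _; rewrite Ranti /conj_frame mulmxN mulNmx scalerN.
by rewrite [E j q * _]mulrC.
Qed.

Let Rm_tr p q : (Rm p q)^T = - Rm p q.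
Proof.
have e (i j : 'I_6) : (conj_frame (Rc i j))^T = - conj_frame (Rc i j).
  by apply: conj_frame_skew; apply/eqP; rewrite -addr_eq0 Rskew.
rewrite /Rm trmx_lincomb2 -sumrN; apply: eq_bigr => i _; rewrite -sumrN.
by apply: eq_bigr => j _; rewrite e scalerN.
Qed.

Let Rm34 p q l s : Rm p q s l = - Rm p q l s.
Proof. by have := Rm_tr p q => /matrixP/(_ l s); rewrite mxE [RHS]mxE. Qed.

Let Rm_bianchi p q s l : Rm p q l s + Rm q s l p + Rm s p l q = 0.
Proof.
(* Only the lower indices are contracted with E; the upper one is common to the three terms, so the
   cyclic sum reduces to [Rbianchi]. *)
pose f a p q s := \sum_i \sum_j \sum_b E i p * E j q * E b s * Rc i j a b.
have RmE x y z : Rm x y l z = \sum_a invmx E l a * f a x y z.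
  rewrite summxE; under eq_bigr do rewrite summxE.
  have e i j : ((E i x * E j y) *: conj_frame (Rc i j)) l z =
      \sum_a \sum_b invmx E l a * (E i x * E j y * E b z * Rc i j a b).
    rewrite mxE [conj_frame _ _ _]mxE exchange_big mulr_sumr; apply: eq_bigr => b _ /=.
    by rewrite mxE mulr_suml mulr_sumr; apply: eq_bigr => a _; ring.
  under eq_bigr do under eq_bigr do rewrite e.
  under eq_bigr do rewrite exchange_big/=.
  rewrite exchange_big; apply: eq_bigr => a _ /=; rewrite /f mulr_sumr.
  apply: eq_bigr => i _; rewrite mulr_sumr; apply: eq_bigr => j _.
  by rewrite mulr_sumr.
rewrite !RmE -!big_split big1// => a _ /=; rewrite -!mulrDr.
suff -> : f a p q s + f a q s p + f a s p q = 0 by rewrite mulr0.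
have -> : f a q s p = \sum_i \sum_j \sum_b E i p * E j q * E b s * Rc j b a i.
  rewrite /f; under eq_bigr do rewrite exchange_big/=.
  rewrite exchange_big; apply: eq_bigr => i _ /=; apply: eq_bigr => j _.
  by apply: eq_bigr => b _; ring.
have -> : f a s p q = \sum_i \sum_j \sum_b E i p * E j q * E b s * Rc b i a j.
  rewrite /f exchange_big; apply: eq_bigr => i _ /=; rewrite exchange_big.
  by apply: eq_bigr => j _ /=; apply: eq_bigr => b _; ring.
rewrite /f -!big_split big1// => i _ /=; rewrite -!big_split big1// => j _ /=.
by rewrite -!big_split big1// => b _ /=; rewrite -!mulrDr Rbianchi mulr0.
Qed.

Let endoE p r s : endo_frame A p r s = - lam * (re_dz p r s)%:~R.
Proof.
rewrite endo_frame_lower -PE; have -> : fcomp E (fun m => G *m A m) p = - lam *: fcomp E P p.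
  by rewrite -fcompZ; apply: eq_bigr => k _; rewrite GA.
by rewrite mxE.
Qed.

Let form4E p q r s : form4_frame Q p q r s = - lam * (om_om p q r s)%:~R.
Proof.
have -> : form4_frame Q p q = - lam *: omx (E^T *m W *m E) (E^T *m W *m E) p q.
  rewrite omx_form4; apply: eq_bigr => m _; congr (_ *: _).
  by apply: eq_bigr => k _; rewrite QW.
by rewrite WE mxE om_omE.
Qed.

Let dPE (p q r s : 'I_6) : (form4_frame Q p q *m J0 + ps0 q *m endo_frame A p) r s =
  - lam * (dre p q r s)%:~R.
Proof.
have -> : (dre p q r s)%:~R = (jsg s)%:~R * (om_om p q r (jdx s))%:~R
    + \sum_(l < 6) (im_dz q r l * re_dz p l s)%:~R :> R.
  by rewrite (sum6E R (fun l => im_dz q r l * re_dz p l s)) /dre intrD [in LHS]intrM.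
rewrite mxE mulmxJ0 form4E [X in _ + X]mxE mulrDr; congr (_ + _); first exact: mulrCA.
rewrite mulr_sumr; apply: eq_bigr => l _.
by rewrite mxE endoE intrM mulrCA.
Qed.

Let RmW (p q r s : 'I_6) :
  (jsg s)%:~R * Rm p q r (jord s) + (jsg r)%:~R * Rm p q (jord r) s =
  - (dlf p * (re_dz q r s)%:~R - dlf q * (re_dz p r s)%:~R)
  + lam ^+ 2 * (ricci_om p q r s)%:~R.
Proof.
pose dP i j := Q i j *m J + N j *m A i.
have e : (Rm p q)^T *m J0^T + J0^T *m Rm p q =
    - (dlf p *: fcomp E P q - dlf q *: fcomp E P p
       + lam *: ((form4_frame Q p q *m J0 + ps0 q *m endo_frame A p)
                 - (form4_frame Q q p *m J0 + ps0 p *m endo_frame A q))).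
  transitivity (\sum_i \sum_j (E i p * E j q) *:
      (E^T *m ((Rc i j)^T *m W + W *m Rc i j) *m E)).
    rewrite -WE /Rm trmx_lincomb2.
    rewrite mulmx_suml mulmx_sumr -big_split; apply: eq_bigr => i _ /=.
    rewrite mulmx_suml mulmx_sumr -big_split; apply: eq_bigr => j _ /=.
    rewrite -scalemxAl -scalemxAr -scalerDr; congr (_ *: _).
    by rewrite mulmxDr mulmxDl (trE' W (Rc i j)) (trE W (Rc i j)).
  rewrite -!frame_dP.
  have S (X : 'I_6 -> 'I_6 -> 'M[R]_6) x y : \sum_m E m x *: \sum_k E k y *: (E^T *m X m k *m E) =
      \sum_m \sum_k (E m x * E k y) *: (E^T *m X m k *m E).
    apply: eq_bigr => m _; rewrite scaler_sumr; apply: eq_bigr => k _.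
    by rewrite scalerA.
  have S' (X : 'I_6 -> 'I_6 -> 'M[R]_6) x y :
      \sum_m E m y *: \sum_k E k x *: (E^T *m X m k *m E) =
      \sum_i \sum_j (E i x * E j y) *: (E^T *m X j i *m E).
    rewrite S exchange_big; apply: eq_bigr => m _ /=; apply: eq_bigr => k _.
    by rewrite mulrC.
  have D (F : 'I_6 -> 'M[R]_6) x y : dlf x *: fcomp E F y =
      \sum_i \sum_j (E i x * E j y) *: (E^T *m (dl i *: F j) *m E).
    rewrite /dlf scaler_suml; apply: eq_bigr => i _; rewrite /fcomp scaler_sumr.
    by apply: eq_bigr => j _; rewrite -scalemxAr -scalemxAl !scalerA; congr (_ *: _); ring.
  have D' (F : 'I_6 -> 'M[R]_6) x y : dlf y *: fcomp E F x =
      \sum_i \sum_j (E i x * E j y) *: (E^T *m (dl j *: F i) *m E).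
    rewrite D exchange_big; apply: eq_bigr => m _ /=; apply: eq_bigr => k _.
    by rewrite mulrC.
  rewrite (S dP p q) (S' dP p q) (D P p q) (D' P p q) -!sumrB scaler_sumr -big_split -sumrN.
  apply: eq_bigr => i _ /=; rewrite -!sumrB scaler_sumr -big_split -sumrN.
  apply: eq_bigr => j _ /=; rewrite RcW -/(dP i j) -/(dP j i).
  move: (E i p * E j q) => c; rewrite -!scalerBr scalerA [lam * _]mulrC -scalerA -scalerDr.
  apply: etrans _ (scalerN _ _); congr (_ *: _); rewrite mulmxN mulNmx; congr (- _).
  by rewrite mulmxDr mulmxDl !mulmxBr !mulmxBl -!scalemxAr -!scalemxAl mulmxBr mulmxBl.
have := congr1 (fun m : 'M_6 => m r s) e.
have -> : ((Rm p q)^T *m J0^T + J0^T *m Rm p q) r s =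
    (jsg s)%:~R * Rm p q r (jord s) + (jsg r)%:~R * Rm p q (jord r) s.
  rewrite mxE mulJ0Tmx; congr (_ + _).
  by rewrite -trmx_mul mxE -[J0]opprK -J0_tr mulNmx mxE mulJ0Tmx (Rm34 p q r (jord s)) mulrN opprK.
move=> ->.
have mx4 (X Y Z V : 'M[R]_6) (x y z : R) : (- (x *: X - y *: Y + z *: (Z - V))) r s =
    - (x * X r s - y * Y r s + z * (Z r s - V r s)) by rewrite !mxE.
by rewrite mx4 !dPE !PE /ricci_om intrB; ring.
Qed.

Lemma torsion_constant_point i : dl i = 0.
Proof.
have d0 := torsion_constant Rm12 Rm34 Rm_bianchi RmW.
(* [R^o] makes scalars a module, so that [lincomb_inj] applies to the covector [dl]. *)
rewrite -[RHS]/((fun _ : 'I_6 => 0 : R^o) i).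
apply: (lincomb_inj (V := R^o) (X := dl) uE) => p.
by rewrite [RHS]big1 => [|k _]; [exact: d0|rewrite scaler0].
Qed.

Hypothesis RcN : forall i j k,
  (Rc i j)^T *m N k + N k *m Rc i j + \sum_l Rc i j l k *: N l =
  lam ^+ 2 *: ((omx (P i) W j k + omx W (P i) j k) - (omx (P j) W i k + omx W (P j) i k)).

(** The derivation action of an endomorphism on a 3-tensor is natural under change of frame; the
    last sum is the action on the slice index. *)
Let conj_frame_act (B : 'M[R]_6) k :
  \sum_a E a k *: (E^T *m (B^T *m N a + N a *m B + \sum_l B l a *: N l) *m E) =
  (conj_frame B)^T *m ps0 k + ps0 k *m conj_frame B + \sum_s conj_frame B s k *: ps0 s.
Proof.
under eq_bigr do rewrite mulmxDr mulmxDl scalerDr mulmxDr mulmxDl scalerDr.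
rewrite !big_split/=; congr (_ + _ + _).
- rewrite -N0 /fcomp mulmx_sumr; apply: eq_bigr => a _.
  by rewrite (trE' (N a) B) -scalemxAr.
- rewrite -N0 /fcomp mulmx_suml; apply: eq_bigr => a _.
  by rewrite (trE (N a) B) -scalemxAl.
under [RHS]eq_bigr do rewrite -N0 /fcomp scaler_sumr.
rewrite [RHS]exchange_big/=.
under eq_bigr do rewrite mulmx_sumr mulmx_suml scaler_sumr.
rewrite exchange_big/=; apply: eq_bigr => l _.
under eq_bigr do rewrite -scalemxAr -scalemxAl scalerA.
under [RHS]eq_bigr do rewrite scalerA.
rewrite -!scaler_suml; congr (_ *: _).
transitivity ((B *m E) l k); first by rewrite mxE; apply: eq_bigr => a _; rewrite mulrC.
have -> : B *m E = E *m conj_frame B by rewrite /conj_frame !mulmxA mulmxV// mul1mx.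
by rewrite mxE; apply: eq_bigr => a _; rewrite mulrC.
Qed.

Let omx_lincomb_l (a : 'I_6 -> R) (X : 'I_6 -> 'M[R]_6) Y q k :
  \sum_i a i *: omx (X i) Y q k = omx (\sum_i a i *: X i) Y q k.
Proof.
apply/matrixP => l m; rewrite omxE !summxE 3!mulr_suml -sumrB -big_split.
by apply: eq_bigr => i _ /=; rewrite mxE omxE !mxE; ring.
Qed.

Let omx_lincomb_r (a : 'I_6 -> R) (X : 'I_6 -> 'M[R]_6) Y q k :
  \sum_i a i *: omx Y (X i) q k = omx Y (\sum_i a i *: X i) q k.
Proof.
apply/matrixP => l m; rewrite omxE !summxE 3!mulr_sumr -sumrB -big_split.
by apply: eq_bigr => i _ /=; rewrite mxE omxE !mxE; ring.
Qed.

Let RmN (p q k l m : 'I_6) :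
  \sum_s (Rm p q s k * (im_dz s l m)%:~R + Rm p q s l * (im_dz k s m)%:~R
           + Rm p q s m * (im_dz k l s)%:~R) = lam ^+ 2 * (ricci_im p q k l m)%:~R.
Proof.
pose C i j k := (Rc i j)^T *m N k + N k *m Rc i j + \sum_l Rc i j l k *: N l.
pose D i j k := omx (P i) W j k + omx W (P i) j k.
pose Df p q k := omx (fcomp E P p) J0^T q k + omx J0^T (fcomp E P p) q k.
have L : \sum_i \sum_j (E i p * E j q) *: (\sum_a E a k *: (E^T *m C i j a *m E)) =
    (Rm p q)^T *m ps0 k + ps0 k *m Rm p q + \sum_s Rm p q s k *: ps0 s.
  under eq_bigr do under eq_bigr do rewrite conj_frame_act !scalerDr.
  under eq_bigr do rewrite !big_split/=.
  rewrite !big_split/= /Rm trmx_lincomb2; congr (_ + _ + _).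
  - rewrite mulmx_suml; apply: eq_bigr => i _; rewrite mulmx_suml; apply: eq_bigr => j _.
    by rewrite scalemxAl.
  - rewrite mulmx_sumr; apply: eq_bigr => i _; rewrite mulmx_sumr; apply: eq_bigr => j _.
    by rewrite scalemxAr.
  under eq_bigr do under eq_bigr do rewrite scaler_sumr.
  under eq_bigr do rewrite exchange_big/=.
  rewrite exchange_big; apply: eq_bigr => s _ /=.
  rewrite summxE scaler_suml; apply: eq_bigr => i _.
  rewrite summxE scaler_suml; apply: eq_bigr => j _.
  by rewrite scalerA [in RHS]mxE.
have S i x y : \sum_j \sum_a (E j x * E a y) *: (E^T *m D i j a *m E) =
    omx (E^T *m P i *m E) J0^T x y + omx J0^T (E^T *m P i *m E) x y.
  rewrite -WE -!omx_frame -big_split; apply: eq_bigr => j _ /=.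
  rewrite -big_split; apply: eq_bigr => a _ /=.
  by rewrite -scalerDr mulmxDr mulmxDl.
have S2 x y z : \sum_i \sum_j \sum_a (E i x * E j y * E a z) *: (E^T *m D i j a *m E) = Df x y z.
  transitivity (\sum_i E i x *: (\sum_j \sum_a (E j y * E a z) *: (E^T *m D i j a *m E))).
    apply: eq_bigr => i _; rewrite scaler_sumr; apply: eq_bigr => j _.
    by rewrite scaler_sumr; apply: eq_bigr => a _; rewrite scalerA mulrA.
  under eq_bigr do rewrite S scalerDr.
  by rewrite big_split/= omx_lincomb_l omx_lincomb_r.
have e : (Rm p q)^T *m ps0 k + ps0 k *m Rm p q + \sum_s Rm p q s k *: ps0 s =
    lam ^+ 2 *: (Df p q k - Df q p k).
  rewrite -L -(S2 p q k) -(S2 q p k) [X in _ - X]exchange_big/= -sumrB scaler_sumr.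
  apply: eq_bigr => i _; rewrite -sumrB scaler_sumr; apply: eq_bigr => j _.
  rewrite -sumrB !scaler_sumr; apply: eq_bigr => a _.
  rewrite /C RcN -/(D i j a) -/(D j i a) -scalemxAr -scalemxAl mulmxBr mulmxBl.
  rewrite !scalerBr !scalerA; congr (_ *: _ - _ *: _); ring.
have := congr1 (fun z : 'M_6 => z l m) e.
have mx3 (X Y Z : 'M[R]_6) : (X + Y + Z) l m = X l m + Y l m + Z l m by rewrite !mxE.
rewrite mx3 => e2; rewrite !big_split/=.
have t1 : ((Rm p q)^T *m ps0 k) l m = \sum_s Rm p q s l * (im_dz k s m)%:~R.
  by rewrite mxE; apply: eq_bigr => s _; rewrite [_^T _ _]mxE [ps0 _ _ _]mxE.
have t2 : (ps0 k *m Rm p q) l m = \sum_s Rm p q s m * (im_dz k l s)%:~R.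
  by rewrite mxE; apply: eq_bigr => s _; rewrite [ps0 _ _ _]mxE mulrC.
have t3 : (\sum_s Rm p q s k *: ps0 s) l m = \sum_s Rm p q s k * (im_dz s l m)%:~R.
  by rewrite summxE; apply: eq_bigr => s _; rewrite mxE [ps0 _ _ _]mxE.
rewrite t1 t2 t3 in e2; rewrite -addrA [LHS]addrC e2.
have DfE (x y z : 'I_6) : Df x y z l m = (dom_om x y z l m)%:~R.
  rewrite mxE !omxE !J0T_om !PE -!intrM -!intrB -!intrD; congr (_%:~R).
  by rewrite /dom_om; ring.
have mx2 (X Y : 'M[R]_6) (z : R) : (z *: (X - Y)) l m = z * (X l m - Y l m).
  by rewrite !mxE.
by rewrite mx2 !DfE /ricci_im intrB.
Qed.

(** The inverse metric is E E^T, so the metric trace of the Ricci tensor is a plain double trace in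
    the frame. *)
Lemma scalar_curvature_point :
  \sum_j \sum_k invmx G j k * \sum_i Rc i j i k = 30 * lam ^+ 2.
Proof.
have invG : invmx G = E *m E^T.
  have EG : E^T *m (G *m E) = 1%:M by rewrite mulmxA.
  have GEE : G *m (E *m E^T) = 1%:M by rewrite mulmxA; exact: mulmx1C.
  by rewrite -[LHS]mulmx1 -GEE mulKmx//; have [] := mulmx1_unit GEE.
have invGT : (invmx G)^T = invmx G by rewrite invG trmx_mul trmxK.
rewrite -(scalar_curvature_frame Rm12 Rm34 Rm_bianchi RmW RmN).
transitivity (\sum_i \sum_j (Rc i j *m invmx G) i j).
  under eq_bigr do under eq_bigr do rewrite mulr_sumr.
  under eq_bigr do rewrite exchange_big/=.
  rewrite exchange_big; apply: eq_bigr => i _ /=; apply: eq_bigr => j _.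
  rewrite mxE; apply: eq_bigr => k _; rewrite mulrC; congr (_ * _).
  by rewrite -{1}invGT mxE.
have e i j : (Rc i j *m invmx G) i j = \sum_p \sum_q (E i p * E j q) * conj_frame (Rc i j) p q.
  have -> : Rc i j *m invmx G = E *m conj_frame (Rc i j) *m E^T.
    by rewrite invG /conj_frame !mulmxA mulmxV// mul1mx.
  rewrite mxE exchange_big; apply: eq_bigr => q _ /=; rewrite mxE mulr_suml.
  by apply: eq_bigr => p _; rewrite [_^T _ _]mxE; ring.
under eq_bigr do under eq_bigr do rewrite e.
under eq_bigr do rewrite exchange_big/=.
rewrite exchange_big; apply: eq_bigr => p _ /=.
under eq_bigr do rewrite exchange_big/=.
rewrite exchange_big; apply: eq_bigr => q _ /=.
rewrite summxE; apply: eq_bigr => i _; rewrite summxE; apply: eq_bigr => j _.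
by rewrite [RHS]mxE.
Qed.

End CurvaturePoint.
End Pointwise.

(** * The torsion in a chart *)

(** Links [nabla] to the slice calculus: the Christoffel sum of the first slot is the sum in [covF],
    those of the other two slots are the matrix products in [covB]. *)
Lemma nabla3E (R : realType) n (M : manifold R n) (g : @matrix_field R n M)
    (T : @ktensor_field R n M 3) c y m k i j :
  nabla g T c y [tuple m; k; i; j] = covF g c m k (fun k z => fam (T c z) k) y i j.
Proof.
have mx2 (A B : 'M[R]_n) : (A - B) i j = A i j - B i j by rewrite !mxE.
have mx3 (A B C : 'M[R]_n) : (A - B - C) i j = A i j - B i j - C i j by rewrite !mxE.
rewrite /nabla /covF mx2 /covB mx3.
have -> : tdel [tuple m; k; i; j] ord0 = [tuple k; i; j].
  by apply: eq_from_tnth => a; rewrite tnth_mktuple !(tnth_nth k); case: a => -[|[|[|//]]].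
rewrite -[thead _]/m -!addrA; congr (_ + _).
  by rewrite [RHS]mxE; apply: partial_ext => z; rewrite mxE.
have tu0 l : tupd [tuple k; i; j] ord0 l = [tuple l; i; j].
  by apply: eq_from_tnth => a; rewrite tnth_mktuple -val_eqE !(tnth_nth k); case: a => -[|[|[|//]]].
have tu1 l : tupd [tuple k; i; j] (lift ord0 ord0) l = [tuple k; l; j].
  by apply: eq_from_tnth => a; rewrite tnth_mktuple -val_eqE !(tnth_nth k); case: a => -[|[|[|//]]].
have tu2 l : tupd [tuple k; i; j] (lift ord0 (lift ord0 ord0)) l = [tuple k; i; l].
  by apply: eq_from_tnth => a; rewrite tnth_mktuple -val_eqE !(tnth_nth k); case: a => -[|[|[|//]]].
rewrite !big_ord_recl big_ord0 addr0 !opprD [RHS]addrA [RHS]addrC.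
congr (_ + (_ + _)); congr (- _).
- rewrite summxE; apply: eq_bigr => l _.
  by rewrite !mxE tu0 (tnth_nth k).
- rewrite [RHS]mxE; apply: eq_bigr => l _.
  by rewrite tu1 !mxE (tnth_nth k).
- rewrite [RHS]mxE; apply: eq_bigr => l _.
  by rewrite tu2 !mxE mulrC (tnth_nth k).
Qed.

Lemma alternating4_swaps (V : zmodType) n (T : 4.-tuple 'I_n -> V) : alternating T ->
  [/\ forall a b c d, T [tuple a; b; c; d] = - T [tuple b; a; c; d],
      forall a b c d, T [tuple a; b; c; d] = - T [tuple a; c; b; d] &
      forall a b c d, T [tuple a; b; c; d] = - T [tuple a; b; d; c]].
Proof.
move=> aT.
have sw (I : 4.-tuple 'I_n) (p q : 'I_4) : p != q -> T (tperm_idx I (tperm p q)) = - T I.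
  by move=> pq; rewrite aT odd_tperm pq.
have tp (I K : 4.-tuple 'I_n) (p q : 'I_4) : tnth K p = tnth I q -> tnth K q = tnth I p ->
    (forall r, r != p -> r != q -> tnth K r = tnth I r) -> K = tperm_idx I (tperm p q).
  move=> Kp Kq Kr; apply: eq_from_tnth => r; rewrite tnth_mktuple.
  by case: tpermP => [->|->|/eqP rp /eqP rq]; rewrite ?Kp ?Kq// Kr.
have o1 : (lift ord0 ord0 : 'I_4) != ord0 by [].
split=> a b c d.
- rewrite -(sw _ (Ordinal (isT : (0 < 4)%N)) (Ordinal (isT : (1 < 4)%N)))//; congr T.
  by apply: tp; rewrite ?(tnth_nth a)// => -[[|[|[|[|//]]]] r4] //= _ _; rewrite !(tnth_nth a).
- rewrite -(sw _ (Ordinal (isT : (1 < 4)%N)) (Ordinal (isT : (2 < 4)%N)))//; congr T.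
  by apply: tp; rewrite ?(tnth_nth a)// => -[[|[|[|[|//]]]] r4] //= _ _; rewrite !(tnth_nth a).
- rewrite -(sw _ (Ordinal (isT : (2 < 4)%N)) (Ordinal (isT : (3 < 4)%N)))//; congr T.
  by apply: tp; rewrite ?(tnth_nth a)// => -[[|[|[|[|//]]]] r4] //= _ _; rewrite !(tnth_nth a).
Qed.

Section Chart.
Context {R : realType} {M : manifold R 6}.
Variables (g : @matrix_field R 6 M) (g_metric : riemannian_metric g).
Variables (S : su3_structure g) (S_killing : killing g (Psi_minus S)) (c : chart M).

Definition cimg := chart_map c @` chart_dom c.
(* components in the chart c of Psi+, Psi-, J, omega, nabla J and nabla Psi-;
   3-tensors are sliced along their first index *)
Definition Pf k z := fam (Psi_plus S c z) k.
Definition Nf k z := fam (Psi_minus S c z) k.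
Definition Jf := su3_J S c.
Definition Wf z := (Jf z)^T *m g c z.
Definition Af m := covE g c m Jf.
Definition Qf m k := covF g c m k Nf.

Lemma open_cimg : open cimg. Proof. exact: chart_image_open. Qed.

Lemma smooth_g : msmooth cimg (g c).
Proof. by move=> i j; have [[+ _] _] := g_metric; apply. Qed.

Lemma pd_g z : cimg z -> positive_definite (g c z).
Proof. by move=> [x cx <-]; have [_] := g_metric; apply. Qed.

Lemma smooth_J : msmooth cimg Jf.
Proof. by move=> i j; have [[+ _] _] := su3_almost_complex S; apply. Qed.

Lemma J_sqr z : cimg z -> Jf z *m Jf z = - 1%:M.
Proof. by move=> [x cx <-]; have [_] := su3_almost_complex S; apply. Qed.

Lemma J_compat z : cimg z -> (Jf z)^T *m g c z *m Jf z = g c z.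
Proof. by move=> [x cx <-]; exact: su3_compatible. Qed.

Lemma smooth_P k : msmooth cimg (Pf k).
Proof.
move=> i j; have [[sP _] _] := Psi_plus_form S.
by apply: smooth_on_ext open_cimg _ (sP c [tuple k; i; j]) => z _; rewrite mxE.
Qed.

Lemma alternating_P z : cimg z -> alternating (Psi_plus S c z).
Proof. by move=> [x cx <-]; have [_] := Psi_plus_form S; apply. Qed.

Lemma slot_P z k : cimg z -> Pf k z *m Jf z = (Jf z)^T *m Pf k z.
Proof. by move=> [x cx <-]; apply: type_slot; exact: Psi_plus_type. Qed.

Lemma frame_at z : cimg z -> exists E, [/\ adapted (g c z) (Jf z) E,
  forall p q r, fcomp E (Pf ^~ z) p q r = (re_dz p q r)%:~R &
  forall p q r, fcomp E (Nf ^~ z) p q r = (im_dz p q r)%:~R].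
Proof.
move=> Uz; apply: (su3_frame (pd_g Uz) (J_sqr Uz) (J_compat Uz) (alternating_P Uz)).
  by move=> k; exact: slot_P.
by move: Uz => [x cx <-]; exact: Psi_plus_volume.
Qed.

Lemma re_im_check : all6 (fun p => all6 (fun r => all6 (fun s =>
  im_dz p r s == - (jsg s * re_dz p r (jdx s))))).
Proof. by vm_compute. Qed.

(** Psi- (X, Y, Z) = - Psi+ (X, Y, J Z). This replaces the Hodge star in all differentiations, where
    square roots and orientation signs would intervene. *)
Lemma N_eq z k : cimg z -> Nf k z = - (Pf k z *m Jf z).
Proof.
move=> Uz; have [E [aE PE NE]] := frame_at Uz.
have uE := adapted_unitmx aE; move: k; apply: (fcomp_inj (X := Nf ^~ z)
  (Y := fun k => - (Pf k z *m Jf z)) uE) => p.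
transitivity (- (fcomp E (Pf ^~ z) p *m J0)).
  apply/matrixP => r s; rewrite NE mxE mulmxJ0 PE.
  have /(all6P p)/(all6P r)/(all6P s)/eqP -> := re_im_check.
  by rewrite mulrNz intrM. 
have [_ JE] := aE; rewrite /fcomp mulmx_suml -sumrN; apply: eq_bigr => k _.
by rewrite mulmxN mulNmx scalerN -scalemxAl -!mulmxA JE.
Qed.

Lemma P_eq z k : cimg z -> Pf k z = Nf k z *m Jf z.
Proof. by move=> Uz; rewrite N_eq// mulNmx -mulmxA J_sqr// mulmxN mulmx1 opprK. Qed.

Lemma slot_N z k : cimg z -> Nf k z *m Jf z = (Jf z)^T *m Nf k z.
Proof.
move=> Uz; rewrite -P_eq// N_eq// mulmxN mulmxA -slot_P//.
by rewrite -mulmxA J_sqr// mulmxN mulmx1 opprK.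
Qed.

Lemma smooth_N k : msmooth cimg (Nf k).
Proof.
have s := msmoothN open_cimg (msmoothM open_cimg (smooth_P k) smooth_J).
by move=> i j; apply: smooth_on_ext open_cimg _ (s i j) => z Uz; rewrite N_eq.
Qed.

Lemma smooth_W : msmooth cimg Wf.
Proof. exact: msmoothM open_cimg (msmooth_tr open_cimg smooth_J) smooth_g. Qed.

Lemma near_cimg z (Q : 'rV[R]_6 -> Prop) : cimg z -> (forall w, cimg w -> Q w) ->
  \forall w \near z, Q w.
Proof. exact: open_near open_cimg. Qed.

Lemma A_anti z m : cimg z -> Af m z *m Jf z + Jf z *m Af m z = 0.
Proof.
move=> Uz; have dJ := msmooth_mdiff smooth_J Uz.
have nr : \forall w \near z, Jf w *m Jf w = (-1)%:M.
  by apply: near_cimg => // w Uw; rewrite J_sqr// -scaleN1r scale_scalar_mx mulr1.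
by rewrite -covEM// (covE_near g c m nr) covE_scalar.
Qed.

(** omega is both the transpose of g J and - g J, and g is parallel. Comparing the two derivatives
    shows that nabla J is skew for g. *)
Lemma covB_W z m : cimg z -> covB g c m Wf z = (Af m z)^T *m g c z /\
  covB g c m Wf z = - (g c z *m Af m z).
Proof.
move=> Uz; have dJ := msmooth_mdiff smooth_J Uz.
have dg := msmooth_mdiff smooth_g Uz.
have gJ : covB g c m (fun w => g c w *m Jf w) z = g c z *m Af m z.
  by rewrite covBM// (covB_metric open_cimg pd_g)// mul0mx add0r.
have n1 : \forall w \near z, Wf w = (g c w *m Jf w)^T.
  by apply: near_cimg => // w Uw; rewrite trmx_mul; have [-> _] := pd_g Uw.
have n2 : \forall w \near z, Wf w = - (g c w *m Jf w).
  by apply: near_cimg => // w Uw; exact: compatible_skew (J_sqr Uw) (J_compat Uw).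
split; first by rewrite (covB_near g c m n1) covB_tr gJ trmx_mul; have [-> _] := pd_g Uz.
by rewrite (covB_near g c m n2) covBN ?gJ//; exact: mdiffM.
Qed.

Lemma covB_mull m B F y : mdiff B y -> mdiff F y ->
  covB g c m (fun z => (F z)^T *m B z) y =
  (covE g c m F y)^T *m B y + (F y)^T *m covB g c m B y.
Proof.
move=> dB dF; have nr : \forall z \near y, (F z)^T *m B z = ((B z)^T *m F z)^T.
  by near=> z; rewrite trmx_mul trmxK.
rewrite (covB_near g c m nr) covB_tr covBM//; last exact: mdiff_tr.
rewrite covB_tr; apply/matrixP => i j.
have trD (a b : 'M[R]_6) : (a + b)^T = a^T + b^T by apply/matrixP => u v; rewrite !mxE.
by rewrite trD !trmx_mul !trmxK addrC.
Unshelve. all: by end_near. Qed.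

(** The derivative of [slot_N]; the Christoffel terms of the slice index match by [slot_N]
    itself. *)
Lemma Q_slot z m k : cimg z ->
  Qf m k z *m Jf z + Nf k z *m Af m z = (Af m z)^T *m Nf k z + (Jf z)^T *m Qf m k z.
Proof.
move=> Uz; have dJ := msmooth_mdiff smooth_J Uz.
have dN l := msmooth_mdiff (smooth_N l) Uz.
have e : covB g c m (Nf k) z *m Jf z + Nf k z *m Af m z =
    (Af m z)^T *m Nf k z + (Jf z)^T *m covB g c m (Nf k) z.
  rewrite -covBM// -covB_mull//; apply: covB_near.
  by apply: near_cimg => // w Uw; exact: slot_N.
rewrite /Qf /covF mulmxBl (mulmxBr (Jf z)^T) addrAC e -addrA; congr (_ + (_ - _)).
rewrite mulmx_suml mulmx_sumr; apply: eq_bigr => l _.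
by rewrite -scalemxAl -scalemxAr slot_N.
Qed.

(** Here the Killing hypothesis enters. *)
Lemma Q_alt z : cimg z ->
  [/\ forall p q r s, Qf p q z r s = - Qf q p z r s,
      forall p q r s, Qf p q z r s = - Qf p r z q s &
      forall p q r s, Qf p q z r s = - Qf p q z s r].
Proof.
move=> [x cx <-]; have [H1 H2 H3] := alternating4_swaps (S_killing cx).
by split=> p q r s; rewrite /Qf -!nabla3E.
Qed.

Lemma torsion_at z : cimg z -> exists lam : R,
  (forall m, covB g c m Wf z = lam *: Pf m z) /\
  (forall m k, Qf m k z = - lam *: omx (Wf z) (Wf z) m k).
Proof.
move=> Uz; have [E [aE PE NE]] := frame_at Uz.
have [Q1 Q2 Q3] := Q_alt Uz.
have AG m : (Af m z)^T *m g c z = - (g c z *m Af m z).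
  by have [<- ->] := covB_W m Uz.
have [lam [GA QW]] := torsion_point (pd_g Uz) aE PE NE
  (fun m => A_anti m Uz) AG Q1 Q2 Q3 (fun m k => Q_slot m k Uz).
exists lam; split => // m; have [_ ->] := covB_W m Uz.
by rewrite GA scaleNr opprK.
Qed.

End Chart.

Lemma omxZl (R : realType) n (a : R) (X Y : 'M[R]_n) m k : omx (a *: X) Y m k = a *: omx X Y m k.
Proof. by apply/matrixP => i j; rewrite omxE [RHS]mxE omxE !mxE; ring. Qed.

Lemma omxZr (R : realType) n (a : R) (X Y : 'M[R]_n) m k : omx X (a *: Y) m k = a *: omx X Y m k.
Proof. by apply/matrixP => i j; rewrite omxE [RHS]mxE omxE !mxE; ring. Qed.

Section OmxLeibniz.
Context {R : realType} {n : nat} {M : manifold R n}.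
Variables (g : @matrix_field R n M) (c : chart M).

Lemma mdiff_omx (W : 'rV[R]_n -> 'M[R]_n) j k y : mdiff W y ->
  mdiff (fun z => omx (W z) (W z) j k) y.
Proof.
move=> dW a b; rewrite (_ : (fun z => _) = (fun z => W z j k * W z a b
    - W z j a * W z k b + W z j b * W z k a)); last by apply/funext => z; rewrite omxE.
apply: differentiableD; last exact: differentiableM.
by apply: differentiableB; exact: differentiableM.
Qed.

(** Leibniz rule for (omega /\ omega) / 2. The left-hand side corrects for every index but j, whence
    the Christoffel sum on the right. *)
Lemma covB_omx i j k (W : 'rV[R]_n -> 'M[R]_n) y : mdiff W y ->
  covB g c i (fun z => omx (W z) (W z) j k) y
  - \sum_l chrmx g c i y l k *: omx (W y) (W y) j l =
  omx (covB g c i W y) (W y) j k + omx (W y) (covB g c i W y) j k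
  + \sum_l chrmx g c i y l j *: omx (W y) (W y) l k.
Proof.
move=> dW; apply/matrixP => a b; rewrite !covBE.
have dE : dmx i (fun z => omx (W z) (W z) j k) y a b =
    dmx i W y j k * W y a b + W y j k * dmx i W y a b
    - (dmx i W y j a * W y k b + W y j a * dmx i W y k b)
    + (dmx i W y j b * W y k a + W y j b * dmx i W y k a).
  rewrite [LHS]mxE (partial_ext _ _ (h := fun z => W z j k * W z a b
    - W z j a * W z k b + W z j b * W z k a)); last by move=> z; rewrite omxE.
  have d2 u v u' v' : differentiable (fun z => W z u v * W z u' v') y.
    exact: differentiableM.
  rewrite partialD//; last exact: differentiableB.
  rewrite partialD//; last exact: differentiableN.
  by rewrite partialN// !partialM// ![dmx i W y _ _]mxE.
move: (dmx i (fun z => _) y) (dmx i W y) (chrmx g c i y) (W y) dE => D d Ga w dE.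
pose X := Ga^T *m w; pose Y := w *m Ga.
have XE u v : \sum_l Ga l u * w l v = X u v.
  by rewrite mxE; apply: eq_bigr => l _; rewrite mxE.
have YE u v : \sum_l Ga l v * w u l = Y u v.
  by rewrite mxE; apply: eq_bigr => l _; rewrite mulrC.
have e1 : (Ga^T *m omx w w j k) a b = w j k * X a b - Y j a * w k b + w j b * Y k a.
  rewrite -!XE -!YE mulr_suml !mulr_sumr -sumrB -big_split mxE.
  by apply: eq_bigr => l _ /=; rewrite mxE omxE; ring.
have e2 : (omx w w j k *m Ga) a b = w j k * Y a b - w j a * Y k b + Y j b * w k a.
  rewrite -!YE mulr_suml !mulr_sumr -sumrB -big_split mxE.
  by apply: eq_bigr => l _ /=; rewrite omxE; ring.
have e3 : (\sum_l Ga l k *: omx w w j l) a b = Y j k * w a b - w j a * X k b + w j b * X k a.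
  rewrite -!YE -!XE mulr_suml !mulr_sumr -sumrB -big_split summxE.
  by apply: eq_bigr => l _ /=; rewrite mxE omxE; ring.
have e4 : (\sum_l Ga l j *: omx w w l k) a b = X j k * w a b - X j a * w k b + X j b * w k a.
  rewrite -!XE 3!mulr_suml -sumrB -big_split summxE.
  by apply: eq_bigr => l _ /=; rewrite mxE omxE; ring.
have mx4 (A B F H : 'M[R]_n) : (A - B - F - H) a b = A a b - B a b - F a b - H a b.
  by rewrite !mxE.
have mx3 (A B F : 'M[R]_n) u v : (A - B - F) u v = A u v - B u v - F u v by rewrite !mxE.
have mx3' (A B F : 'M[R]_n) : (A + B + F) a b = A a b + B a b + F a b by rewrite !mxE.
rewrite mx4 mx3' e1 e2 e3 e4 !omxE !mx3 dE -/X -/Y; ring.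
Qed.

End OmxLeibniz.

(** C1 and C2 stand for iterated derivatives in the two orders, s1 and s2 for their Christoffel sums
    in the second index, which agree as the connection is torsion-free. *)
Lemma alternation_cancel (R : pzRingType) (V : lmodType R) (l : R)
    (C1 C2 w a1 a2 x1 x2 s1 s2 : V) :
  C1 - C2 = - w -> C1 = a1 + l *: (x1 + s1) -> C2 = a2 + l *: (x2 + s2) -> s1 = s2 ->
  w = - (a1 - a2 + l *: (x1 - x2)).
Proof.
move=> e e1 e2 es; apply: oppr_inj; rewrite opprK -e e1 e2 es opprD addrACA.
by rewrite -scalerBr opprD addrACA subrr addr0.
Qed.

Lemma alternation_cancel2 (R : pzRingType) (V : lmodType R) (l : R)
    (C1 C2 w x1 x2 s1 s2 : V) :
  C1 - C2 = - w -> C1 = - l *: (l *: x1 + s1) -> C2 = - l *: (l *: x2 + s2) -> s1 = s2 ->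
  w = l ^+ 2 *: (x1 - x2).
Proof.
move=> e e1 e2 es; apply: oppr_inj; rewrite -e e1 e2 es -scalerBr opprD addrACA.
by rewrite subrr addr0 -scalerBr scalerA expr2 mulNr scaleNr.
Qed.

(** * The torsion function in a chart: differentiability, vanishing differential, scalar
    curvature *)

Section ChartScale.
Context {R : realType} {M : manifold R 6}.
Variables (g : @matrix_field R 6 M) (g_metric : riemannian_metric g).
Variables (S : su3_structure g) (S_killing : killing g (Psi_minus S)) (c : chart M).
Variable lam : 'rV[R]_6 -> R.
Notation U := (cimg c).
Notation W := (Wf S c).
Notation P := (Pf S c).
Notation N := (Nf S c).
Notation J := (Jf S c).
Notation A := (Af S c).
Notation Q := (Qf S c).
Hypothesis lamW : forall z m, U z -> covB g c m W z = lam z *: P m z.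
Hypothesis lamQ : forall z m k, U z -> Q m k z = - lam z *: omx (W z) (W z) m k.

Let oU : open U := open_cimg (c := c).
Let sg := smooth_g g_metric c.
Let pg := pd_g g_metric (c := c).
Let dch i y (Uy : U y) := mdiff_chrmx oU sg pg i Uy.

Lemma P_nonzero z : U z -> exists m i j, P m z i j != 0.
Proof.
move=> Uz; have [E [aE PE NE]] := frame_at g_metric S Uz.
apply: contrapT => P0.
have P00 m : P m z = 0.
  apply/matrixP => i j; rewrite [RHS]mxE; apply: contrapT => Pij; apply: P0.
  by exists m, i, j; apply/eqP.
have := PE (inord 0) (inord 2) (inord 4); rewrite !inordK//.
rewrite /fcomp big1 ?mxE; last by move=> k _; rewrite P00 mulmx0 mul0mx scaler0.
by dz_simpl => /esym/eqP; rewrite oner_eq0.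
Qed.

(** lam is only given point by point. Near z it is the quotient of a component of nabla omega by a
    component of Psi+ that does not vanish at z. *)
Lemma differentiable_lam z : U z -> differentiable lam z.
Proof.
move=> Uz; have [m [i [j Pn]]] := P_nonzero Uz.
have dP := msmooth_mdiff (smooth_P S c m) Uz.
have dcW : mdiff (covB g c m W) z.
  exact: mdiff_covB oU Uz (smooth_W g_metric S c) (dch m Uz).
apply: (@differentiable_near _ _ (fun w => covB g c m W w i j * (P m w i j)^-1)).
  have nP : \forall w \near z, P m w i j != 0.
    have : {for z, continuous (fun w => P m w i j)} by exact: differentiable_continuous.
    by move=> /(_ _ (open_nbhs_nbhs (conj (@open_neq _ 0) Pn))).
  have nU : \forall w \near z, U w by exact: open_near oU Uz (fun w Uw => Uw).
  apply: filterS (filterI nP nU) => w [Pw Uw].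
  by rewrite lamW// mxE mulfK.
apply: differentiableM; first exact: dcW.
by apply: differentiableV => //; exact: dP.
Qed.

Lemma lower_A z m : U z -> g c z *m A m z = - lam z *: P m z.
Proof.
move=> Uz; have [_ e] := covB_W g_metric S m Uz.
by rewrite -[LHS]opprK -e lamW// scaleNr.
Qed.

Lemma covB_P z i j : U z -> covB g c i (P j) z =
  Q i j z *m J z + N j z *m A i z + \sum_l chrmx g c i z l j *: P l z.
Proof.
move=> Uz; have dJ := msmooth_mdiff (smooth_J S c) Uz.
have dN l := msmooth_mdiff (smooth_N g_metric S c l) Uz.
have nr : \forall w \near z, P j w = N j w *m J w.
  by apply: open_near oU Uz _ => w Uw; exact: P_eq.
rewrite (covB_near g c i nr) covBM// /Qf /covF (mulmxBl (covB g c i (N j) z)) mulmx_suml.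
have -> : \sum_l (chrmx g c i z l j *: N l z) *m J z = \sum_l chrmx g c i z l j *: P l z.
  by apply: eq_bigr => l _; rewrite -scalemxAl -(P_eq g_metric).
by rewrite [RHS]addrAC subrK.
Qed.

Lemma ricci_W z i j : U z ->
  (riemx g c i j z)^T *m W z + W z *m riemx g c i j z =
  - (partial i lam z *: P j z - partial j lam z *: P i z
     + lam z *: ((Q i j z *m J z + N j z *m A i z) - (Q j i z *m J z + N i z *m A j z))).
Proof.
move=> Uz; have dl := differentiable_lam Uz.
have dP l := msmooth_mdiff (smooth_P S c l) Uz.
have RI := ricci_identity oU Uz (smooth_W g_metric S c) (dch i Uz) (dch j Uz).
have cc a b : covB g c a (covB g c b W) z = partial a lam z *: P b z +
    lam z *: (Q a b z *m J z + N b z *m A a z + \sum_l chrmx g c a z l b *: P l z).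
  have nr : \forall w \near z, covB g c b W w = lam w *: P b w.
    by apply: open_near oU Uz _ => w Uw; exact: lamW.
  by rewrite (covB_near g c a nr) covBZ// covB_P.
apply: alternation_cancel RI (cc i j) (cc j i) _.
by apply: eq_bigr => l _; rewrite (chrmx_sym oU pg).
Qed.

Lemma partial_lam z i : U z -> partial i lam z = 0.
Proof.
move=> Uz; have [E [aE PE NE]] := frame_at g_metric S Uz.
apply: (torsion_constant_point (pg Uz) aE PE NE (A := A ^~ z) (Q := fun m k => Q m k z)
  (Rc := fun i j => riemx g c i j z) (lam := lam z) (dl := fun i => partial i lam z)).
- by move=> m; exact: lower_A.
- by move=> m k; exact: lamQ.
- by move=> a b; exact: riemx_skew oU sg pg _ _ _ Uz.
- by move=> a b; exact: riemx_antisym.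
- by move=> a b k l; exact: riemx_bianchi oU pg _ _ _ _ _ Uz.
- by move=> a b; exact: ricci_W.
Qed.

Lemma ricci_N z i j k : U z ->
  (riemx g c i j z)^T *m N k z + N k z *m riemx g c i j z
    + \sum_l riemx g c i j z l k *: N l z =
  lam z ^+ 2 *: ((omx (P i z) (W z) j k + omx (W z) (P i z) j k)
               - (omx (P j z) (W z) i k + omx (W z) (P j z) i k)).
Proof.
move=> Uz; have dl := differentiable_lam Uz.
have dW := msmooth_mdiff (smooth_W g_metric S c) Uz.
have RI := ricci_identityF k oU Uz (smooth_N g_metric S c) (dch i Uz) (dch j Uz).
have cc a b : covB g c a (Q b k) z - \sum_l chrmx g c a z l k *: Q b l z =
    - lam z *: (lam z *: (omx (P a z) (W z) b k + omx (W z) (P a z) b k)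
      + \sum_l chrmx g c a z l b *: omx (W z) (W z) l k).
  have nr : \forall w \near z, Q b k w = - lam w *: omx (W w) (W w) b k.
    by apply: open_near oU Uz _ => w Uw; exact: lamQ.
  rewrite (covB_near g c a nr) covBZ//; [|exact: differentiableN|exact: mdiff_omx].
  (* As d lam = 0, the second derivative of Psi- contains no derivative of lam. *)
  rewrite partialN// partial_lam// oppr0 scale0r add0r.
  have -> : \sum_l chrmx g c a z l k *: Q b l z =
      - lam z *: \sum_l chrmx g c a z l k *: omx (W z) (W z) b l.
    rewrite scaler_sumr; apply: eq_bigr => l _.
    by rewrite lamQ// !scalerA mulrC.
  by rewrite -scalerBr covB_omx// lamW// omxZl omxZr -scalerDr.
apply: alternation_cancel2 RI (cc i j) (cc j i) _.
by apply: eq_bigr => l _; rewrite (chrmx_sym oU pg).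
Qed.

Lemma scalar_curvature_lam z : U z -> scalar_curvature g c z = 30 * lam z ^+ 2.
Proof.
move=> Uz; have [E [aE PE NE]] := frame_at g_metric S Uz.
rewrite -(scalar_curvature_point (pg Uz) aE PE NE (A := A ^~ z) (Q := fun m k => Q m k z)
  (Rc := fun i j => riemx g c i j z) (lam := lam z) (dl := fun i => partial i lam z)).
- rewrite /scalar_curvature; apply: eq_bigr => j _; apply: eq_bigr => k _; congr (_ * _).
  by apply: eq_bigr => i _; rewrite riemannE.
- by move=> m; exact: lower_A.
- by move=> m k; exact: lamQ.
- by move=> a b; exact: riemx_skew oU sg pg _ _ _ Uz.
- by move=> a b; exact: riemx_antisym.
- by move=> a b k l; exact: riemx_bianchi oU pg _ _ _ _ _ Uz.
- by move=> a b; exact: ricci_W.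
- by move=> a b k; exact: ricci_N.
Qed.

End ChartScale.

(** * Exterior derivative of 2-forms *)

Section Curl.
Context {R : realType} {n : nat}.
Implicit Types (D X : 'I_n -> 'M[R]_n) (K : 'M[R]_n).

(** When D m is the derivative of a 2-form along e_m, this is its exterior derivative. *)
Definition curl D i j k : R := D i j k - D j i k + D k i j.

Lemma eq_curl D X i j k : D =1 X -> curl D i j k = curl X i j k.
Proof. by move=> DX; rewrite /curl !DX. Qed.

Lemma curlD D X i j k : curl (fun m => D m + X m) i j k = curl D i j k + curl X i j k.
Proof.
have mxD (a b : 'M[R]_n) u v : (a + b) u v = a u v + b u v by rewrite mxE.
by rewrite /curl !mxD; ring.
Qed.

Lemma curlN D i j k : curl (fun m => - D m) i j k = - curl D i j k.
Proof. 
have mxN (a : 'M[R]_n) u v : (- a) u v = - a u v by rewrite mxE.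
by rewrite /curl !mxN; ring.
Qed.

Lemma curl_fcomp K D i j k :
  curl (fcomp K D) i j k =
  \sum_a \sum_b \sum_e K a i * K b j * K e k * curl D a b e.
Proof.
rewrite /curl !fcompE.
have -> : \sum_a \sum_b \sum_e K a j * K b i * K e k * D a b e =
    \sum_a \sum_b \sum_e K a i * K b j * K e k * D b a e.
  rewrite exchange_big; do 3 (apply: eq_bigr => ? _ /=); ring.
have -> : \sum_a \sum_b \sum_e K a k * K b i * K e j * D a b e =
    \sum_a \sum_b \sum_e K a i * K b j * K e k * D e a b.
  rewrite exchange_big; apply: eq_bigr => a _; rewrite exchange_big.
  by do 2 (apply: eq_bigr => ? _ /=); ring.
rewrite -sumrB -big_split; apply: eq_bigr => a _ /=.
rewrite -sumrB -big_split; apply: eq_bigr => b _ /=.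
by rewrite -sumrB -big_split; apply: eq_bigr => e _ /=; ring.
Qed.

(** Antisymmetrisation kills symmetric second-order terms: H is the connection in [curl_covB] and
    the Hessian of the coordinate change in [curl_pullback]. *)
Lemma curl_symmetric0 (H : 'I_n -> 'M[R]_n) (L : 'M[R]_n) i j k :
  (forall a p q, H p a q = H q a p) ->
  curl (fun m => (H m)^T *m L - L^T *m H m) i j k = 0.
Proof.
move=> sH.
have E m p q : ((H m)^T *m L - L^T *m H m) p q =
    \sum_a (H m a p * L a q - L a p * H m a q).
  rewrite mxE [X in _ + X]mxE !mxE -sumrB; apply: eq_bigr => a _.
  by rewrite [_^T p a]mxE [_^T p a]mxE.
rewrite /curl !E -sumrB -big_split big1// => a _ /=.
by rewrite (sH a i j) (sH a i k) (sH a j k); ring.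
Qed.

Lemma ext_d2E (M : manifold R n) (T : @ktensor_field R n M 2) (B : 'rV[R]_n -> 'M[R]_n) c y i j k :
  (forall z a b, T c z [tuple a; b] = B z a b) ->
  ext_d T c y [tuple i; j; k] = curl (fun m => dmx m B y) i j k.
Proof.
move=> TB; rewrite /ext_d !big_ord_recl big_ord0 addr0 /curl.
have t0 : tdel [tuple i; j; k] ord0 = [tuple j; k].
  by apply: eq_from_tnth => a; rewrite tnth_mktuple !(tnth_nth k); case: a => -[|[|//]].
have t1 : tdel [tuple i; j; k] (lift ord0 ord0) = [tuple i; k].
  by apply: eq_from_tnth => a; rewrite tnth_mktuple !(tnth_nth k); case: a => -[|[|//]].
have t2 : tdel [tuple i; j; k] (lift ord0 (lift ord0 ord0)) = [tuple i; j].
  by apply: eq_from_tnth => a; rewrite tnth_mktuple !(tnth_nth k); case: a => -[|[|//]].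
rewrite t0 t1 t2 !(tnth_nth k)/= expr0 expr1 mul1r mulN1r addrA.
rewrite (_ : (-1) ^+ bump 0 1 = 1) ?mul1r; last by rewrite expr2 mulN1r opprK.
have E m a b : partial m (fun z => T c z [tuple a; b]) y = dmx m B y a b.
  by rewrite mxE; apply: partial_ext.
by rewrite !E.
Qed.

Lemma curl_covB (M : manifold R n) (g : @matrix_field R n M) c (B : 'rV[R]_n -> 'M[R]_n) y i j k :
  (forall l a b, chrmx g c a y l b = chrmx g c b y l a) -> (B y)^T = - B y ->
  curl (fun m => covB g c m B y) i j k = curl (fun m => dmx m B y) i j k.
Proof.
move=> sG sB.
pose H m := chrmx g c m y.
transitivity (curl (fun m => dmx m B y + - ((H m)^T *m B y - (B y)^T *m H m)) i j k).
  by apply: eq_curl => m; rewrite sB mulNmx opprK opprD addrA.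
by rewrite curlD curlN curl_symmetric0 ?subr0// => a p q; exact: sG.
Qed.

(** Exterior differentiation commutes with pullback, because the second derivatives of T enter
    symmetrically and drop out. *)
Lemma curl_pullback (T : 'rV[R]_n -> 'rV[R]_n) (B : 'rV[R]_n -> 'M[R]_n) V y i j k :
  open V -> V y -> (forall a, smooth_on V (fun z => T z 0 a)) ->
  mdiff B (T y) -> (B (T y))^T = - B (T y) ->
  curl (fun m => dmx m (fun z => (jac T z)^T *m B (T z) *m jac T z) y) i j k =
  \sum_a \sum_b \sum_e jac T y a i * jac T y b j * jac T y e k *
    curl (fun m => dmx m B (T y)) a b e.
Proof.
move=> oV Vy sT dB sB.
have sJ : msmooth V (jac T).
  move=> a b; apply: smooth_on_ext oV _ (smooth_on_partial b (sT a)) => z _.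
  by rewrite mxE.
have dJ := msmooth_mdiff sJ Vy.
have dT a : differentiable (fun z => T z 0 a) y := smooth_on_differentiable (sT a) Vy.
have dBT : mdiff (fun z => B (T z)) y.
  move=> a b; apply: (@differentiable_comp _ _ _ _ T (fun w => B w a b)); last exact: dB.
  exact: differentiable_row.
have BTE m : dmx m (fun z => B (T z)) y = \sum_e jac T y e m *: dmx e B (T y).
  apply/matrixP => a b; rewrite [LHS]mxE (partial_comp m dT (dB a b)) summxE.
  by apply: eq_bigr => e _; rewrite [RHS]mxE [dmx e B _ _ _]mxE mulrC.
have dtJ := mdiff_tr dJ.
pose H m := dmx m (jac T) y; pose L := B (T y) *m jac T y.
have E m : dmx m (fun z => (jac T z)^T *m B (T z) *m jac T z) y =
    fcomp (jac T y) (fun e => dmx e B (T y)) m + ((H m)^T *m L - L^T *m H m).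
  rewrite (dmxM m (mdiffM dtJ dBT) dJ) (dmxM m dtJ dBT) dmx_tr BTE.
  rewrite /L trmx_mul sB mulmxN mulNmx opprK mulmxDl -!mulmxA -/(H m).
  rewrite addrAC addrC; congr (_ + _).
  rewrite /fcomp mulmx_suml mulmx_sumr; apply: eq_bigr => e _.
  by rewrite -scalemxAl -scalemxAr mulmxA.
transitivity (curl (fun m => fcomp (jac T y) (fun e => dmx e B (T y)) m +
    ((H m)^T *m L - L^T *m H m)) i j k).
  exact: eq_curl.
rewrite curlD curl_symmetric0 ?addr0; first exact: curl_fcomp.
move=> a p q; rewrite [LHS]mxE [RHS]mxE.
transitivity (partial p (partial q (fun z => T z 0 a)) y).
  by apply: partial_ext => z; rewrite mxE.
transitivity (partial q (partial p (fun z => T z 0 a)) y).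
  exact: partial_comm oV (sT a) Vy.
by apply: partial_ext => z; rewrite mxE.
Qed.

End Curl.

(** * Independence of the chart *)

Lemma nabla_endoE (R : realType) n (M : manifold R n) (g J : @matrix_field R n M) c y X :
  nabla_endo g J c y X = \sum_m X m 0 *: covE g c m (J c) y.
Proof. by apply: eq_bigr => m _; rewrite nabla_endo_basisE. Qed.

Lemma raiseZ (R : realType) n k (G : 'M[R]_n) (a : R) (T : @ktensor R n k) I :
  raise G (fun K => a * T K) I = a * raise G T I.
Proof. by rewrite /raise mulr_sumr; apply: eq_bigr => K _; rewrite mulrCA. Qed.

Lemma hodgeZ (R : realType) k l (o : R) (G : 'M[R]_(k + l)) (a : R) (T : @ktensor R (k + l) k) L :
  hodge o G (fun K => a * T K) L = a * hodge o G T L.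
Proof.
rewrite /hodge [RHS]mulrCA [X in _ = _ * X]mulr_sumr; congr (_ * _); apply: eq_bigr => I _.
by rewrite raiseZ -mulrA.
Qed.

Lemma open_overlap (R : realType) n (M : manifold R n) (c d : chart M) :
  open (chart_map c @` (chart_dom c `&` chart_dom d)).
Proof.
rewrite openE => y [x [cx dx] <-]; rewrite /interior.
have n1 : nbhs (chart_map c x) (chart_map c @` chart_dom c).
  by apply: open_nbhs_nbhs; split; [exact: chart_image_open|exists x].
have n2 : nbhs (chart_inv c (chart_map c x)) (chart_dom d).
  by rewrite chart_mapK//; apply: open_nbhs_nbhs; split => //; exact: chart_dom_open.
have n3 := chart_inv_continuous cx n2.
apply: filterS (filterI n1 n3) => w [[x' cx' <-]] /=; rewrite chart_mapK// => dx'.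
by exists x'.
Qed.

(* e_p is the only basis vector not annihilated by Psi+ when the other two
   arguments are the partners of p *)
Definition slot_partner (p : nat) : nat * nat :=
  nth (0, 0)%N [:: (2, 4); (3, 4); (4, 0); (4, 1); (0, 2); (0, 3)]%N p.

Lemma re_dz_partner_check : all6 (fun p => all6 (fun q =>
  re_dz q (slot_partner p).1 (slot_partner p).2 == if q == p then (-1) ^+ odd p else 0)).
Proof. by vm_compute. Qed.

Section Global.
Context {R : realType} {M : manifold R 6}.
Variables (g : @matrix_field R 6 M) (g_metric : riemannian_metric g).
Variables (S : su3_structure g) (S_killing : killing g (Psi_minus S)).

(* unique on the image of the chart, as Psi+ has no zeros *)
Definition torsion_scale c z : R :=
  xget 0 [set l | (forall m, covB g c m (Wf S c) z = l *: Pf S c m z) /\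
    forall m k, Qf S c m k z = - l *: omx (Wf S c z) (Wf S c z) m k].

Lemma torsion_scaleW c z m : cimg c z ->
  covB g c m (Wf S c) z = torsion_scale c z *: Pf S c m z.
Proof. by move=> Uz; have [+ _] := xgetPex 0 (torsion_at g_metric S_killing Uz); apply. Qed.

Lemma torsion_scaleQ c z m k : cimg c z ->
  Qf S c m k z = - torsion_scale c z *: omx (Wf S c z) (Wf S c z) m k.
Proof. by move=> Uz; have [_] := xgetPex 0 (torsion_at g_metric S_killing Uz); apply. Qed.

Lemma tr_W c z : cimg c z -> (Wf S c z)^T = - Wf S c z.
Proof.
move=> Uz; have [gT _] := pd_g g_metric Uz.
have e : (Jf S c z)^T *m g c z = - (g c z *m Jf S c z).
  exact: compatible_skew (J_sqr S Uz) (J_compat S Uz).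
by rewrite {2}/Wf e opprK /Wf trmx_mul trmxK gT.
Qed.

Lemma P_swap c z : cimg c z ->
  (forall i j k, Pf S c i z j k = - Pf S c j z i k) /\
  (forall i j k, Pf S c i z j k = - Pf S c i z k j).
Proof.
move=> Uz; have aP := alternating_P S Uz; split => i j k; rewrite [LHS]mxE.
  by rewrite (alternating_swap12 aP) [Pf _ _ _ _ _ _]mxE.
by rewrite (alternating_swap23 aP) [Pf _ _ _ _ _ _]mxE.
Qed.

(** nabla omega = lam Psi+ is alternating, so the three terms of [curl] are equal. *)
Lemma curl_W c z i j k : cimg c z ->
  curl (fun m => dmx m (Wf S c) z) i j k = 3 * torsion_scale c z * Pf S c i z j k.
Proof.
move=> Uz; rewrite -(curl_covB (g := g) (c := c)); last exact: tr_W.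
  rewrite /curl !torsion_scaleW//.
  have mxZ (a : R) (B : 'M[R]_6) u v : (a *: B) u v = a * B u v by rewrite mxE.
  have [s12 s23] := P_swap Uz.
  by rewrite !mxZ (s12 j i k) (s12 k i j) (s23 i k j); ring.
have oU : open (cimg c) := open_cimg (c := c).
have pg := pd_g g_metric (c := c).
by move=> l a b; exact: (chrmx_sym oU pg l a b Uz).
Qed.

Lemma ext_d_omega c z I : cimg c z ->
  ext_d (su3_omega S) c z I = 3 * torsion_scale c z * Psi_plus S c z I.
Proof.
move=> Uz; case: I => -[|i [|j [|k []]]] // sI.
rewrite (_ : Tuple sI = [tuple i; j; k]); last exact: val_inj.
by rewrite (ext_d2E (B := Wf S c)) ?curl_W// mxE.
Qed.

Lemma torsion_scale_chart c d x : chart_dom c x -> chart_dom d x ->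
  torsion_scale c (chart_map c x) = torsion_scale d (chart_map d x).
Proof.
move=> cx dx; pose T y := chart_map d (chart_inv c y); pose y := chart_map c x.
have Uc : cimg c y by exists x.
have Ty : T y = chart_map d x by rewrite /T chart_mapK.
have Ud : cimg d (T y) by rewrite Ty; exists x.
pose V := chart_map c @` (chart_dom c `&` chart_dom d).
have oV : open V by exact: open_overlap.
have Vy : V y by exists x.
have sT a : smooth_on V (fun z => T z 0 a) by exact: transition_smooth.
have nr : \forall z \near y, Wf S c z = (jac T z)^T *m Wf S d (T z) *m jac T z.
  apply: open_near oV Vy _ => _ [x' [cx' dx'] <-].
  have [[_ /(_ _ _ _ cx' dx') gE] _] := g_metric.
  have [[_ /(_ _ _ _ cx' dx') JE] _] := su3_almost_complex S.
  rewrite /Wf /Jf [T _]/T chart_mapK// gE !mulmxA -trmx_mul -[jac T _]/(jac_at c d x').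
  by rewrite JE trmx_mul -!mulmxA.
have dW := msmooth_mdiff (smooth_W g_metric S d) Ud.
have E i j k : 3 * torsion_scale c y * Pf S c i y j k =
    3 * torsion_scale d (T y) * Pf S c i y j k.
  rewrite -curl_W// (eq_curl (X := fun m => dmx m (fun z =>
    (jac T z)^T *m Wf S d (T z) *m jac T z) y)); last by move=> m; exact: dmx_near nr.
  rewrite (curl_pullback _ _ _ oV Vy sT dW (tr_W Ud)).
  rewrite [Pf S c i y j k]mxE; have [[_ PE] _] := Psi_plus_form S.
  rewrite (PE c d x cx dx [tuple i; j; k]) -Ty.
  rewrite [X in _ = _ * X](_ : _ = tframe (jac T y) (Psi_plus S d (T y)) [tuple i; j; k])//.
  rewrite tframe3E mulr_sumr; apply: eq_bigr => a _.
  rewrite mulr_sumr; apply: eq_bigr => b _; rewrite mulr_sumr; apply: eq_bigr => e _.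
  by rewrite curl_W// [Pf _ _ _ _ _ _]mxE mulrCA.
have [i [j [k Pn]]] := P_nonzero g_metric S Uc.
have := E i j k; rewrite Ty => /(mulIf Pn)/(mulfI _); apply.
by rewrite pnatr_eq0.
Qed.

Lemma torsion_scale_constant : connected [set: M] ->
  exists l, forall c x, chart_dom c x -> torsion_scale c (chart_map c x) = l.
Proof.
move=> cM; have [[x0 _]|M0] := pselect (exists x : M, True); last first.
  (* On an empty manifold any constant will do. *)
  by exists 0 => c x _; case: M0; exists x.
have [ch chP] : {ch : M -> chart M | forall x, chart_dom (ch x) x}.
  by exists (fun x => sval (cid (chart_cover x))) => x; case: cid.
pose f x := torsion_scale (ch x) (chart_map (ch x) x).
have fE c x : chart_dom c x -> torsion_scale c (chart_map c x) = f x.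
  by move=> cx; exact: torsion_scale_chart.
have fnear x : \forall x' \near x, f x' = f x.
  have cx := chP x; set c := ch x in cx *.
  have Ux : cimg c (chart_map c x) by exists x.
  have nc : \forall z \near chart_map c x, torsion_scale c z = f x.
    apply: (near_constant (open_cimg (c := c)) Ux) => z.
      move=> Uz; apply: (differentiable_lam g_metric _ Uz) => w m Uw.
      exact: torsion_scaleW.
    move=> i Uz; apply: (partial_lam g_metric _ _ i Uz) => w m.
      exact: torsion_scaleW.
    by move=> k; exact: torsion_scaleQ.
  have n1 : \forall x' \near x, torsion_scale c (chart_map c x') = f x.
    exact: chart_map_continuous cx _ nc.
  have n2 : nbhs x (chart_dom c).
    by apply: open_nbhs_nbhs; split => //; exact: chart_dom_open.
  by apply: filterS (filterI n1 n2) => x' [/= e cx']; rewrite -e (fE c).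
(* A level set of the locally constant f is open and closed. *)
pose B := [set x | f x = f x0].
suff BT : B = [set: M].
  by exists (f x0) => c x cx; rewrite fE//; have : [set: M] x by []; rewrite -BT.
have oB : open B.
  rewrite openE => x Bx; rewrite /interior; apply: filterS (fnear x) => x' /=.
  by rewrite /B/= => ->.
apply: cM; first by exists x0.
  exists B; last by rewrite setTI.
  exact: oB.
exists B; last by rewrite setTI.
rewrite -[B]setCK; apply: open_closedC; rewrite openE => x Bx.
by rewrite /interior; apply: filterS (fnear x) => x'; rewrite /B/= => ->.
Qed.

(** In an adapted frame each coordinate of X is, up to sign, one component of the interior product
    of X with Psi+. *)
Lemma frame_P_injective c z (X : 'cV[R]_6) : cimg c z ->
  \sum_m X m 0 *: Pf S c m z = 0 -> X = 0.
Proof.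
move=> Uz XP; have [E [aE PE _]] := frame_at g_metric S Uz.
have uE := adapted_unitmx aE; pose Y := invmx E *m X.
have XE : X = E *m Y by rewrite mulKVmx.
have Y0 (q r : 'I_6) : \sum_p Y p 0 * (re_dz p q r)%:~R = 0 :> R.
  transitivity ((\sum_p Y p 0 *: fcomp E (Pf S c ^~ z) p) q r).
    by rewrite summxE; apply: eq_bigr => p _; rewrite [RHS]mxE PE.
  rewrite (_ : \sum_p _ = E^T *m (\sum_m X m 0 *: Pf S c m z) *m E).
    by rewrite XP mulmx0 mul0mx mxE.
  rewrite mulmx_sumr mulmx_suml /fcomp; under eq_bigr do rewrite scaler_sumr.
  rewrite exchange_big/=; apply: eq_bigr => m _.
  rewrite XE [(E *m Y) m 0]mxE -scalemxAr -scalemxAl scaler_suml; apply: eq_bigr => p _.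
  by rewrite scalerA mulrC.
suff YE : Y = 0 by rewrite XE YE mulmx0.
apply/matrixP => p q; rewrite (ord1 q) [RHS]mxE.
have /(all6P p)/all6P ck := re_dz_partner_check.
have [l1 l2] : ((slot_partner p).1 < 6)%N /\ ((slot_partner p).2 < 6)%N.
  by case: (p) => -[|[|[|[|[|[|//]]]]]].
have := Y0 (Ordinal l1) (Ordinal l2); rewrite (bigD1 p)//= big1.
  have /eqP -> := ck p; rewrite eqxx addr0 => /eqP.
  by rewrite mulf_eq0 intr_eq0 signr_eq0 orbF => /eqP.
by move=> r; rewrite -val_eqE => /negPf rp; have /eqP -> := ck r; rewrite [X in if X then _ else _]rp mulr0.
Qed.

Lemma g_A c z m : cimg c z -> g c z *m Af S c m z = - torsion_scale c z *: Pf S c m z.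
Proof. by move=> Uz; apply: (lower_A g_metric _ m Uz) => w k; exact: torsion_scaleW. Qed.

Lemma g_nabla_J c z X : cimg c z ->
  g c z *m nabla_endo g (su3_J S) c z X =
  - torsion_scale c z *: \sum_m X m 0 *: Pf S c m z.
Proof.
move=> Uz; rewrite nabla_endoE mulmx_sumr scaler_sumr; apply: eq_bigr => m _.
by rewrite -scalemxAr [covE _ _ _ _ _]/(Af S c m z) g_A// !scalerA mulrC.
Qed.

Lemma nabla_J_eq0 c z X : cimg c z -> torsion_scale c z = 0 ->
  nabla_endo g (su3_J S) c z X = 0.
Proof.
move=> Uz l0; have ug := positive_definite_unitmx (pd_g g_metric Uz).
by apply: (can_inj (mulKmx ug)); rewrite g_nabla_J// l0 oppr0 scale0r mulmx0.
Qed.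

(** After lowering the index this is a multiple of Psi+ (X, ., X) = 0. *)
Lemma nabla_J_diag c z X : cimg c z -> nabla_endo g (su3_J S) c z X *m X = 0.
Proof.
move=> Uz; have ug := positive_definite_unitmx (pd_g g_metric Uz).
apply: (can_inj (mulKmx ug)); rewrite mulmxA g_nabla_J// mulmx0.
rewrite -scalemxAl; suff -> : (\sum_m X m 0 *: Pf S c m z) *m X = 0 by rewrite scaler0.
have [s12 s23] := P_swap Uz.
apply/matrixP => i j; rewrite (ord1 j) [RHS]mxE.
set L := (_ *m X) i 0.
have LE : L = \sum_a \sum_m X m 0 * X a 0 * Pf S c m z i a.
  rewrite /L mxE; apply: eq_bigr => a _; rewrite summxE mulr_suml.
  by apply: eq_bigr => m _; rewrite mxE; ring.
have : L = - L.
  rewrite {1}LE exchange_big LE -sumrN; apply: eq_bigr => a _ /=.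
  rewrite -sumrN; apply: eq_bigr => m _.
  by rewrite (s12 a i m) (s23 i a m) (s12 i m a); ring.
by lra.
Qed.

Lemma strict_nabla_J c z X : cimg c z -> torsion_scale c z != 0 -> X != 0 ->
  nabla_endo g (su3_J S) c z X != 0.
Proof.
move=> Uz l0; apply: contra_neq => NX; apply: (frame_P_injective Uz).
have := g_nabla_J X Uz; rewrite NX mulmx0 => /esym/eqP.
by rewrite scaler_eq0 oppr_eq0 (negPf l0) => /eqP.
Qed.

(** For lam = 0 both nabla J and nabla Psi- vanish, and nabla Psi+ is built from them by the product
    rule. *)
Lemma nabla_Psi_eq0 c z K : cimg c z -> torsion_scale c z = 0 ->
  nabla g (Psi_plus S) c z K = 0 /\ nabla g (Psi_minus S) c z K = 0.
Proof.
move=> Uz l0; have ug := positive_definite_unitmx (pd_g g_metric Uz).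
have A0 m : Af S c m z = 0.
  by apply: (can_inj (mulKmx ug)); rewrite g_A// l0 oppr0 scale0r mulmx0.
have Q0 m k : Qf S c m k z = 0 by rewrite torsion_scaleQ// l0 oppr0 scale0r.
case: K => -[|m [|k [|i [|j []]]]] // sK.
rewrite (_ : Tuple sK = [tuple m; k; i; j]); last exact: val_inj.
split; rewrite nabla3E.
  transitivity ((covB g c m (Pf S c k) z
    - \sum_l chrmx g c m z l k *: Pf S c l z) i j); first by [].
  by rewrite (covB_P g_metric S _ _ Uz) A0 Q0 mul0mx mulmx0 addr0 add0r subrr mxE.
by rewrite -[covF _ _ _ _ _ _]/(Qf S c m k z) Q0 mxE.
Qed.

End Global.

Theorem proposition3p5 (R : realType) (M : manifold R 6)
    (M_connected : connected [set: M])
    (g : @matrix_field R 6 M) (g_metric : riemannian_metric g)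
    (S : su3_structure g) (Psi_minus_killing : killing g (Psi_minus S)) :
  [/\ kaehler g (su3_J S), parallel g (Psi_plus S) & parallel g (Psi_minus S)]
  \/
  (strict_nearly_kaehler g (su3_J S) /\
   exists lambda : R,
     [/\ lambda != 0,
         (forall c x, chart_dom c x -> forall I : 3.-tuple 'I_6,
            Psi_minus S c (chart_map c x) I =
            (3 * lambda)^-1 *
              hodge3 g (su3_J S) (ext_d (su3_omega S)) c (chart_map c x) I) &
         forall c x, chart_dom c x ->
            scalar_curvature g c (chart_map c x) = 30 * lambda ^+ 2]).
Proof.
have [l lE] := torsion_scale_constant g_metric Psi_minus_killing M_connected.
have Uc (c : chart M) x : chart_dom c x -> cimg c (chart_map c x) by exists x.
have [l0|l0] := eqVneq l 0; [left|right].
  split=> [c x cx X|c x cx K|c x cx K].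
  - by apply: (nabla_J_eq0 g_metric Psi_minus_killing); rewrite ?lE//; exact: Uc.
  - by have [] := nabla_Psi_eq0 g_metric Psi_minus_killing K (Uc c x cx) (etrans (lE c x cx) l0).
  - by have [] := nabla_Psi_eq0 g_metric Psi_minus_killing K (Uc c x cx) (etrans (lE c x cx) l0).
split; first split=> c x cx X.
- by apply: (nabla_J_diag g_metric Psi_minus_killing); exact: Uc.
- by apply: (strict_nabla_J g_metric Psi_minus_killing); rewrite ?lE//; exact: Uc.
exists l; split=> // [c x cx I|c x cx].
  (* From d omega = 3 l Psi+, the Hodge star of d omega is 3 l Psi-. *)
  rewrite /hodge3 (_ : ext_d (su3_omega S) c (chart_map c x) =
      fun K => 3 * l * Psi_plus S c (chart_map c x) K); last first.
    by apply/funext => K; rewrite (ext_d_omega g_metric Psi_minus_killing _ (Uc c x cx)) lE.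
  rewrite hodgeZ mulKf//; by rewrite mulf_neq0// pnatr_eq0.
rewrite -(lE c x cx); apply: (scalar_curvature_lam g_metric (S := S) (lam := torsion_scale S c)) => //.
- by move=> z m; exact: torsion_scaleW.
- by move=> z m k; exact: torsion_scaleQ.
- exact: Uc.
Qed.
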